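(* Let $R$ be an associative ring with unit. For every class $\mathbf{B}\subseteq\mathrm{Ch}(R^{op})$ of complexes of right $R$-modules, the class $\mathbf{GF}_{\mathbf{B}}(R)$ of Gorenstein $\mathbf{B}$-flat complexes and the class $\mathbf{GF}^{\otimes^{\cdot}}_{\mathbf{B}}(R)$ of Gorenstein $\mathbf{B}$-flat complexes under $\otimes^{\cdot}$ are precovering Kaplansky classes in $\mathrm{Ch}(R)$.
   Context: Complexes have differentials $\partial_m\colon X_m\to X_{m-1}$; $Z_m$ = cycles, $B_m$ = boundaries; $\mathrm{Ch}(R)$ is the category of complexes of left $R$-modules. For $X\in\mathrm{Ch}(R^{op})$, $Y\in\mathrm{Ch}(R)$, $X\otimes^{\cdot}Y$ is the complex with $(X\otimes^{\cdot}Y)_m=\bigoplus_kX_k\otimes_RY_{m-k}$ and differential $x\otimes y\mapsto\partial x\otimes y+(-1)^kx\otimes\partial y$ ($x\in X_k$); $X\otimes Y$ is the complex with $(X\otimes Y)_m=(X\otimes^{\cdot}Y)_m/B_m(X\otimes^{\cdot}Y)$ and differential $x\otimes y\mapsto\partial x\otimes y$. A complex $F\in\mathrm{Ch}(R)$ is flat if $-\otimes F$ is exact (equivalently, $F$ is exact with flat cycles), and $\otimes^{\cdot}$-flat if $-\otimes^{\cdot}F$ is exact. A complex of complexes $F_\bullet\in\mathrm{Ch}(\mathrm{Ch}(R))$ is $(\mathbf{B}\otimes-)$-acyclic (resp. $(\mathbf{B}\otimes^{\cdot}-)$-acyclic) if $B\otimes F_\bullet$ (resp. $B\otimes^{\cdot}F_\bullet$),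 formed termwise, is exact for every $B\in\mathbf{B}$. $\mathbf{GF}_{\mathbf{B}}(R)$ consists of the complexes $X=Z_0(F_\bullet)$ with $F_\bullet$ exact, $(\mathbf{B}\otimes-)$-acyclic, with flat terms; $\mathbf{GF}^{\otimes^{\cdot}}_{\mathbf{B}}(R)$ consists of the complexes $X=Z_0(F_\bullet)$ with $F_\bullet$ exact, $(\mathbf{B}\otimes^{\cdot}-)$-acyclic, with $\otimes^{\cdot}$-flat terms. A class $\mathcal{A}$ of objects of a Grothendieck category is a Kaplansky class if there is a regular cardinal $\kappa$ such that for any subobject $M\subseteq A$ with $0\neq A\in\mathcal{A}$ and $M$ $\kappa$-generated, there exists a $\kappa$-presentable object $S\neq0$ with $M\subseteq S\subseteq A$ and $S,A/S\in\mathcal{A}$. $\mathcal{A}$ is precovering if every object $M$ has an $\mathcal{A}$-precover, i.e. a morphism $\varphi\colon A\to M$ with $A\in\mathcal{A}$ such that every morphism $A'\to M$ with $A'\in\mathcal{A}$ factors through $\varphi$. *)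

(* Defs.v *)
From HB Require Import structures.
From mathcomp Require Import all_boot all_order all_algebra generic_quotient.
From mathcomp Require Import finmap boolp classical_sets functions cardinality.
From mathcomp.multinomials Require Import freeg.

Set Implicit Arguments.
Unset Strict Implicit.
Unset Printing Implicit Defensive.

Import Order.TTheory GRing.Theory.
Local Open Scope classical_set_scope.
Local Open Scope quotient_scope.
Local Open Scope ring_scope.

Section GeneratedSubgroup.
Variables (A : zmodType) (S : set A).

(* Membership in the subgroup of A generated by S. *)
Definition gen_subgroup : {pred A} := fun x =>
  `[< forall H : set A, H 0 -> (forall u v, H u -> H v -> H (u - v)) ->
        S `<=` H -> H x >].

Lemma gen_subgroup_zmod_closed : zmod_closed gen_subgroup.
Proof.
split=> [|u v /asboolP Gu /asboolP Gv]; apply/asboolP => // H H0 HB SH.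
by apply: (HB); [exact: Gu | exact: Gv].
Qed.

HB.instance Definition _ :=
  GRing.isZmodClosed.Build A gen_subgroup gen_subgroup_zmod_closed.

Lemma gen_subgroup_sub x : S x -> x \in gen_subgroup.
Proof. by move=> Sx; apply/asboolP => H _ _; apply. Qed.

Definition zquo : zmodType := Quotient.quot gen_subgroup.

Definition zpi (x : A) : zquo := \pi_(zquo) x.

Lemma zpi_is_additive : zmod_morphism zpi.
Proof. by move=> x y; rewrite /zpi !piE. Qed.

HB.instance Definition _ :=
  GRing.isZmodMorphism.Build A zquo zpi zpi_is_additive.

Lemma zpi_repr (z : zquo) : zpi (repr z) = z.
Proof. exact: reprK. Qed.

Lemma zpi_surj (z : zquo) : exists x, zpi x = z.
Proof. by exists (repr z); rewrite zpi_repr. Qed.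

Lemma zpi_eq0 x : (zpi x == 0) = (x \in gen_subgroup).
Proof.
by rewrite -[x in RHS]subr0 Quotient.idealrBE /zpi !piE.
Qed.

Lemma zpi_rel x : S x -> zpi x = 0.
Proof. by move=> Sx; apply/eqP; rewrite zpi_eq0 gen_subgroup_sub. Qed.

Section Lift.
Variables (C : zmodType) (f : {additive A -> C}).
Hypothesis fS : forall x, S x -> f x = 0.

Lemma lift_ker x : zpi x = 0 -> f x = 0.
Proof.
move/eqP; rewrite zpi_eq0 => /asboolP /(_ [set x | f x = 0]); apply.
- exact: raddf0.
- by move=> u v /= fu fv; rewrite raddfB fu fv subr0.
- exact: fS.
Qed.

Definition zquo_lift_fun of (forall x, S x -> f x = 0) :=
  fun z : zquo => f (repr z).

Lemma zquo_lift_funE x : zquo_lift_fun fS (zpi x) = f x.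
Proof.
apply/eqP; rewrite -subr_eq0 -raddfB; apply/eqP/lift_ker.
by apply/eqP; rewrite raddfB subr_eq0; apply/eqP/zpi_repr.
Qed.

Lemma zquo_lift_is_additive : zmod_morphism (zquo_lift_fun fS).
Proof.
move=> u v; have [[x <-] [y <-]] := (zpi_surj u, zpi_surj v).
by rewrite -raddfB !zquo_lift_funE raddfB.
Qed.

HB.instance Definition _ :=
  GRing.isZmodMorphism.Build zquo C (zquo_lift_fun fS) zquo_lift_is_additive.

Definition zquo_lift : {additive zquo -> C} := zquo_lift_fun fS.

Lemma zquo_liftE x : zquo_lift (zpi x) = f x.
Proof. exact: zquo_lift_funE. Qed.

End Lift.

End GeneratedSubgroup.

Section DirectSum.
Variables (I : choiceType) (T : I -> zmodType).

Record dsum := DSum {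
  dcoord : forall k, T k;
  dsum_fin : finite_set [set k | dcoord k != 0] }.

Lemma dsum_eq (x y : dsum) : (forall k, dcoord x k = dcoord y k) -> x = y.
Proof.
case: x y => [x fx] [y fy] /= exy.
have {}exy : x = y by apply: functional_extensionality_dep.
by move: exy fx fy => -> fx fy; congr DSum; exact: Prop_irrelevance.
Qed.

HB.instance Definition _ := gen_eqMixin dsum.
HB.instance Definition _ := gen_choiceMixin dsum.

Lemma dsum0_fin : finite_set [set k | (0 : T k) != 0].
Proof.
rewrite (_ : [set _ | _] = set0) ?predeqE; first exact: finite_set0.
by move=> k; split=> //=; rewrite eqxx.
Qed.

Lemma dsumN_fin (x : dsum) : finite_set [set k | - dcoord x k != 0].
Proof.
by apply: sub_finite_set (dsum_fin x) => k /=; rewrite oppr_eq0.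
Qed.

Lemma dsumD_fin (x y : dsum) :
  finite_set [set k | dcoord x k + dcoord y k != 0].
Proof.
have : finite_set ([set k | dcoord x k != 0] `|` [set k | dcoord y k != 0]).
  by rewrite finite_setU; split; exact: dsum_fin.
apply: sub_finite_set => k /=; case: (eqVneq (dcoord x k) 0).
  by move=> ->; rewrite add0r; right.
by left.
Qed.

Let d0 := DSum dsum0_fin.
Let dN x := DSum (dsumN_fin x).
Let dD x y := DSum (dsumD_fin x y).

Fact dsum_addA : associative dD.
Proof. by move=> x y z; apply: dsum_eq => k /=; rewrite addrA. Qed.
Fact dsum_addC : commutative dD.
Proof. by move=> x y; apply: dsum_eq => k /=; rewrite addrC. Qed.
Fact dsum_add0 : left_id d0 dD.
Proof. by move=> x; apply: dsum_eq => k /=; rewrite add0r. Qed.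
Fact dsum_addN : left_inverse d0 dN dD.
Proof. by move=> x; apply: dsum_eq => k /=; rewrite addNr. Qed.

HB.instance Definition _ :=
  GRing.isZmodule.Build dsum dsum_addA dsum_addC dsum_add0 dsum_addN.

Lemma dcoordB (x y : dsum) k : dcoord (x - y) k = dcoord x k - dcoord y k.
Proof. by []. Qed.

Definition din_coord k (t : T k) j : T j :=
  if k =P j is ReflectT e then ecast i (T i) e t else 0.

Lemma din_coord_id k (t : T k) : din_coord t k = t.
Proof.
rewrite /din_coord; case: eqP => // e.
by rewrite (eq_irrelevance e (erefl k)).
Qed.

Lemma din_coord_ne k (t : T k) j : k != j -> din_coord t j = 0.
Proof. by rewrite /din_coord; case: eqP. Qed.

Lemma din_fin k (t : T k) : finite_set [set j | din_coord t j != 0].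
Proof.
apply: (@sub_finite_set _ _ [set k]); last exact: finite_set1.
move=> j /= tj; apply: contra_neq_eq tj => kj.
by rewrite din_coord_ne // eq_sym.
Qed.

Definition din k (t : T k) : dsum := DSum (din_fin t).

Lemma din_is_additive k : zmod_morphism (@din k).
Proof.
move=> x y; apply: dsum_eq => j; rewrite dcoordB /= /din_coord.
by case: eqP => [e|]; [case: j / e | rewrite subr0].
Qed.

HB.instance Definition _ k :=
  GRing.isZmodMorphism.Build (T k) dsum (@din k) (@din_is_additive k).

Definition dinj k : {additive T k -> dsum} := @din k.

Lemma mem_dsupp (x : dsum) k :
  (k \in fset_set [set j | dcoord x j != 0]) = (dcoord x k != 0).
Proof.
by rewrite in_fset_set; [apply/idP/idP; rewrite inE | exact: dsum_fin].
Qed.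

Lemma dsum_sumE (x : dsum) :
  x = \sum_(k <- fset_set [set k | dcoord x k != 0]) din (dcoord x k).
Proof.
have dcoord_sum (r : seq I) j : dcoord (\sum_(k <- r) din (dcoord x k)) j =
    \sum_(k <- r) din_coord (dcoord x k) j.
  by elim: r => [|k r IH]; rewrite ?big_nil ?big_cons //= IH.
apply: dsum_eq => j; rewrite dcoord_sum.
case: (eqVneq (dcoord x j) 0) => [xj0|xjn0].
  rewrite xj0 big1 // => k _; case: (eqVneq k j) => [->|/din_coord_ne //].
  by rewrite din_coord_id xj0.
rewrite (bigD1_seq j) ?fset_uniq ?mem_dsupp //=.
by rewrite din_coord_id big1 ?addr0 // => k /din_coord_ne.
Qed.

Section Lift.
Variables (C : zmodType) (f : forall k, {additive T k -> C}).

Definition dlift_fun (x : dsum) : C :=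
  \sum_(k <- fset_set [set k | dcoord x k != 0]) f k (dcoord x k).

Lemma dlift_funE (x : dsum) (r : seq I) : uniq r ->
  (forall k, dcoord x k != 0 -> k \in r) ->
  dlift_fun x = \sum_(k <- r) f k (dcoord x k).
Proof.
move=> ur xr; rewrite [RHS](bigID (fun k => dcoord x k != 0)) /= addrC.
rewrite [X in _ = X + _]big1 ?add0r => [|k /negPn/eqP ->]; last exact: raddf0.
rewrite -[RHS]big_filter; apply: perm_big; apply: uniq_perm.
- exact: fset_uniq.
- exact: filter_uniq.
- by move=> k; rewrite mem_dsupp mem_filter; case: eqVneq => //= /xr ->.
Qed.

Lemma dlift_is_additive : zmod_morphism dlift_fun.
Proof.
move=> x y.
pose s (z : dsum) : seq I := fset_set [set k | dcoord z k != 0].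
pose r := undup (s x ++ s y).
have ur : uniq r by exact: undup_uniq.
have xr k : dcoord x k != 0 -> k \in r.
  by move=> xk; rewrite mem_undup mem_cat mem_dsupp xk.
have yr k : dcoord y k != 0 -> k \in r.
  by move=> yk; rewrite mem_undup mem_cat orbC mem_dsupp yk.
rewrite !(dlift_funE ur) //; last first.
  move=> k; rewrite dcoordB; case: (eqVneq (dcoord x k) 0) => [->|/xr //].
  by rewrite sub0r oppr_eq0 => /yr.
by rewrite -sumrB; apply: eq_bigr => k _; rewrite dcoordB raddfB.
Qed.

HB.instance Definition _ :=
  GRing.isZmodMorphism.Build dsum C dlift_fun dlift_is_additive.

Definition dlift : {additive dsum -> C} := dlift_fun.

Lemma dlift_din k (t : T k) : dlift (din t) = f k t.
Proof.
rewrite /= (@dlift_funE _ [:: k]) //= ?big_seq1 ?din_coord_id // => j.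
by rewrite inE; apply: contraNT => jk; rewrite din_coord_ne // eq_sym.
Qed.

End Lift.

Lemma dsum_ext (C : zmodType) (f g : {additive dsum -> C}) :
  (forall k t, f (@din k t) = g (din t)) -> f =1 g.
Proof.
move=> fg x; rewrite (dsum_sumE x) !raddf_sum.
by apply: eq_bigr => k _; exact: fg.
Qed.

End DirectSum.

(* A right R-module is a left module over the converse ring R^c, so that
   (r : R^c) *: m is m r. *)
Section Tensor.
Variables (R : pzRingType) (M : lmodType R^c) (N : lmodType R).

Let gen (m : M) (n : N) : {freeg (M * N)%type / int} := << (m, n) >>.

Definition tensor_rel : set {freeg (M * N)%type / int} :=
  [set z | [\/ exists m m' n, z = gen (m + m') n - gen m n - gen m' n,
               exists m n n', z = gen m (n + n') - gen m n - gen m n' |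
               exists m (r : R) n,
                 z = gen ((r : R^c) *: m) n - gen m (r *: n)]].

Definition tensor : zmodType := zquo tensor_rel.

Definition tmk (m : M) (n : N) : tensor := zpi tensor_rel (gen m n).

Lemma tmkDl m m' n : tmk (m + m') n = tmk m n + tmk m' n.
Proof.
apply/eqP; rewrite -subr_eq0 opprD addrA; apply/eqP.
by rewrite -!raddfB; apply: zpi_rel; apply: Or31; exists m, m', n.
Qed.

Lemma tmkDr m n n' : tmk m (n + n') = tmk m n + tmk m n'.
Proof.
apply/eqP; rewrite -subr_eq0 opprD addrA; apply/eqP.
by rewrite -!raddfB; apply: zpi_rel; apply: Or32; exists m, n, n'.
Qed.

Lemma tmk_balanced m (r : R) n : tmk ((r : R^c) *: m) n = tmk m (r *: n).
Proof.
apply/eqP; rewrite -subr_eq0; apply/eqP.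
by rewrite -!raddfB; apply: zpi_rel; apply: Or33; exists m, r, n.
Qed.

Section Lift.
Variables (C : zmodType) (f : M -> N -> C).

Definition balanced_biadditive : Prop :=
  [/\ forall m m' n, f (m + m') n = f m n + f m' n,
      forall m n n', f m (n + n') = f m n + f m n' &
      forall m (r : R) n, f ((r : R^c) *: m) n = f m (r *: n)].

Definition tensor_free_lift (z : {freeg (M * N)%type / int}) : C :=
  fglift (fun p => f p.1 p.2 : zmodule C) z.

Lemma tensor_free_lift_is_additive : zmod_morphism tensor_free_lift.
Proof.
exact: (@lift_is_additive _ _ (zmodule C : lmodType int) (fun p => f p.1 p.2)).
Qed.

HB.instance Definition _ := GRing.isZmodMorphism.Build
  {freeg (M * N)%type / int} C tensor_free_lift tensor_free_lift_is_additive.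

Lemma tensor_free_liftE m n : tensor_free_lift (gen m n) = f m n.
Proof. by rewrite /tensor_free_lift liftU scale1r. Qed.

Hypothesis fP : balanced_biadditive.

Lemma tensor_free_lift_rel z : tensor_rel z -> tensor_free_lift z = 0.
Proof.
case: fP => fDl fDr fb; case=> -[a [b [c ->]]].
all: rewrite !raddfB /= !tensor_free_liftE.
- by rewrite fDl addrAC addrK subrr.
- by rewrite fDr addrAC addrK subrr.
- by rewrite fb subrr.
Qed.

Definition tensor_lift : {additive tensor -> C} :=
  zquo_lift tensor_free_lift_rel.

Lemma tensor_lift_tmk m n : tensor_lift (tmk m n) = f m n.
Proof. by rewrite /tensor_lift zquo_liftE /= tensor_free_liftE. Qed.

End Lift.

Lemma tensor_ext (C : zmodType) (f g : {additive tensor -> C}) :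
  (forall m n, f (tmk m n) = g (tmk m n)) -> f =1 g.
Proof.
move=> fg z; have [x <-] := zpi_surj z.
rewrite -(freeg_sumE x) !raddf_sum; apply: eq_bigr => -[m n] _.
by rewrite -[coeff _ _]intz -freegU_mulz !raddfMz fg.
Qed.

End Tensor.
Arguments tmk : simpl never.

Section TensorMap.
Variables (R : pzRingType) (M M' : lmodType R^c) (N N' : lmodType R).
Variables (f : {linear M -> M'}) (g : {linear N -> N'}).

Lemma tensor_map_balanced :
  balanced_biadditive (fun m n => tmk (f m) (g n)).
Proof.
split=> [m m' n|m n n'|m r n].
- by rewrite linearD tmkDl.
- by rewrite linearD tmkDr.
- by rewrite !linearZ tmk_balanced.
Qed.

Definition tensor_map : {additive tensor M N -> tensor M' N'} :=
  tensor_lift tensor_map_balanced.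

Lemma tensor_map_tmk m n : tensor_map (tmk m n) = tmk (f m) (g n).
Proof. exact: tensor_lift_tmk. Qed.

End TensorMap.

(* Ch(R); Ch(R^op) is [complex R^c], and complexes of abelian groups are the
   objects of [complex int], through the alias [zmodule]. *)
Record complex (R : pzRingType) := Complex {
  cobj :> int -> lmodType R;
  cdiff : forall m, {linear cobj m -> cobj (m - 1)};
  cdiffK : forall m x, cdiff (m - 1) (cdiff m x) = 0 }.

Record cmor (R : pzRingType) (X Y : complex R) := CMor {
  cmap :> forall m, {linear X m -> Y m};
  cmap_diff : forall m x, cmap (m - 1) (cdiff X m x) = cdiff Y m (cmap m x) }.

Definition ceq (R : pzRingType) (X Y : complex R) (f g : cmor X Y) : Prop :=
  forall m, f m =1 g m.
Notation "f =c g" := (ceq f g) (at level 70).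

Section ComplexTheory.
Variable R : pzRingType.
Implicit Types X Y Z : complex R.

Definition cmor_id X : cmor X X :=
  @CMor R X X (fun m => idfun) (fun m x => erefl).

Fact cmor_comp_diff X Y Z (g : cmor Y Z) (f : cmor X Y) m x :
  (g (m - 1) \o f (m - 1))%FUN (cdiff X m x) = cdiff Z m ((g m \o f m)%FUN x).
Proof. by rewrite /= !cmap_diff. Qed.

Definition cmor_comp X Y Z (g : cmor Y Z) (f : cmor X Y) : cmor X Z :=
  CMor (cmor_comp_diff g f).

Definition ccast X (a b : int) (e : a = b) : {linear X a -> X b} :=
  match e in _ = b return {linear X a -> X b} with erefl => idfun end.

Lemma ccast_id X a (e : a = a) x : ccast X e x = x.
Proof. by rewrite (eq_irrelevance e erefl). Qed.

Lemma ccast_comp X a b c (e : a = b) (e' : b = c) x :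
  ccast X e' (ccast X e x) = ccast X (etrans e e') x.
Proof. by case: c / e'; case: b / e. Qed.

Lemma ccast_irr X a b (e e' : a = b) x : ccast X e x = ccast X e' x.
Proof. by rewrite (eq_irrelevance e e'). Qed.

Lemma ccast_diff X a b (e : a = b) (e' : a - 1 = b - 1) x :
  cdiff X b (ccast X e x) = ccast X e' (cdiff X a x).
Proof. by case: b / e e' => e'; rewrite !ccast_id. Qed.

Lemma cmap_cast X Y (f : cmor X Y) a b (e : a = b) x :
  f b (ccast X e x) = ccast Y e (f a x).
Proof. by case: b / e. Qed.

Definition boundary X m : set (X m) :=
  [set x | exists n (e : n - 1 = m) (y : X n), x = ccast X e (cdiff X n y)].

Definition cinj X Y (f : cmor X Y) : Prop := forall m, injective (f m).

Definition csurj X Y (f : cmor X Y) : Prop := forall m y, exists x, f m x = y.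

Definition exact_at X Y Z (f : cmor X Y) (g : cmor Y Z) : Prop :=
  forall m (y : Y m), g m y = 0 <-> exists x, f m x = y.

Definition short_exact X Y Z (f : cmor X Y) (g : cmor Y Z) : Prop :=
  [/\ cinj f, exact_at f g & csurj g].

Definition cnonzero X : Prop := exists m (x : X m), x <> 0.

Record ccomplex := CComplex {
  ccobj :> int -> complex R;
  ccdiff : forall n, cmor (ccobj n) (ccobj (n - 1));
  ccdiffK : forall n m x, ccdiff (n - 1) m (ccdiff n m x) = 0 }.

(* Every integer is of the form n - 1, so this is exactness at every term. *)
Definition ccexact (F : ccomplex) : Prop :=
  forall n, exact_at (ccdiff F n) (ccdiff F (n - 1)).

(* X = Z_0(F), up to isomorphism: X is a kernel of F_0 -> F_(-1). *)
Definition is_Z0 (F : ccomplex) X : Prop :=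
  exists i : cmor X (F 0), cinj i /\ exact_at i (ccdiff F 0).

End ComplexTheory.

Arguments boundary {R} X m _.

Section ZLinear.
Variables (A B : zmodType) (f : {additive A -> B}).

Definition zlin_fun (x : zmodule A) : zmodule B := f x.

Fact zlin_is_linear : linear zlin_fun.
Proof. by move=> n x y; rewrite /zlin_fun raddfD !scalezrE raddfMz. Qed.

HB.instance Definition _ := GRing.isLinear.Build int (zmodule A) (zmodule B) _
  zlin_fun zlin_is_linear.

Definition zlin : {linear zmodule A -> zmodule B} := zlin_fun.

End ZLinear.

Section AddMulz.
Variables (A B : zmodType) (f g : {additive A -> B}) (n : int).

Definition addmulz_fun (x : A) : B := f x + g x *~ n.

Fact addmulz_is_additive : zmod_morphism addmulz_fun.
Proof.
by move=> s t; rewrite /addmulz_fun !raddfB mulrzBl opprD addrACA.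
Qed.

HB.instance Definition _ := GRing.isZmodMorphism.Build A B
  addmulz_fun addmulz_is_additive.

Definition addmulz : {additive A -> B} := addmulz_fun.

End AddMulz.

(* The prefix [dot] refers to the total tensor product (X (x)^. Y), and [bar]
   to its quotient (X (x) Y) by boundaries. The maps on them are locked because
   unification would otherwise unfold them through the quotients. *)
Definition dot_obj (R : pzRingType) (X : complex R^c) (Y : complex R) (m : int)
    : zmodType :=
  dsum (fun k : int => tensor (X k) (Y (m - k))).

Section DotTensor.
Variables (R : pzRingType) (X : complex R^c) (Y : complex R) (m : int).

Definition dot_in k
  : {additive tensor (X k) (Y (m - k)) -> dot_obj X Y m} :=
  @dinj _ (fun k : int => tensor (X k) (Y (m - k))) k.

Definition dot_mk k (x : X k) (y : Y (m - k)) : dot_obj X Y m :=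
  dot_in k (tmk x y).

Lemma dot_mk0l k (y : Y (m - k)) : dot_mk (0 : X k) y = 0.
Proof.
suff t0 : tmk (0 : X k) y = 0 by rewrite /dot_mk t0 raddf0.
by apply: (addrI (tmk (0 : X k) y)); rewrite -tmkDl !addr0.
Qed.

Lemma dot_mk0r k (x : X k) : dot_mk x (0 : Y (m - k)) = 0.
Proof.
suff t0 : tmk x (0 : Y (m - k)) = 0 by rewrite /dot_mk t0 raddf0.
by apply: (addrI (tmk x (0 : Y (m - k)))); rewrite -tmkDr !addr0.
Qed.

Lemma dot_ext (C : zmodType) (f g : {additive dot_obj X Y m -> C}) :
  (forall k (x : X k) (y : Y (m - k)), f (dot_mk x y) = g (dot_mk x y)) ->
  f =1 g.
Proof.
move=> fg; apply: dsum_ext => k t.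
exact: (@tensor_ext _ _ _ _ (f \o dot_in k) (g \o dot_in k) (@fg k) t).
Qed.

End DotTensor.
Arguments dot_mk : simpl never.

Fact dot_index_l (m k : int) : m - k = m - 1 - (k - 1).
Proof. by rewrite opprB addrA addrNK. Qed.

Fact dot_index_r (m k : int) : m - k - 1 = m - 1 - k.
Proof. exact: addrAC. Qed.

(* x (x) y |-> dx (x) y; the cast identifies Y_(m-k) and Y_((m-1)-(k-1)). *)
Definition dot_diffl_at (R : pzRingType) (X : complex R^c) (Y : complex R)
    (m k : int) : {additive tensor (X k) (Y (m - k)) -> dot_obj X Y (m - 1)} :=
  dot_in X Y (m - 1) (k - 1) \o
  tensor_map (cdiff X k) (ccast Y (dot_index_l m k)).

(* x (x) y |-> x (x) dy *)
Definition dot_diffr_at (R : pzRingType) (X : complex R^c) (Y : complex R)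
    (m k : int) : {additive tensor (X k) (Y (m - k)) -> dot_obj X Y (m - 1)} :=
  dot_in X Y (m - 1) k \o
  tensor_map idfun (ccast Y (dot_index_r m k) \o cdiff Y (m - k)).

HB.lock Definition dot_diffl (R : pzRingType) (X : complex R^c) (Y : complex R)
    (m : int) (z : dot_obj X Y m) : dot_obj X Y (m - 1) :=
  dlift (dot_diffl_at X Y m) z.

HB.lock Definition dot_diff (R : pzRingType) (X : complex R^c) (Y : complex R)
    (m : int) (z : dot_obj X Y m) : dot_obj X Y (m - 1) :=
  dlift (fun k => addmulz (dot_diffl_at X Y m k) (dot_diffr_at X Y m k)
                    ((-1) ^ k)) z.

Section Differential.
Variables (R : pzRingType) (X : complex R^c) (Y : complex R) (m : int).

Fact dot_diffl_is_additive : zmod_morphism (@dot_diffl R X Y m).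
Proof. by rewrite dot_diffl.unlock => u v; exact: raddfB. Qed.

HB.instance Definition _ := GRing.isZmodMorphism.Build
  (dot_obj X Y m) (dot_obj X Y (m - 1)) (@dot_diffl R X Y m)
  dot_diffl_is_additive.

Fact dot_diff_is_additive : zmod_morphism (@dot_diff R X Y m).
Proof. by rewrite dot_diff.unlock => u v; exact: raddfB. Qed.

HB.instance Definition _ := GRing.isZmodMorphism.Build
  (dot_obj X Y m) (dot_obj X Y (m - 1)) (@dot_diff R X Y m)
  dot_diff_is_additive.

Lemma dot_diffl_at_tmk k (x : X k) (y : Y (m - k)) :
  dot_diffl_at X Y m k (tmk x y) =
    dot_mk (cdiff X k x) (ccast Y (dot_index_l m k) y).
Proof.
exact: (congr1 (dot_in X Y (m - 1) (k - 1)) (tensor_map_tmk _ _ x y)).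
Qed.

Lemma dot_diffr_at_tmk k (x : X k) (y : Y (m - k)) :
  dot_diffr_at X Y m k (tmk x y) =
    dot_mk x (ccast Y (dot_index_r m k) (cdiff Y (m - k) y)).
Proof.
exact: (congr1 (dot_in X Y (m - 1) k) (tensor_map_tmk _ _ x y)).
Qed.

Lemma dot_diffl_mk k (x : X k) (y : Y (m - k)) :
  dot_diffl (dot_mk x y) =
    dot_mk (cdiff X k x) (ccast Y (dot_index_l m k) y).
Proof. by rewrite -dot_diffl_at_tmk dot_diffl.unlock; exact: dlift_din. Qed.

Lemma dot_diff_mk k (x : X k) (y : Y (m - k)) :
  dot_diff (dot_mk x y) =
    dot_mk (cdiff X k x) (ccast Y (dot_index_l m k) y) +
    dot_mk x (ccast Y (dot_index_r m k) (cdiff Y (m - k) y)) *~ (-1) ^ k.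
Proof.
rewrite -dot_diffl_at_tmk -dot_diffr_at_tmk dot_diff.unlock; exact: dlift_din.
Qed.

End Differential.

Section DifferentialTheory.
Variables (R : pzRingType) (X : complex R^c) (Y : complex R).

Lemma dot_diffK m (z : dot_obj X Y m) : dot_diff (dot_diff z) = 0.
Proof.
apply: (@dot_ext _ X Y m _
  (@dot_diff R X Y (m - 1) \o @dot_diff R X Y m) \0) => k x y.
rewrite -[LHS]/(dot_diff (dot_diff (dot_mk x y))) -[RHS]/0.
rewrite dot_diff_mk raddfD raddfMz /= !dot_diff_mk.
rewrite cdiffK dot_mk0l add0r mulrzDl.
set e1 := dot_index_l m k; set e2 := dot_index_r m k.
set e3 := dot_index_r (m - 1) (k - 1).
set e4 := dot_index_l (m - 1) k; set e5 := dot_index_r (m - 1) k.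
have e : m - k - 1 = m - 1 - (k - 1) - 1 by rewrite e1.
have e' : m - k - 1 - 1 = m - 1 - k - 1 by rewrite e2.
rewrite (ccast_diff e1 e) (ccast_diff e2 e') cdiffK !raddf0.
rewrite dot_mk0r mul0rz mul0rz addr0.
rewrite !ccast_comp (ccast_irr (etrans e e3) (etrans e2 e4)) -mulrzDr.
by rewrite exprzDr ?unitrN1 // mulrN1 addNr.
Qed.

Lemma dot_difflK m (z : dot_obj X Y m) : dot_diffl (dot_diffl z) = 0.
Proof.
apply: (@dot_ext _ X Y m _
  (@dot_diffl R X Y (m - 1) \o @dot_diffl R X Y m) \0) => k x y.
rewrite -[LHS]/(dot_diffl (dot_diffl (dot_mk x y))) -[RHS]/0.
by rewrite !dot_diffl_mk cdiffK dot_mk0l.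
Qed.

Lemma dot_diffl_anti m (z : dot_obj X Y m) :
  dot_diffl (dot_diff z) =
  - dot_diff (dot_diffl z).
Proof.
apply: (@dot_ext _ X Y m _ (@dot_diffl R X Y (m - 1) \o @dot_diff R X Y m)
  (-%R \o (@dot_diff R X Y (m - 1) \o @dot_diffl R X Y m))) => k x y.
rewrite -[LHS]/(dot_diffl (dot_diff (dot_mk x y))).
rewrite -[RHS]/(- (dot_diff (dot_diffl (dot_mk x y)))).
rewrite dot_diff_mk raddfD raddfMz /= !dot_diffl_mk dot_diff_mk.
rewrite cdiffK !dot_mk0l !add0r.
set e1 := dot_index_l m k; set e2 := dot_index_r m k.
set e3 := dot_index_r (m - 1) (k - 1); set e4 := dot_index_l (m - 1) k.
have e : m - k - 1 = m - 1 - (k - 1) - 1 by rewrite e1.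
rewrite (ccast_diff e1 e) !ccast_comp (ccast_irr (etrans e e3) (etrans e2 e4)).
by rewrite exprzDr ?unitrN1 // mulrN1 mulrNz opprK.
Qed.

Definition dot_tensor : complex int :=
  @Complex int (fun m => zmodule (dot_obj X Y m))
    (fun m => zlin (@dot_diff R X Y m)) dot_diffK.

Definition bar_obj m : zmodType :=
  @zquo (dot_obj X Y m) (boundary dot_tensor m).

Definition bar_pi m (z : dot_obj X Y m) : bar_obj m :=
  zpi (boundary dot_tensor m) z.

HB.instance Definition _ m := GRing.isZmodMorphism.Build
  (dot_obj X Y m) (bar_obj m) (@bar_pi m)
  (@zpi_is_additive (dot_obj X Y m) (boundary dot_tensor m)).

Lemma bar_pi_surj m (z : bar_obj m) : exists w, bar_pi w = z.
Proof. exact: zpi_surj. Qed.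

Fact bar_diff_boundary m (z : dot_obj X Y m) :
  boundary dot_tensor m z ->
  (@bar_pi (m - 1) \o @dot_diffl R X Y m) z = 0.
Proof.
move=> -[n [e [w ->]]]; case: m / e z => _; rewrite ccast_id.
apply: zpi_rel; exists (n - 1), erefl, (- dot_diffl w).
by rewrite ccast_id raddfN; exact: dot_diffl_anti.
Qed.

End DifferentialTheory.

HB.lock Definition bar_diff (R : pzRingType) (X : complex R^c) (Y : complex R)
    (m : int) (z : bar_obj X Y m) : bar_obj X Y (m - 1) :=
  zquo_lift (@bar_diff_boundary R X Y m) z.

Arguments bar_pi : simpl never.

Section BarTensor.
Variables (R : pzRingType) (X : complex R^c) (Y : complex R).

Fact bar_diff_is_additive m : zmod_morphism (@bar_diff R X Y m).
Proof. by rewrite bar_diff.unlock => u v; exact: raddfB. Qed.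

HB.instance Definition _ m := GRing.isZmodMorphism.Build
  (bar_obj X Y m) (bar_obj X Y (m - 1)) (@bar_diff R X Y m)
  (@bar_diff_is_additive m).

Lemma bar_diff_pi m (z : dot_obj X Y m) :
  bar_diff (bar_pi z) = bar_pi (dot_diffl z).
Proof. rewrite bar_diff.unlock; exact: zquo_liftE. Qed.

Fact bar_diffK m (z : bar_obj X Y m) : bar_diff (bar_diff z) = 0.
Proof.
have [w <-] := bar_pi_surj z.
by rewrite !bar_diff_pi dot_difflK raddf0.
Qed.

Definition bar_tensor : complex int :=
  @Complex int (fun m => zmodule (bar_obj X Y m))
    (fun m => zlin (@bar_diff R X Y m)) bar_diffK.

End BarTensor.

HB.lock Definition dot_map_at (R : pzRingType) (X X' : complex R^c)
    (Y Y' : complex R) (f : cmor X X') (g : cmor Y Y') (m : int)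
    (z : dot_obj X Y m) : dot_obj X' Y' m :=
  dlift (fun k => dot_in X' Y' m k \o tensor_map (f k) (g (m - k))) z.

Arguments dot_map_at {R X X' Y Y'} f g m z.

Section DotMap.
Variables (R : pzRingType) (X X' : complex R^c) (Y Y' : complex R).
Variables (f : cmor X X') (g : cmor Y Y').

Fact dot_map_at_is_additive m : zmod_morphism (dot_map_at f g m).
Proof. by rewrite dot_map_at.unlock => u v; exact: raddfB. Qed.

HB.instance Definition _ m := GRing.isZmodMorphism.Build
  (dot_obj X Y m) (dot_obj X' Y' m) (dot_map_at f g m)
  (@dot_map_at_is_additive m).

Lemma dot_map_mk m k (x : X k) (y : Y (m - k)) :
  dot_map_at f g m (dot_mk x y) = dot_mk (f k x) (g (m - k) y).
Proof.
rewrite /dot_mk -tensor_map_tmk dot_map_at.unlock; exact: dlift_din.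
Qed.

Fact dot_map_diff m (z : dot_obj X Y m) :
  dot_map_at f g (m - 1) (dot_diff z) = dot_diff (dot_map_at f g m z).
Proof.
apply: (@dot_ext _ X Y m _ (dot_map_at f g (m - 1) \o @dot_diff R X Y m)
  (@dot_diff R X' Y' m \o dot_map_at f g m)) => k x y.
rewrite -[LHS]/(dot_map_at f g _ (dot_diff (dot_mk x y))).
rewrite -[RHS]/(dot_diff (dot_map_at f g _ (dot_mk x y))).
rewrite dot_diff_mk raddfD raddfMz /= !dot_map_mk dot_diff_mk.
by rewrite !cmap_cast !cmap_diff.
Qed.

Fact dot_map_diffl m (z : dot_obj X Y m) :
  dot_map_at f g (m - 1) (dot_diffl z) = dot_diffl (dot_map_at f g m z).
Proof.
apply: (@dot_ext _ X Y m _ (dot_map_at f g (m - 1) \o @dot_diffl R X Y m)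
  (@dot_diffl R X' Y' m \o dot_map_at f g m)) => k x y.
rewrite -[LHS]/(dot_map_at f g _ (dot_diffl (dot_mk x y))).
rewrite -[RHS]/(dot_diffl (dot_map_at f g _ (dot_mk x y))).
by rewrite dot_diffl_mk !dot_map_mk dot_diffl_mk cmap_cast cmap_diff.
Qed.

Definition dot_map : cmor (dot_tensor X Y) (dot_tensor X' Y') :=
  @CMor int (dot_tensor X Y) (dot_tensor X' Y')
    (fun m => zlin (dot_map_at f g m)) dot_map_diff.

Fact bar_map_boundary m (z : dot_obj X Y m) :
  boundary (dot_tensor X Y) m z ->
  (@bar_pi _ X' Y' m \o dot_map_at f g m) z = 0.
Proof.
move=> -[n [e [w ->]]]; case: m / e z => _; rewrite ccast_id.
apply: zpi_rel; exists n, erefl, (dot_map_at f g n w).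
by rewrite ccast_id; exact: dot_map_diff.
Qed.

End DotMap.

HB.lock Definition bar_map_at (R : pzRingType) (X X' : complex R^c)
    (Y Y' : complex R) (f : cmor X X') (g : cmor Y Y') (m : int)
    (z : bar_obj X Y m) : bar_obj X' Y' m :=
  zquo_lift (@bar_map_boundary R X X' Y Y' f g m) z.

Arguments bar_map_at {R X X' Y Y'} f g m z.

Section BarMap.
Variables (R : pzRingType) (X X' : complex R^c) (Y Y' : complex R).
Variables (f : cmor X X') (g : cmor Y Y').

Fact bar_map_at_is_additive m : zmod_morphism (bar_map_at f g m).
Proof. by rewrite bar_map_at.unlock => u v; exact: raddfB. Qed.

HB.instance Definition _ m := GRing.isZmodMorphism.Build
  (bar_obj X Y m) (bar_obj X' Y' m) (bar_map_at f g m)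
  (@bar_map_at_is_additive m).

Lemma bar_map_pi m (z : dot_obj X Y m) :
  bar_map_at f g m (bar_pi z) = bar_pi (dot_map_at f g m z).
Proof. rewrite bar_map_at.unlock; exact: zquo_liftE. Qed.

Fact bar_map_diff m (z : bar_obj X Y m) :
  bar_map_at f g (m - 1) (bar_diff z) = bar_diff (bar_map_at f g m z).
Proof.
have [w <-] := bar_pi_surj z.
by rewrite bar_diff_pi !bar_map_pi dot_map_diffl bar_diff_pi.
Qed.

Definition bar_map : cmor (bar_tensor X Y) (bar_tensor X' Y') :=
  @CMor int (bar_tensor X Y) (bar_tensor X' Y')
    (fun m => zlin (bar_map_at f g m)) bar_map_diff.

End BarMap.

Section Termwise.
Variables (R : pzRingType) (B : complex R^c) (F : ccomplex R).

Fact dot_ccdiffK n m z :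
  dot_map (cmor_id B) (ccdiff F (n - 1)) m
    (dot_map (cmor_id B) (ccdiff F n) m z) = 0.
Proof.
pose d n := dot_map_at (cmor_id B) (ccdiff F n) m.
rewrite -[LHS]/(d (n - 1) (d n z)).
apply: (@dot_ext _ _ _ _ _ (d (n - 1) \o d n) \0) => k x y.
rewrite -[LHS]/(d (n - 1) (d n (dot_mk x y))) -[RHS]/0.
by rewrite /d !dot_map_mk ccdiffK dot_mk0r.
Qed.

Definition dot_ccomplex : ccomplex int :=
  @CComplex int (fun n => dot_tensor B (F n))
    (fun n => dot_map (cmor_id B) (ccdiff F n)) dot_ccdiffK.

Fact bar_ccdiffK n m z :
  bar_map (cmor_id B) (ccdiff F (n - 1)) m
    (bar_map (cmor_id B) (ccdiff F n) m z) = 0.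
Proof.
have [w <-] := bar_pi_surj z.
rewrite -[LHS]/(bar_map_at (cmor_id B) (ccdiff F (n - 1)) m
  (bar_map_at (cmor_id B) (ccdiff F n) m (bar_pi w))).
rewrite !bar_map_pi.
by rewrite (dot_ccdiffK w : dot_map_at _ _ m (dot_map_at _ _ m w) = 0) raddf0.
Qed.

Definition bar_ccomplex : ccomplex int :=
  @CComplex int (fun n => bar_tensor B (F n))
    (fun n => bar_map (cmor_id B) (ccdiff F n)) bar_ccdiffK.

End Termwise.

Section GorensteinFlat.
Variable R : pzRingType.

Definition flat (F : complex R) : Prop :=
  forall (X' X X'' : complex R^c) (i : cmor X' X) (p : cmor X X''),
    short_exact i p ->
    short_exact (bar_map i (cmor_id F)) (bar_map p (cmor_id F)).

Definition dot_flat (F : complex R) : Prop :=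
  forall (X' X X'' : complex R^c) (i : cmor X' X) (p : cmor X X''),
    short_exact i p ->
    short_exact (dot_map i (cmor_id F)) (dot_map p (cmor_id F)).

Variable B : complex R^c -> Prop.

Definition acyclic (F : ccomplex R) : Prop :=
  forall C, B C -> ccexact (bar_ccomplex C F).

Definition dot_acyclic (F : ccomplex R) : Prop :=
  forall C, B C -> ccexact (dot_ccomplex C F).

Definition gorenstein_flat (X : complex R) : Prop :=
  exists F : ccomplex R,
    [/\ ccexact F, acyclic F, forall n, flat (F n) & is_Z0 F X].

Definition dot_gorenstein_flat (X : complex R) : Prop :=
  exists F : ccomplex R,
    [/\ ccexact F, dot_acyclic F, forall n, dot_flat (F n) & is_Z0 F X].

End GorensteinFlat.

Section Cardinals.
Local Open Scope card_scope.

Definition card_lt T U (A : set T) (B : set U) : Prop :=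
  A #<= B /\ ~ (B #<= A).

(* A cardinal is represented by a type of that cardinality; it is regular if it
   is infinite and is not a union of fewer than kappa subsets, each of
   cardinality less than kappa. *)
Definition regular_cardinal (kappa : Type) : Prop :=
  infinite_set [set: kappa] /\
  forall (I : set kappa) (F : kappa -> set kappa),
    card_lt I [set: kappa] -> (forall i, I i -> card_lt (F i) [set: kappa]) ->
    \bigcup_(i in I) F i <> [set: kappa].

Definition directed (kappa : Type) d (I : porderType d) : Prop :=
  forall A : set I, card_lt A [set: kappa] ->
    exists j, forall i, A i -> (i <= j)%O.

End Cardinals.

Section Presentability.
Variable R : pzRingType.

Record dsystem d (I : porderType d) := DSystem {
  dobj :> I -> complex R;
  dmap : forall i j, (i <= j)%O -> cmor (dobj i) (dobj j);
  dmap_id : forall i (h : (i <= i)%O), dmap h =c cmor_id (dobj i);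
  dmap_comp : forall i j k
      (hij : (i <= j)%O) (hjk : (j <= k)%O) (hik : (i <= k)%O),
    dmap hik =c cmor_comp (dmap hjk) (dmap hij) }.

Section Colimit.
Variables (d : Order.disp_t) (I : porderType d) (D : dsystem I).

Definition is_cocone (C : complex R) (c : forall i, cmor (D i) C) : Prop :=
  forall i j (h : (i <= j)%O), cmor_comp (c j) (dmap D h) =c c i.

Definition is_colimit (C : complex R) (c : forall i, cmor (D i) C) : Prop :=
  is_cocone c /\
  forall (C' : complex R) (c' : forall i, cmor (D i) C'), is_cocone c' ->
    exists2 u : cmor C C', forall i, cmor_comp u (c i) =c c' i &
      forall v : cmor C C', (forall i, cmor_comp v (c i) =c c' i) -> v =c u.

(* Hom(S, -) preserves the colimit: the canonical map
   colim_i Hom(S, D_i) -> Hom(S, C) is bijective. *)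
Definition hom_preserves (S C : complex R) (c : forall i, cmor (D i) C)
    : Prop :=
  (forall f : cmor S C,
     exists i, exists g : cmor S (D i), cmor_comp (c i) g =c f) /\
  (forall i (g : cmor S (D i)) j (h : cmor S (D j)),
     cmor_comp (c i) g =c cmor_comp (c j) h ->
     exists k (hik : (i <= k)%O) (hjk : (j <= k)%O),
       cmor_comp (dmap D hik) g =c cmor_comp (dmap D hjk) h).

End Colimit.

Definition presentable (kappa : Type) (S : complex R) : Prop :=
  forall d (I : porderType d) (D : dsystem I) (C : complex R)
         (c : forall i, cmor (D i) C),
    directed kappa I -> is_colimit c -> hom_preserves S c.

Definition generated (kappa : Type) (S : complex R) : Prop :=
  forall d (I : porderType d) (D : dsystem I) (C : complex R)
         (c : forall i, cmor (D i) C),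
    directed kappa I -> (forall i j (h : (i <= j)%O), cinj (dmap D h)) ->
    is_colimit c -> hom_preserves S c.

Variable cls : complex R -> Prop.

(* Subobjects are given by monomorphisms, and A/S by a cokernel of S -> A. *)
Definition kaplansky : Prop :=
  exists2 kappa : Type, regular_cardinal kappa &
    forall (M A : complex R) (i : cmor M A),
      cls A -> cnonzero A -> cinj i -> generated kappa M ->
      exists (S Q : complex R) (h : cmor M S) (j : cmor S A) (p : cmor A Q),
        [/\ presentable kappa S, cnonzero S, cmor_comp j h =c i,
            short_exact j p & cls S /\ cls Q].

Definition precovering : Prop :=
  forall M : complex R, exists (A : complex R) (phi : cmor A M),
    cls A /\
    forall (A' : complex R) (psi : cmor A' M), cls A' ->
      exists f : cmor A' A, cmor_comp phi f =c psi.

End Presentability.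

(* Main.v *)
From HB Require Import structures.
From mathcomp Require Import all_boot all_order all_algebra generic_quotient.
From mathcomp Require Import finmap boolp classical_sets functions cardinality.
Require Import Defs.

(** Call a graded subset S of a complex of complexes F pure when every finite
    system of equations (in the R-action and both differentials) with constants
    in S and a solution in F has a solution in S. Then S and F/S inherit
    exactness, flatness of the terms and acyclicity under B (x) - : the local
    retractions F -> S provided by purity give a map from B (x) F to a reduced
    power of B (x) S that restricts to the diagonal on B (x) S.

    Kaplansky: by a Loewenheim-Skolem argument a small subset of F lies in a
    small pure S, and Z_0(S) is the required subobject of Z_0(F).

    Precovers: given psi : Z_0(F) -> M, divide F by a maximal pure S such that
    psi vanishes on Z_0(S). The size of F/S is bounded in terms of R and M
    only. Indeed let P0 be a subobject of F/S realizing all small diagrams of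
    F/S, with constants in P0 and labelled by psi. If x is not in P0, take a
    small elementary P containing x and a copy g : P -> P0 of it that fixes the
    intersection of P and P0 and respects psi; then (id - g)(P) is a nonzero
    pure subobject on which psi vanishes, against maximality. Up to isomorphism
    over M, only set many quotients F/S thus occur, and the direct sum of their
    Z_0 is a precover. *)

Set Implicit Arguments.
Unset Strict Implicit.
Unset Printing Implicit Defensive.

Import Order.TTheory GRing.Theory.
Local Open Scope classical_set_scope.
Local Open Scope card_scope.
Local Open Scope ring_scope.

(** * Subobjects, quotients and direct sums of complexes *)

(** A function F -> S provided by purity respects only the finitely many equations that were asked
    of it, and none of them need be a homomorphism. A relation of a tensor product names finitely
    many elements, so it holds for all functions that solve a large enough system; identifying
    families that eventually agree turns these partial choices into one additive map. The two tensor
    products share this argument, which uses their universal properties only.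

    The good complexes F are shown to be stable under pure subobjects, pure quotients and direct
    sums. Precovers are built from this alone, so the bound on size has to come from collapsing F
    rather than from filtering it. The labels serve two ends: values of psi as labels let g respect
    psi, and membership in P0 as a label makes P elementary enough for (id - g)(P) to be pure.

    Closures need no transfinite iteration: they are the sets of values of well-founded infinitely
    branching terms, and their size is read off from the number of terms. *)

Section MkLinear.
Variables (R : pzRingType) (U V : lmodType R) (f : U -> V).

Definition mklin_fun of linear f := f.

Variable fP : linear f.
HB.instance Definition _ :=
  GRing.isLinear.Build R U V *:%R (mklin_fun fP) fP.

Definition mklin : {linear U -> V} := mklin_fun fP.

End MkLinear.

Section MkAdditive.
Variables (U V : zmodType) (f : U -> V).

Definition mkadd_fun of zmod_morphism f := f.

Variable fP : zmod_morphism f.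
HB.instance Definition _ := GRing.isZmodMorphism.Build U V (mkadd_fun fP) fP.

Definition mkadd : {additive U -> V} := mkadd_fun fP.

End MkAdditive.

Definition mkcmor (R : pzRingType) (X Y : complex R) (f : forall m, X m -> Y m)
    (fP : forall m, linear (f m))
    (fd : forall m x, f (m - 1) (cdiff X m x) = cdiff Y m (f m x)) : cmor X Y :=
  @CMor R X Y (fun m => mklin (fP m)) fd.

Section Submodule.
Variables (R : pzRingType) (V : lmodType R).

Record submod := SubMod {
  smem :> V -> Prop;
  smem0 : smem 0;
  smemD : forall x y, smem x -> smem y -> smem (x + y);
  smemZ : forall r x, smem x -> smem (r *: x) }.

Variable S : submod.

Lemma smemN x : S x -> S (- x).
Proof. by move=> Sx; rewrite -scaleN1r; exact: smemZ. Qed.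

Lemma smemB x y : S x -> S y -> S (x - y).
Proof. by move=> Sx Sy; apply: smemD => //; exact: smemN. Qed.

Record lsub := LSub { lval :> V; lvalP : S lval }.

Lemma lval_inj : injective lval.
Proof.
by move=> [x Sx] [y Sy] /= exy; case: y / exy Sy => Sy;
  congr LSub; exact: Prop_irrelevance.
Qed.

HB.instance Definition _ := gen_eqMixin lsub.
HB.instance Definition _ := gen_choiceMixin lsub.

Let l0 := LSub (smem0 S).
Let lN (x : lsub) := LSub (smemN (lvalP x)).
Let lD (x y : lsub) := LSub (smemD (lvalP x) (lvalP y)).
Let lZ (r : R) (x : lsub) := LSub (smemZ r (lvalP x)).

Fact lsub_addA : associative lD.
Proof. by move=> x y z; apply: lval_inj; exact: addrA. Qed.
Fact lsub_addC : commutative lD.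
Proof. by move=> x y; apply: lval_inj; exact: addrC. Qed.
Fact lsub_add0 : left_id l0 lD.
Proof. by move=> x; apply: lval_inj; exact: add0r. Qed.
Fact lsub_addN : left_inverse l0 lN lD.
Proof. by move=> x; apply: lval_inj; exact: addNr. Qed.
HB.instance Definition _ :=
  GRing.isZmodule.Build lsub lsub_addA lsub_addC lsub_add0 lsub_addN.

Fact lsub_scaleA a b x : lZ a (lZ b x) = lZ (a * b) x.
Proof. by apply: lval_inj; exact: scalerA. Qed.
Fact lsub_scale1 : left_id 1 lZ.
Proof. by move=> x; apply: lval_inj; exact: scale1r. Qed.
Fact lsub_scaleDr : right_distributive lZ +%R.
Proof. by move=> a x y; apply: lval_inj; exact: scalerDr. Qed.
Fact lsub_scaleDl (x : lsub) : {morph lZ^~ x : a b / a + b}.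
Proof. by move=> a b; apply: lval_inj; exact: scalerDl. Qed.
HB.instance Definition _ := GRing.Zmodule_isLmodule.Build R lsub
  lsub_scaleA lsub_scale1 lsub_scaleDr lsub_scaleDl.

Lemma lval_is_linear : linear lval.
Proof. by []. Qed.
HB.instance Definition _ := GRing.isLinear.Build R lsub V *:%R lval
  lval_is_linear.

Definition lincl : {linear lsub -> V} := lval.

Definition lquo : Type := zquo S.
HB.instance Definition _ := GRing.Zmodule.on lquo.

Definition lpi_fun (x : V) : lquo := zpi S x.
Lemma lpi_is_additive : zmod_morphism lpi_fun.
Proof. exact: zpi_is_additive. Qed.
HB.instance Definition _ := GRing.isZmodMorphism.Build V lquo lpi_fun
  lpi_is_additive.

Lemma lpi_surj (z : lquo) : exists x, lpi_fun x = z.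
Proof. exact: zpi_surj. Qed.

Lemma lpi0P x : lpi_fun x = 0 <-> S x.
Proof.
split=> [/eqP|]; last exact: zpi_rel.
rewrite zpi_eq0 => /asboolP; apply => //; first exact: smem0.
exact: smemB.
Qed.

Lemma lpiP x y : lpi_fun x = lpi_fun y <-> S (x - y).
Proof.
have E : lpi_fun (x - y) = lpi_fun x - lpi_fun y by exact: raddfB.
rewrite -lpi0P E; split=> [->|/eqP]; first by rewrite subrr.
by rewrite subr_eq0 => /eqP.
Qed.

Definition lquo_scale (r : R) (z : lquo) : lquo := lpi_fun (r *: repr z).

Lemma lquo_scaleE r x : lquo_scale r (lpi_fun x) = lpi_fun (r *: x).
Proof.
apply/lpiP; rewrite -scalerBr; apply: smemZ; apply/lpiP; exact: zpi_repr.
Qed.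

Fact lquo_scaleA a b x : lquo_scale a (lquo_scale b x) = lquo_scale (a * b) x.
Proof. by have [y <-] := lpi_surj x; rewrite !lquo_scaleE scalerA. Qed.
Fact lquo_scale1 : left_id 1 lquo_scale.
Proof. by move=> x; have [y <-] := lpi_surj x; rewrite lquo_scaleE scale1r. Qed.
Fact lquo_scaleDr : right_distributive lquo_scale +%R.
Proof.
move=> a x y; have [[u <-] [v <-]] := (lpi_surj x, lpi_surj y).
by rewrite -raddfD !lquo_scaleE scalerDr raddfD.
Qed.
Fact lquo_scaleDl (x : lquo) : {morph lquo_scale^~ x : a b / a + b}.
Proof.
by move=> a b; have [y <-] := lpi_surj x; rewrite !lquo_scaleE scalerDl raddfD.
Qed.
HB.instance Definition _ := GRing.Zmodule_isLmodule.Build R lquo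
  lquo_scaleA lquo_scale1 lquo_scaleDr lquo_scaleDl.

Lemma lpi_is_scalable : scalable lpi_fun.
Proof. by move=> r x; rewrite -lquo_scaleE. Qed.
HB.instance Definition _ := GRing.isScalable.Build R V lquo *:%R lpi_fun
  lpi_is_scalable.

Definition lpi : {linear V -> lquo} := lpi_fun.

End Submodule.

Section SubquotientMap.
Variables (R : pzRingType) (U V : lmodType R) (S : submod U) (T : submod V).
Variables (f : {linear U -> V}) (fST : forall x, S x -> T (f x)).

Definition lsub_fun (x : lsub S) : lsub T := LSub (fST (lvalP x)).
Fact lsub_fun_linear : linear lsub_fun.
Proof. by move=> a x y; apply: lval_inj; exact: linearP. Qed.
Definition lsub_map : {linear lsub S -> lsub T} := mklin lsub_fun_linear.

Definition lquo_fun (z : lquo S) : lquo T := lpi T (f (repr z)).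
Lemma lquo_funE x : lquo_fun (lpi S x) = lpi T (f x).
Proof.
apply: (proj2 (lpiP T _ _)); rewrite -linearB; apply: fST.
apply: (proj1 (lpiP S _ _)); exact: zpi_repr.
Qed.
Fact lquo_fun_linear : linear lquo_fun.
Proof.
move=> a x y; have [[u <-] [v <-]] := (lpi_surj x, lpi_surj y).
have -> : a *: lpi_fun S u + lpi_fun S v = lpi S (a *: u + v).
  by rewrite linearP.
rewrite lquo_funE !linearP.
by congr (_ *: _ + _); exact: esym (lquo_funE _).
Qed.
Definition lquo_map : {linear lquo S -> lquo T} := mklin lquo_fun_linear.
Lemma lquo_mapE x : lquo_map (lpi S x) = lpi T (f x).
Proof. exact: lquo_funE. Qed.

End SubquotientMap.

Section Subcomplex.
Variables (R : pzRingType) (X : complex R).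

Record subcx := SubCx {
  scmem :> forall m, submod (X m);
  scmem_diff : forall m x, scmem m x -> scmem (m - 1) (cdiff X m x) }.

Variable S : subcx.

Fact csub_diffK m x :
  lsub_map (@scmem_diff S (m - 1)) (lsub_map (@scmem_diff S m) x) = 0.
Proof. by apply: lval_inj; exact: cdiffK. Qed.

Definition csub : complex R := @Complex R (fun m => lsub (S m))
  (fun m => lsub_map (@scmem_diff S m)) csub_diffK.

Definition cincl : cmor csub X :=
  @CMor R csub X (fun m => lincl (S m)) (fun m x => erefl).

Lemma cincl_inj : cinj cincl.
Proof. by move=> m; exact: lval_inj. Qed.

Lemma csub_lift (Y : complex R) (f : cmor Y X) :
  (forall m y, S m (f m y)) ->
  exists g : cmor Y csub, cmor_comp cincl g =c f.
Proof.
move=> fS; pose g m y : csub m := LSub (fS m y).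
have glin m : linear (g m).
  by move=> a x y; apply: lval_inj; exact: linearP.
have gd m y : g (m - 1) (cdiff Y m y) = cdiff csub m (g m y).
  by apply: lval_inj; exact: cmap_diff.
by exists (mkcmor glin gd).
Qed.

Fact cquo_diffK m x :
  lquo_map (@scmem_diff S (m - 1)) (lquo_map (@scmem_diff S m) x) = 0.
Proof.
by have [u <-] := lpi_surj x; rewrite !lquo_mapE cdiffK linear0.
Qed.

Definition cquo : complex R := @Complex R (fun m => lquo (S m))
  (fun m => lquo_map (@scmem_diff S m)) cquo_diffK.

Fact cproj_diff m x :
  lpi (S (m - 1)) (cdiff X m x) = cdiff cquo m (lpi (S m) x).
Proof. by rewrite /= lquo_mapE. Qed.

Definition cproj : cmor X cquo :=
  @CMor R X cquo (fun m => lpi (S m)) cproj_diff.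

Lemma cproj0P m x : cproj m x = 0 <-> S m x.
Proof. exact: lpi0P. Qed.

Lemma cproj_surj : csurj cproj.
Proof. by move=> m; exact: lpi_surj. Qed.

Lemma csub_short_exact : short_exact cincl cproj.
Proof.
split; [exact: cincl_inj | | exact: cproj_surj].
move=> m y; rewrite cproj0P; split=> [Sy|[x <-]]; last exact: lvalP.
by exists (LSub Sy).
Qed.

End Subcomplex.

Section SubcomplexMap.
Variables (R : pzRingType) (X Y : complex R) (S : subcx X) (T : subcx Y).
Variables (f : cmor X Y) (fST : forall m x, S m x -> T m (f m x)).

Fact csub_map_diff m x :
  lsub_map (@fST (m - 1)) (cdiff (csub S) m x) =
  cdiff (csub T) m (lsub_map (@fST m) x).
Proof. by apply: lval_inj; exact: cmap_diff. Qed.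
Definition csub_map : cmor (csub S) (csub T) :=
  @CMor R (csub S) (csub T) (fun m => lsub_map (@fST m)) csub_map_diff.

Fact cquo_map_diff m x :
  lquo_map (@fST (m - 1)) (cdiff (cquo S) m x) =
  cdiff (cquo T) m (lquo_map (@fST m) x).
Proof.
by have [u <-] := lpi_surj x; rewrite /= !lquo_mapE cmap_diff.
Qed.
Definition cquo_map : cmor (cquo S) (cquo T) :=
  @CMor R (cquo S) (cquo T) (fun m => lquo_map (@fST m)) cquo_map_diff.
Lemma cquo_mapE m x : cquo_map m (cproj S m x) = cproj T m (f m x).
Proof. exact: lquo_mapE. Qed.

End SubcomplexMap.

Section QuotientLift.
Variables (R : pzRingType) (X Y : complex R) (K : subcx X) (f : cmor X Y).
Hypothesis fK : forall m x, K m x -> f m x = 0.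

Definition cquo_lift_fun m (z : cquo K m) : Y m := f m (repr z).

Lemma cquo_lift_funE m (x : X m) : cquo_lift_fun (cproj K m x) = f m x.
Proof.
apply/eqP; rewrite -subr_eq0 -linearB; apply/eqP/fK.
apply: (proj1 (lpiP (K m) _ _)); exact: zpi_repr.
Qed.

Fact cquo_lift_linear m : linear (@cquo_lift_fun m).
Proof.
move=> a x y; have [[u <-] [v <-]] := (cproj_surj x, cproj_surj y).
by rewrite -linearP !cquo_lift_funE linearP.
Qed.

Fact cquo_lift_diff m (x : cquo K m) :
  cquo_lift_fun (cdiff (cquo K) m x) = cdiff Y m (cquo_lift_fun x).
Proof.
have [u <-] := cproj_surj x.
by rewrite -cmap_diff !cquo_lift_funE cmap_diff.
Qed.

Definition cquo_lift : cmor (cquo K) Y :=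
  mkcmor cquo_lift_linear cquo_lift_diff.

Lemma cquo_liftE m x : cquo_lift m (cproj K m x) = f m x.
Proof. exact: cquo_lift_funE. Qed.

End QuotientLift.

Section Preimage.
Variables (R : pzRingType) (X Y : complex R) (f : cmor X Y) (S : subcx Y).

Definition preim_submod m : submod (X m).
Proof.
exists (fun x => S m (f m x)).
- by rewrite linear0; exact: smem0.
- by move=> x y Sx Sy; rewrite linearD; exact: smemD.
- by move=> r x Sx; rewrite linearZ_LR; exact: smemZ.
Defined.

(** If [f] is the inclusion of Z_0(F) into F_0 and [S] is the term of index 0 of a subobject of F,
    this is Z_0 of that subobject. *)
Definition preim_subcx : subcx X.
Proof.
exists preim_submod => m x /= Sx.
by rewrite cmap_diff; exact: scmem_diff.
Defined.

Definition cquo_preim : cmor (cquo preim_subcx) (cquo S) :=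
  @cquo_map R X Y preim_subcx S f (fun m x h => h).

Lemma cquo_preimE m x : cquo_preim m (cproj _ m x) = cproj S m (f m x).
Proof. exact: cquo_mapE. Qed.

Lemma cquo_preim_inj : cinj cquo_preim.
Proof.
move=> m u v; have [[x <-] [y <-]] := (cproj_surj u, cproj_surj v).
rewrite !cquo_preimE => /eqP; rewrite -subr_eq0 -linearB => /eqP/cproj0P Sxy.
apply/eqP; rewrite -subr_eq0 -linearB; apply/eqP/cproj0P.
by rewrite /= linearB.
Qed.

Definition csub_preim : cmor (csub preim_subcx) (csub S) :=
  @csub_map R X Y preim_subcx S f (fun m x h => h).

End Preimage.

Section Subccomplex.
Variables (R : pzRingType) (F : ccomplex R).

Record subccx := SubCCx {
  sccmem :> forall n, subcx (F n);
  sccmem_diff : forall n m x, sccmem n m x ->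
    sccmem (n - 1) m (ccdiff F n m x) }.

Variable S : subccx.

Fact ccsub_diffK n m x :
  csub_map (@sccmem_diff S (n - 1)) m (csub_map (@sccmem_diff S n) m x) = 0.
Proof. by apply: lval_inj; exact: ccdiffK. Qed.
Definition ccsub : ccomplex R := @CComplex R (fun n => csub (S n))
  (fun n => csub_map (@sccmem_diff S n)) ccsub_diffK.

Fact ccquo_diffK n m x :
  cquo_map (@sccmem_diff S (n - 1)) m (cquo_map (@sccmem_diff S n) m x) = 0.
Proof.
by have [u <-] := cproj_surj x; rewrite !cquo_mapE ccdiffK linear0.
Qed.
Definition ccquo : ccomplex R := @CComplex R (fun n => cquo (S n))
  (fun n => cquo_map (@sccmem_diff S n)) ccquo_diffK.

Definition ccproj n : cmor (F n) (ccquo n) := cproj (S n).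

Lemma ccproj_diff n m x :
  ccproj (n - 1) m (ccdiff F n m x) = ccdiff ccquo n m (ccproj n m x).
Proof. exact: esym (cquo_mapE _ _). Qed.

End Subccomplex.

Section DirectSumModule.
Variables (R : pzRingType) (I : choiceType) (V : I -> lmodType R).

Definition lsum : Type := dsum V.
HB.instance Definition _ := GRing.Zmodule.on lsum.

Lemma lsumZ_fin (r : R) (x : lsum) :
  finite_set [set k | r *: dcoord x k != 0].
Proof.
apply: sub_finite_set (dsum_fin x) => k /=; apply: contraNN => /eqP ->.
by rewrite scaler0.
Qed.
Let lZ r x : lsum := DSum (lsumZ_fin r x).

Fact lsum_scaleA a b x : lZ a (lZ b x) = lZ (a * b) x.
Proof. by apply: dsum_eq => k; exact: scalerA. Qed.
Fact lsum_scale1 : left_id 1 lZ.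
Proof. by move=> x; apply: dsum_eq => k; exact: scale1r. Qed.
Fact lsum_scaleDr : right_distributive lZ +%R.
Proof. by move=> a x y; apply: dsum_eq => k; exact: scalerDr. Qed.
Fact lsum_scaleDl (x : lsum) : {morph lZ^~ x : a b / a + b}.
Proof. by move=> a b; apply: dsum_eq => k; exact: scalerDl. Qed.
HB.instance Definition _ := GRing.Zmodule_isLmodule.Build R lsum
  lsum_scaleA lsum_scale1 lsum_scaleDr lsum_scaleDl.

Fact lcoord_linear k : linear (fun x : lsum => dcoord x k).
Proof. by []. Qed.
Definition lcoord k : {linear lsum -> V k} := mklin (lcoord_linear k).

Fact lsum_in_linear k : linear (fun t : V k => din t : lsum).
Proof.
move=> a x y; apply: dsum_eq => j.
rewrite -[RHS]/(a *: din_coord x j + din_coord y j) /= /din_coord.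
by case: eqP => [e|_]; [case: j / e | rewrite scaler0 addr0].
Qed.
Definition lsum_in k : {linear V k -> lsum} := mklin (@lsum_in_linear k).

Lemma lsum_eq (x y : lsum) : (forall k, lcoord k x = lcoord k y) -> x = y.
Proof. exact: dsum_eq. Qed.

(** The list [r] may be any duplicate-free list that contains the support, so that decompositions of
    several elements can be taken over a common list. *)
Lemma lsum_fin (x : lsum) : exists s : seq I, forall r, uniq r ->
  {subset s <= r} -> x = \sum_(k <- r) lsum_in k (lcoord k x).
Proof.
exists (fset_set [set k | dcoord x k != 0]) => r ur sr.
rewrite {1}(dsum_sumE x) [RHS](bigID (fun k => dcoord x k != 0)) /=.
rewrite [X in _ = _ + X]big1 ?addr0; last first.
  move=> k /negPn/eqP xk0; have -> : lcoord k x = 0 by exact: xk0.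
  by rewrite linear0.
rewrite -[RHS]big_filter; apply: perm_big; apply: uniq_perm.
- exact: fset_uniq.
- exact: filter_uniq.
move=> k; rewrite mem_dsupp mem_filter.
by apply/idP/andP => [xk|[]//]; split=> //; apply: sr; rewrite mem_dsupp.
Qed.

Lemma lsum_ext (C : zmodType) (f g : lsum -> C) :
  zmod_morphism f -> zmod_morphism g ->
  (forall k t, f (lsum_in k t) = g (lsum_in k t)) -> f =1 g.
Proof.
move=> fB gB fg.
exact: (@dsum_ext _ V C (@mkadd (dsum V) C f fB) (@mkadd (dsum V) C g gB) fg).
Qed.

Section Lift.
Variables (W : lmodType R) (f : forall k, {linear V k -> W}).

Fact llift_linear : linear (dlift (fun k => f k) : lsum -> W).
Proof.
move=> a x y; rewrite [LHS](raddfD (dlift (fun k => f k))); congr (_ + _).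
pose g (z : lsum) : W := dlift (fun k => f k) (a *: z).
pose h (z : lsum) : W := a *: dlift (fun k => f k) z.
apply: (@lsum_ext W g h) x => [u v|u v|k t]; rewrite /g /h.
- by rewrite scalerBr [LHS](raddfB (dlift (fun k => f k))).
- by rewrite [in LHS](raddfB (dlift (fun k => f k))) scalerBr.
have -> : a *: lsum_in k t = lsum_in k (a *: t) by rewrite linearZ.
by rewrite [LHS]dlift_din [in RHS]dlift_din; exact: (linearZ_LR (f k)).
Qed.
Definition llift : {linear lsum -> W} := mklin llift_linear.
Lemma llift_in k t : llift (lsum_in k t) = f k t.
Proof. exact: dlift_din. Qed.

End Lift.

End DirectSumModule.
Arguments lcoord {R I V} k.

Section DirectSumMap.
Variables (R : pzRingType) (I : choiceType) (U V : I -> lmodType R).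
Variable f : forall k, {linear U k -> V k}.

Fact lsum_map_fin (x : lsum U) : finite_set [set k | f k (dcoord x k) != 0].
Proof.
apply: sub_finite_set (dsum_fin x) => k /=; apply: contraNN => /eqP ->.
by rewrite linear0.
Qed.
Definition lsum_map_fun (x : lsum U) : lsum V := DSum (lsum_map_fin x).
Fact lsum_map_linear : linear lsum_map_fun.
Proof. by move=> a x y; apply: dsum_eq => k; exact: linearP. Qed.
Definition lsum_map : {linear lsum U -> lsum V} := mklin lsum_map_linear.
Lemma lcoord_map k x : lcoord k (lsum_map x) = f k (lcoord k x).
Proof. by []. Qed.
Lemma lsum_map_in k t : lsum_map (lsum_in U k t) = lsum_in V k (f k t).
Proof.
apply: dsum_eq => j /=; rewrite /din_coord.
by case: eqP => [e|_]; [case: j / e | rewrite linear0].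
Qed.

End DirectSumMap.

Section DirectSumComplex.
Variables (R : pzRingType) (I : choiceType) (X : I -> complex R).

Fact csum_diffK m x :
  lsum_map (fun k => cdiff (X k) (m - 1)) (lsum_map (fun k => cdiff (X k) m) x)
  = 0.
Proof. by apply: lsum_eq => k; rewrite !lcoord_map cdiffK. Qed.
Definition csum : complex R := @Complex R (fun m => lsum (fun k => X k m))
  (fun m => lsum_map (fun k => cdiff (X k) m)) csum_diffK.

Definition csum_pr k : cmor csum (X k) :=
  @CMor R csum (X k) (fun m => lcoord k) (fun m x => erefl).

Fact csum_in_diff k m x :
  lsum_in (fun k => X k (m - 1)) k (cdiff (X k) m x) =
  cdiff csum m (lsum_in (fun k => X k m) k x).
Proof. by rewrite /= lsum_map_in. Qed.
Definition csum_in k : cmor (X k) csum :=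
  @CMor R (X k) csum (fun m => lsum_in (fun k => X k m) k) (@csum_in_diff k).

Fact csum_lift_diff (Y : complex R) (f : forall k, cmor (X k) Y) m
  (x : csum m) :
  llift (fun k => f k (m - 1)) (cdiff csum m x) =
  cdiff Y m (llift (fun k => f k m) x).
Proof.
move: x; apply: lsum_ext => [u v|u v|k t].
- by rewrite !raddfB.
- by rewrite !raddfB.
by rewrite -csum_in_diff !llift_in cmap_diff.
Qed.

Definition csum_lift (Y : complex R) (f : forall k, cmor (X k) Y) :
    cmor csum Y :=
  @CMor R csum Y (fun m => llift (fun k => f k m)) (csum_lift_diff f).

Lemma csum_lift_in (Y : complex R) (f : forall k, cmor (X k) Y) k m x :
  csum_lift f m (csum_in k m x) = f k m x.
Proof. exact: llift_in. Qed.

End DirectSumComplex.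

Section DirectSumComplexMap.
Variables (R : pzRingType) (I : choiceType) (X Y : I -> complex R).
Variable f : forall k, cmor (X k) (Y k).

Fact csum_map_diff m x :
  lsum_map (fun k => f k (m - 1)) (cdiff (csum X) m x) =
  cdiff (csum Y) m (lsum_map (fun k => f k m) x).
Proof.
apply: lsum_eq => k; rewrite lcoord_map.
rewrite -[RHS]/(cdiff (Y k) m (f k m (lcoord k x))).
by rewrite -cmap_diff.
Qed.
Definition csum_map : cmor (csum X) (csum Y) :=
  @CMor R (csum X) (csum Y) (fun m => lsum_map (fun k => f k m)) csum_map_diff.

End DirectSumComplexMap.

Section DirectSumCComplex.
Variables (R : pzRingType) (I : choiceType) (F : I -> ccomplex R).

Fact ccsum_diffK n m x :
  csum_map (fun k => ccdiff (F k) (n - 1)) m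
    (csum_map (fun k => ccdiff (F k) n) m x) = 0.
Proof.
apply: lsum_eq => k; rewrite [RHS]linear0.
exact: (ccdiffK (lcoord k x)).
Qed.
Definition ccsum : ccomplex R := @CComplex R (fun n => csum (fun k => F k n))
  (fun n => csum_map (fun k => ccdiff (F k) n)) ccsum_diffK.

End DirectSumCComplex.

(** * Tensor products through their universal property *)

(** Turns membership in a subgroup into the vanishing of an additive map. A claim [K z] about all
    tensors z then reduces to generators by comparing [zpi K] with 0. *)
Lemma zquo0P (A : zmodType) (K : set A) : K 0 ->
  (forall u v, K u -> K v -> K (u - v)) -> forall x, zpi K x = 0 <-> K x.
Proof.
move=> K0 KB x; split=> [/eqP|]; last exact: zpi_rel.
by rewrite zpi_eq0 => /asboolP; apply.
Qed.

Section TensorTheory.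
Variable R : pzRingType.

(* The universal property of X (x)^. Y and, when bar holds, of its quotient
   X (x) Y: then f must in addition vanish on d(x (x) y), for x in X_k and y in
   Y_(n-k) with n = m + 1. *)
Definition tensor_like (bar : Prop) (X : complex R^c) (Y : complex R) (m : int)
    (C : zmodType) (f : forall k, X k -> Y (m - k) -> C) : Prop :=
  (forall k, balanced_biadditive (f k)) /\
  (bar -> forall n k (e1 : n - k = m - (k - 1)) (e2 : n - k - 1 = m - k)
     (x : X k) (y : Y (n - k)),
     f (k - 1) (cdiff X k x) (ccast Y e1 y) +
     f k x (ccast Y e2 (cdiff Y (n - k) y)) *~ (-1) ^ k = 0).

(** The common interface of the two tensor products, so that each argument is made once. The action
    on morphisms is a field, rather than a map derived from [tlift], so that it can be instantiated
    by [dot_map] and [bar_map] themselves. *)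
Record tensor_theory := TensorTheory {
  tbar : Prop;
  tobj :> complex R^c -> complex R -> complex int;
  tgen : forall (X : complex R^c) (Y : complex R) m k, 
    X k -> Y (m - k) -> tobj X Y m;
  tgen_ok : forall X Y m, tensor_like tbar (@tgen X Y m);
  tlift : forall (X : complex R^c) (Y : complex R) m (C : zmodType)
      (f : forall k, X k -> Y (m - k) -> C), tensor_like tbar f ->
    exists2 g : tobj X Y m -> C, zmod_morphism g &
      forall k x y, g (@tgen X Y m k x y) = f k x y;
  tgen_ext : forall (X : complex R^c) (Y : complex R) m (C : zmodType)
      (f g : tobj X Y m -> C),
    zmod_morphism f -> zmod_morphism g ->
    (forall k x y, f (@tgen X Y m k x y) = g (@tgen X Y m k x y)) -> f =1 g;
  tmap : forall (X X' : complex R^c) (Y Y' : complex R),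
    cmor X X' -> cmor Y Y' -> cmor (tobj X Y) (tobj X' Y');
  tmap_mk : forall (X X' : complex R^c) (Y Y' : complex R) (f : cmor X X')
      (g : cmor Y Y') m k x y,
    tmap f g m (@tgen X Y m k x y) = @tgen X' Y' m k (f k x) (g (m - k) y) }.

Variable T : tensor_theory.
Local Notation tg := (@tgen T _ _ _ _).
Local Notation tm := (@tmap T _ _ _ _).

Section Bilinear.
Variables (X : complex R^c) (Y : complex R) (m k : int).

Lemma tgenBl (x x' : X k) (y : Y (m - k)) : tg (x - x') y = tg x y - tg x' y.
Proof.
have [/(_ k)[+ _ _] _] := @tgen_ok T X Y m.
by move=> D; apply/eqP; rewrite eq_sym subr_eq -D subrK.
Qed.

Lemma tgenBr (x : X k) (y y' : Y (m - k)) : tg x (y - y') = tg x y - tg x y'.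
Proof.
have [/(_ k)[_ + _] _] := @tgen_ok T X Y m.
by move=> D; apply/eqP; rewrite eq_sym subr_eq -D subrK.
Qed.

Lemma tgen0r (x : X k) : tg x (0 : Y (m - k)) = 0.
Proof. by rewrite -[0 in LHS](subrr 0) tgenBr subrr. Qed.

Lemma tgen0l (y : Y (m - k)) : tg (0 : X k) y = 0.
Proof. by rewrite -[0 in LHS](subrr 0) tgenBl subrr. Qed.

End Bilinear.

Lemma tmap_comp X X' X'' Y Y' Y'' (f : cmor X X') (f' : cmor X' X'')
    (g : cmor Y Y') (g' : cmor Y' Y'') (f'' : cmor X X'') (g'' : cmor Y Y'')
    m z :
  f'' =c cmor_comp f' f -> g'' =c cmor_comp g' g ->
  tm f'' g'' m z = tm f' g' m (tm f g m z).
Proof.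
move=> ef eg; move: z; apply: tgen_ext => [u v|u v|k x y].
- exact: raddfB.
- by rewrite !raddfB.
by rewrite !tmap_mk ef eg.
Qed.

Lemma tmap0r X X' Y Y' (f : cmor X X') (g : cmor Y Y') m z :
  (forall m y, g m y = 0) -> tm f g m z = 0.
Proof.
move=> g0; move: z; apply: tgen_ext => [u v|u v|k x y].
- exact: raddfB.
- by rewrite subrr.
by rewrite tmap_mk g0 tgen0r.
Qed.

Section RightExact.
Variables (X X'' : complex R^c) (Y Y'' : complex R).
Variables (p : cmor X X'') (q : cmor Y Y'').
Hypotheses (psurj : csurj p) (qsurj : csurj q).

Lemma tmap_surj : csurj (tm p q).
Proof.
move=> m; pose K : set (T X'' Y'' m) := [set z | exists x, tm p q m x = z].
have KP z : zpi K z = 0 -> K z.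
  move/zquo0P; apply; first by exists 0; rewrite raddf0.
  by move=> _ _ [u <-] [v <-]; exists (u - v); rewrite raddfB.
move=> z; apply: KP; move: z; apply: tgen_ext => [u v|u v|k x y].
- exact: raddfB.
- by rewrite subrr.
have [[x' <-] [y' <-]] := (psurj x, qsurj y).
by apply: zpi_rel; exists (tg x' y'); rewrite tmap_mk.
Qed.

(** Set-theoretic sections of [p] and [q] define a map back into the quotient by [K]: another choice
    of preimages alters a generator by an element of [K]. Hence [zpi K] factors through [tm p q]. *)
Lemma tmap_ker m (K : set (T X Y m)) : K 0 ->
  (forall u v, K u -> K v -> K (u - v)) ->
  (forall k (x : X k) (y : Y (m - k)), p k x = 0 \/ q _ y = 0 -> K (tg x y)) ->
  forall z, tm p q m z = 0 -> K z.
Proof.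
move=> K0 KB Kpq.
pose lx k := projT1 (choice (@psurj k)).
have lxP k x : p k (lx k x) = x by exact: projT2 (choice (@psurj k)) x.
pose ly k := projT1 (choice (@qsurj k)).
have lyP k y : q k (ly k y) = y by exact: projT2 (choice (@qsurj k)) y.
pose f k (x : X'' k) (y : Y'' (m - k)) := zpi K (tg (lx k x) (ly _ y)).
have fE k (x : X k) (y : Y (m - k)) : f k (p k x) (q _ y) = zpi K (tg x y).
  apply/eqP; rewrite -subr_eq0 -raddfB; apply/eqP; apply: zpi_rel.
  have -> : tg (lx k (p k x)) (ly _ (q _ y)) - tg x y =
      tg (lx k (p k x) - x) (ly _ (q _ y)) -
      (0 - tg x (ly _ (q _ y) - y)).
    by rewrite sub0r opprK tgenBl tgenBr addrA subrK.
  by apply: (KB); [|apply: (KB) => //]; apply: Kpq; [left|right];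
    rewrite linearB ?lxP ?lyP subrr.
have fok : tensor_like (tbar T) f.
  have [Tbal Tbd] := @tgen_ok T X Y m; split=> [k|hb n k e1 e2 x y].
    have [D1 D2 Z] := Tbal k; split=> [x x' y|x y y'|x r y].
    - have [[[{}x <-] [{}x' <-]] [{}y <-]] := (psurj x, psurj x', qsurj y).
      by rewrite -linearD !fE D1 raddfD.
    - have [[[{}x <-] [{}y <-]] [{}y' <-]] := (psurj x, qsurj y, qsurj y').
      by rewrite -linearD !fE D2 raddfD.
    - have [[{}x <-] [{}y <-]] := (psurj x, qsurj y).
      by rewrite -!linearZ !fE Z.
  have [[{}x <-] [{}y <-]] := (psurj x, qsurj y).
  rewrite -!cmap_diff -!cmap_cast !fE -raddfMz -raddfD.
  by rewrite (Tbd hb) raddf0.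
have [g gB gE] := tlift fok.
move=> z pz0; apply/(zquo0P K0 KB).
have -> : zpi K z = g (tm p q m z).
  move: {pz0} z; apply: tgen_ext => [u v|u v|k x y].
  - exact: raddfB.
  - by rewrite raddfB gB.
  by rewrite tmap_mk gE fE.
by rewrite pz0 -[0 in LHS](subrr 0) gB subrr.
Qed.

End RightExact.

Lemma tmap_right_exactl X' X X'' Y (i : cmor X' X) (p : cmor X X'') :
  exact_at i p -> csurj p ->
  exact_at (tm i (cmor_id Y)) (tm p (cmor_id Y)).
Proof.
move=> ip psurj m z; split=> [|[x <-]].
  move: z; apply: tmap_ker => //.
  - by move=> k y; exists y.
  - by exists 0; rewrite raddf0.
  - by move=> _ _ [u <-] [v <-]; exists (u - v); rewrite raddfB.
  move=> k x y [/ip[x' <-]|/= ->]; last by exists 0; rewrite raddf0 tgen0r.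
  by exists (tg x' y); rewrite tmap_mk.
move: x; apply: tgen_ext => [u v|u v|k x y].
- by rewrite !raddfB.
- by rewrite subrr.
by rewrite !tmap_mk (proj2 (ip _ _)) ?tgen0l //; exists x.
Qed.

Lemma tmap_right_exactr X Y' Y Y'' (i : cmor Y' Y) (p : cmor Y Y'') :
  exact_at i p -> csurj p ->
  exact_at (tm (cmor_id X) i) (tm (cmor_id X) p).
Proof.
move=> ip psurj m z; split=> [|[x <-]].
  move: z; apply: tmap_ker => //.
  - by move=> k y; exists y.
  - by exists 0; rewrite raddf0.
  - by move=> _ _ [u <-] [v <-]; exists (u - v); rewrite raddfB.
  move=> k x y [/= ->|/ip[y' <-]]; last first.
    by exists (tg x y'); rewrite tmap_mk.
  by exists 0; rewrite raddf0 tgen0l.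
rewrite -(@tmap_comp _ _ _ _ _ _ (cmor_id X) (cmor_id X) i p (cmor_id X)
  (cmor_comp p i)) //.
by apply: tmap0r => k y; apply/ip; exists y.
Qed.

End TensorTheory.

(** * Purity *)

Section Purity.
Variables (R : pzRingType) (F : ccomplex R).

Definition ccmem := forall n m : int, F n m -> Prop.
Definition ccfun := forall n m : int, F n m -> F n m.

(** The relations that a function on F can be asked to carry over at named elements. In [meets],
    [Rfix] is conditional on membership in S, so one list of requirements makes sense for every
    S. *)
Inductive req : Type :=
| Radd n m (a b : F n m)
| Rscale n m (r : R) (a : F n m)
| Rdiff n m (a : F n m)
| Rccdiff n m (a : F n m)
| Rfix n m (a : F n m).

Definition meets (S : ccmem) (rho : ccfun) (q : req) : Prop :=
  match q with
  | Radd n m a b => rho n m (a + b) = rho n m a + rho n m b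
  | Rscale n m r a => rho n m (r *: a) = r *: rho n m a
  | Rdiff n m a => rho n (m - 1) (cdiff (F n) m a) = cdiff (F n) m (rho n m a)
  | Rccdiff n m a =>
      rho (n - 1) m (ccdiff F n m a) = ccdiff F n m (rho n m a)
  | Rfix n m a => S n m a -> rho n m a = a
  end.

Fixpoint meets_all (S : ccmem) (rho : ccfun) (l : seq req) : Prop :=
  if l is q :: l' then meets S rho q /\ meets_all S rho l' else True.

Lemma meets_all_cat S rho l l' :
  meets_all S rho (l ++ l') <-> meets_all S rho l /\ meets_all S rho l'.
Proof. by elim: l => [|q l IH] /=; [tauto | rewrite IH; tauto]. Qed.

(* A finite system of equations over F with constants in S is recorded here by a
   solution in F, and rho sends that solution to one in S. *)
Definition pure (S : ccmem) : Prop := forall l : seq req, exists2 rho : ccfun,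
  (forall n m f, S n m (rho n m f)) & meets_all S rho l.

Section PureSub.
Variables (S : ccmem) (pS : pure S).
Arguments S : clear implicits.

Lemma pure_add n m (a b : F n m) : S n m a -> S n m b -> S n m (a + b).
Proof.
have [rho rS [/= E [Ea [Eb _]]]] := pS [:: Radd a b; Rfix a; Rfix b].
by move=> Sa Sb; rewrite -(Ea Sa) -(Eb Sb) -E.
Qed.

Lemma pure_scale n m r (a : F n m) : S n m a -> S n m (r *: a).
Proof.
have [rho rS [/= E [Ea _]]] := pS [:: Rscale r a; Rfix a].
by move=> Sa; rewrite -(Ea Sa) -E.
Qed.

Lemma pure0 n m : S n m 0.
Proof.
(* Even the empty system forces S to contain some element in each degree. *)
have [rho rS _] := pS [::].
by rewrite -(scale0r (rho n m 0)); exact: pure_scale.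
Qed.

Lemma pure_diff n m (a : F n m) : S n m a -> S n (m - 1) (cdiff (F n) m a).
Proof.
have [rho rS [/= E [Ea _]]] := pS [:: Rdiff a; Rfix a].
by move=> Sa; rewrite -(Ea Sa) -E.
Qed.

Lemma pure_ccdiff n m (a : F n m) : S n m a -> S (n - 1) m (ccdiff F n m a).
Proof.
have [rho rS [/= E [Ea _]]] := pS [:: Rccdiff a; Rfix a].
by move=> Sa; rewrite -(Ea Sa) -E.
Qed.

Definition pure_submod n m : submod (F n m) :=
  SubMod (@pure0 n m) (@pure_add n m) (@pure_scale n m).
Definition pure_subcx n : subcx (F n) :=
  SubCx (scmem := pure_submod n) (@pure_diff n).
Definition pure_subccx : subccx F := SubCCx (sccmem := pure_subcx) pure_ccdiff.

Lemma pure_solve n m (a : F n m) : S (n - 1) m (ccdiff F n m a) ->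
  exists2 s, S n m s & ccdiff F n m s = ccdiff F n m a.
Proof.
have [rho rS [/= E [Ea _]]] := pS [:: Rccdiff a; Rfix (ccdiff F n m a)].
by move=> Sa; exists (rho n m a) => //; rewrite -E Ea.
Qed.

Lemma ccproj0P n m (f : F n m) : ccproj pure_subccx n m f = 0 <-> S n m f.
Proof. exact: (@cproj0P _ _ (pure_subccx n) m f). Qed.

Lemma pure_sub_exact : ccexact F -> ccexact (ccsub pure_subccx).
Proof.
move=> Fex n m y; split=> [y0|[x <-]]; last first.
  by apply: lval_inj; exact: ccdiffK.
have /Fex [x xy] : ccdiff F (n - 1) m (lval y) = 0.
  exact: (congr1 (@lval _ _ _) y0).
have [|s Ss sx] := @pure_solve n m x; first by rewrite xy; exact: (lvalP y).
by exists (LSub (Ss : pure_submod n m s)); apply: lval_inj; rewrite -xy -sx.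
Qed.

Lemma pure_quo_exact : ccexact F -> ccexact (ccquo pure_subccx).
Proof.
move=> Fex n m y; split=> [|[x <-]]; last exact: ccdiffK.
have [x <-] := @cproj_surj _ _ (pure_subccx (n - 1)) m y.
rewrite -[cproj _ _ _]/(ccproj pure_subccx (n - 1) m x) -ccproj_diff.
move=> /cproj0P/pure_solve[s Ss /esym/eqP].
rewrite -subr_eq0 -linearB => /eqP/Fex[z zxs].
exists (ccproj pure_subccx _ m z); rewrite -ccproj_diff zxs linearB.
by rewrite (proj2 (cproj0P _ s)) ?subr0.
Qed.

End PureSub.
End Purity.

(** * Tensoring a pure subobject: the map to a reduced power *)

Section TensorPurity.
Variables (R : pzRingType) (T : tensor_theory R).
Local Notation tg := (@tgen _ T _ _ _ _).
Local Notation tm := (@tmap _ T _ _ _ _).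
Variables (F : ccomplex R) (S : ccmem F) (pS : pure S).
Arguments S : clear implicits.
Local Notation sF := (pure_subccx pS).
Local Notation incl n := (cincl (sF n)).
Local Notation idc := (cmor_id _).

Record retr := Retr {
  rfun : ccfun F;
  rfunP : forall n m f, S n m (@rfun n m f) }.
Arguments rfun : clear implicits.

Definition retr_sub (rho : retr) n m (f : F n m) : csub (sF n) m :=
  LSub (rfunP rho f : pure_submod pS n m _).

(** The filter generated by the sets of retractions that meet a finite list. Concatenating lists
    gives intersections, and purity of S says that the filter is proper, which is
    [eventually_ex]. *)
Definition eventually (P : retr -> Prop) : Prop :=
  exists l, forall rho, meets_all S (rfun rho) l -> P rho.

Lemma eventually_ex P : eventually P -> exists rho, P rho.
Proof.
by case=> l lP; have [rho rS /(lP (Retr rS)) Pr] := pS l; exists (Retr rS).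
Qed.

Lemma eventually_and P Q :
  eventually P -> eventually Q -> eventually (fun rho => P rho /\ Q rho).
Proof.
move=> [l lP] [l' lQ]; exists (l ++ l') => rho /meets_all_cat[hl hl'].
by split; [exact: lP | exact: lQ].
Qed.

Lemma eventually_mono (P Q : retr -> Prop) :
  (forall rho, P rho -> Q rho) -> eventually P -> eventually Q.
Proof. by move=> PQ [l lP]; exists l => rho /lP/PQ. Qed.

Lemma eventually1 q (P : retr -> Prop) :
  (forall rho, meets S (rfun rho) q -> P rho) -> eventually P.
Proof. by move=> qP; exists [:: q] => rho [] /qP. Qed.

Section Power.
Variables (C : complex R^c).

Definition evzero n m : set (retr -> T C (csub (sF n)) m) :=
  [set u | eventually (fun rho => u rho = 0)].

Lemma evzero0 n m : evzero (0 : retr -> T C (csub (sF n)) m).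
Proof. by exists [::]. Qed.

Lemma evzeroB n m (u v : retr -> T C (csub (sF n)) m) :
  evzero u -> evzero v -> evzero (u - v).
Proof.
move=> u0 v0; apply: eventually_mono (eventually_and u0 v0) => rho [].
by rewrite !fctE => -> ->; rewrite subrr.
Qed.

Definition rpow n m := zquo (@evzero n m).
Definition rpi n m (u : retr -> T C (csub (sF n)) m) : rpow n m :=
  zpi (@evzero n m) u.

Lemma rpi0P n m (u : retr -> T C (csub (sF n)) m) : rpi u = 0 <-> evzero u.
Proof. by apply: zquo0P; [exact: evzero0 | exact: evzeroB]. Qed.

Lemma rpiB n m (u v : retr -> T C (csub (sF n)) m) :
  rpi (u - v) = rpi u - rpi v.
Proof. exact: raddfB. Qed.

Lemma rpi_eq n m (u v : retr -> T C (csub (sF n)) m) :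
  eventually (fun rho => u rho = v rho) -> rpi u = rpi v.
Proof.
move=> uv; apply/eqP; rewrite -subr_eq0 -rpiB; apply/eqP/rpi0P.
by apply: eventually_mono uv => rho; rewrite !fctE => ->; rewrite subrr.
Qed.

Lemma rpiD n m (u v : retr -> T C (csub (sF n)) m) :
  rpi (u + v) = rpi u + rpi v.
Proof. exact: raddfD. Qed.

Lemma rpiMz n m (u : retr -> T C (csub (sF n)) m) z :
  rpi (fun rho => u rho *~ z) = rpi u *~ z.
Proof.
rewrite -[RHS](raddfMz (zpi (@evzero n m))).
apply: rpi_eq; exists [::] => rho _.
have evB : zmod_morphism
    (fun u : retr -> T C (csub (sF n)) m => u rho) by [].
exact: esym (raddfMz (mkadd evB) z u).
Qed.

Definition rmk n m k (x : C k) (y : F n (m - k)) : rpow n m :=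
  rpi (fun rho => tg x (retr_sub rho y)).

Lemma retr_sub_cast (rho : retr) n a b (e : a = b) (y : F n a) :
  retr_sub rho (ccast (F n) e y) = ccast (csub (sF n)) e (retr_sub rho y).
Proof. by case: b / e. Qed.

(** Relations in the left variable hold for every [rho]. A relation in the right variable is
    respected as soon as [rho] meets the one requirement on F that it comes from. *)
Lemma rmk_ok n m : tensor_like (tbar T) (@rmk n m).
Proof.
have [bal bd] := @tgen_ok _ T C (csub (sF n)) m.
split=> [k|hb n' k e1 e2 x y].
  have [D1 D2 Z] := bal k; split=> [x x' y|x y y'|x r y].
  - by rewrite -rpiD; apply: rpi_eq; exists [::] => rho _; rewrite D1.
  - rewrite -rpiD; apply: rpi_eq; apply: (@eventually1 (Radd y y')) => rho E.
    by rewrite fctE -D2; congr tgen; apply: lval_inj.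
  - apply: rpi_eq; apply: (@eventually1 (Rscale r y)) => rho E.
    by rewrite Z; congr tgen; apply: lval_inj.
rewrite -rpiMz -rpiD; apply/rpi0P.
apply: (@eventually1 (Rdiff y)) => rho E.
rewrite -[RHS](bd hb n' k e1 e2 x (retr_sub rho y)).
have -> : cdiff (csub (sF n)) (n' - k) (retr_sub rho y) =
  retr_sub rho (cdiff (F n) (n' - k) y) by apply: lval_inj.
by rewrite !fctE -!retr_sub_cast.
Qed.

Lemma rpow_map n m : exists2 phi : T C (F n) m -> rpow n m,
  zmod_morphism phi & forall k x y, phi (tg x y) = @rmk n m k x y.
Proof. exact: tlift (@rmk_ok n m). Qed.

Definition rphi n m : T C (F n) m -> rpow n m :=
  projT1 (cid2 (rpow_map n m)).

Lemma rphiB n m : zmod_morphism (@rphi n m).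
Proof. by rewrite /rphi; case: cid2. Qed.

Lemma rphiE n m k x y : rphi (tg x y) = @rmk n m k x y.
Proof. by rewrite /rphi; case: cid2 => phi /= _ ->. Qed.

Lemma rphi_incl n m (z : T C (csub (sF n)) m) :
  rphi (tm idc (incl n) m z) = rpi (fun=> z).
Proof.
move: z; apply: tgen_ext => [u v|u v|k x y].
- by rewrite raddfB rphiB.
- by rewrite -rpiB.
rewrite tmap_mk rphiE; apply: rpi_eq.
apply: (@eventually1 (Rfix (lval y))) => rho /(_ (lvalP y)) E.
by congr tgen; apply: lval_inj.
Qed.

(** Formulated with a representative [u] of the class of [rphi w]: evaluating [u] at a single
    retraction later yields an actual element of C (x) S. *)
Lemma rphi_ccdiff n m (w : T C (F n) m) (u : retr -> T C (csub (sF n)) m) :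
  rphi w = rpi u ->
  rphi (tm idc (ccdiff F n) m w) =
  rpi (fun rho => tm idc (ccdiff (ccsub sF) n) m (u rho)).
Proof.
pose h (u : retr -> T C (csub (sF n)) m) := rpi (fun rho =>
  tm idc (ccdiff (ccsub sF) n) m (u rho) : T C (csub (sF (n - 1))) m).
have hB : zmod_morphism h.
  by move=> a b; rewrite -rpiB; apply: rpi_eq; exists [::] => rho _;
    rewrite !fctE raddfB.
have h0 v : evzero v -> mkadd hB v = 0.
  move=> v0; apply/rpi0P; apply: eventually_mono v0 => rho ->.
  by rewrite raddf0.
pose g := zquo_lift h0.
have gE v : g (rpi v) = h v by exact: (zquo_liftE h0).
move=> wu; rewrite -[RHS]gE -wu {wu u}.
move: w; apply: tgen_ext => [u v|u v|k x y].
- by rewrite raddfB rphiB.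
- by rewrite rphiB raddfB.
rewrite tmap_mk !rphiE gE; apply: rpi_eq.
apply: (@eventually1 (Rccdiff y)) => rho E.
by rewrite tmap_mk; congr tgen; apply: lval_inj.
Qed.

Lemma rpow_surj n m (z : rpow n m) : exists u, rpi u = z.
Proof. exact: zpi_surj. Qed.

(** A constant family that is eventually zero is zero, because the filter is proper; so the
    diagonal, which is [rphi] restricted to C (x) S, is injective. *)
Lemma pure_tensor_inj n : cinj (tm (cmor_id C) (incl n)).
Proof.
move=> m z z' /eqP; rewrite -subr_eq0 -raddfB => /eqP zz'.
have : rphi (tm idc (incl n) m (z - z')) = 0.
  by rewrite zz' -[0 in LHS](subrr 0) rphiB subrr.
rewrite rphi_incl => /rpi0P/eventually_ex[_ /eqP].
by rewrite subr_eq0 => /eqP.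
Qed.

(** The equation solved by [w] becomes one that holds for eventually all retractions; any one of
    these turns [w] into a solution over S. *)
Lemma pure_tensor_solve n m (z : T C (csub (sF (n - 1))) m) w :
  tm idc (incl (n - 1)) m z = tm idc (ccdiff F n) m w ->
  exists w', tm idc (ccdiff (ccsub sF) n) m w' = z.
Proof.
have [u uw] := rpow_surj (rphi w).
move=> /(congr1 (@rphi _ _)); rewrite rphi_incl (rphi_ccdiff (esym uw)).
move/eqP; rewrite -subr_eq0 -rpiB => /eqP/rpi0P/eventually_ex[rho /eqP].
by rewrite fctE subr_eq0 => /eqP E; exists (u rho).
Qed.

End Power.
End TensorPurity.

(** * Flatness and acyclicity of pure subobjects and quotients *)

Section GoodCComplex.
Variables (R : pzRingType) (T : tensor_theory R).
Local Notation tm := (@tmap _ T _ _ _ _).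
Local Notation idc := (cmor_id _).

Definition tacyclic (C : complex R^c) (F : ccomplex R) : Prop :=
  forall n, exact_at (tm (cmor_id C) (ccdiff F n))
                     (tm (cmor_id C) (ccdiff F (n - 1))).

Definition tflat (F : complex R) : Prop :=
  forall (X' X X'' : complex R^c) (i : cmor X' X) (p : cmor X X''),
    short_exact i p ->
    short_exact (tm i (cmor_id F)) (tm p (cmor_id F)).

Lemma tmap_ccdiffK (C : complex R^c) (F : ccomplex R) n m z :
  tm (cmor_id C) (ccdiff F (n - 1)) m (tm (cmor_id C) (ccdiff F n) m z) = 0.
Proof.
rewrite -(@tmap_comp _ T _ _ _ _ _ _ idc idc _ _ idc
  (cmor_comp (ccdiff F (n - 1)) (ccdiff F n))) //.
by apply: tmap0r => k y; exact: ccdiffK.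
Qed.

Lemma tflatP (F : complex R) :
  (forall (X' X X'' : complex R^c) (i : cmor X' X) (p : cmor X X''),
     short_exact i p -> forall m z, tm i (cmor_id F) m z = 0 -> z = 0) ->
  tflat F.
Proof.
move=> Fi X' X X'' i p ip; have [_ ex sj] := ip; split.
- move=> m z z' /eqP; rewrite -subr_eq0 -raddfB => /eqP/(Fi _ _ _ _ _ ip)/eqP.
  by rewrite subr_eq0 => /eqP.
- exact: tmap_right_exactl.
- by apply: tmap_surj => // k y; exists y.
Qed.

Section Pure.
Variables (F : ccomplex R) (S : ccmem F) (pS : pure S).
Local Notation sF := (pure_subccx pS).

Lemma tmap_exch X X' Y Y' (f : cmor X X') (g : cmor Y Y') m z :
  tm idc g m (tm f idc m z) = tm f idc m (tm idc g m z).
Proof. by rewrite -!(tmap_comp (f'' := f) (g'' := g)). Qed.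

Lemma pure_sub_flat n : tflat (F n) -> tflat (csub (sF n)).
Proof.
move=> Ff; apply: tflatP => X' X X'' i p /Ff[inj _ _] m z z0.
apply: (pure_tensor_inj (pS := pS)); apply: inj.
by rewrite -tmap_exch z0 !raddf0.
Qed.

(** A chase in the three by three diagram of X', X, X'' against S, F, F/S. It combines injectivity
    of X'' (x) S -> X'' (x) F, from purity, with injectivity of X' (x) F -> X (x) F, from flatness
    of F. *)
Lemma pure_quo_flat n : tflat (F n) -> tflat (cquo (sF n)).
Proof.
move=> Ff; apply: tflatP => X' X X'' i p ip m q q0.
have [inj _ _] := Ff _ _ _ _ _ ip; have [_ iex psurj] := ip.
have sex := csub_short_exact (sF n); have [_ ex pj] := sex.
have [z zq] := @tmap_surj _ T X' X' _ _ idc (cproj (sF n))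
  (fun k y => ex_intro _ y erefl) pj m q.
have /(tmap_right_exactr ex pj)[s sz] :
    tm idc (cproj (sF n)) m (tm i idc m z) = 0.
  by rewrite tmap_exch zq.
have /(tmap_right_exactl iex psurj)[s' s's] : tm p idc m s = 0.
  apply: (pure_tensor_inj (pS := pS)); rewrite raddf0 tmap_exch sz.
  by apply/(tmap_right_exactl iex psurj); exists z.
have zE : z = tm idc (cincl (sF n)) m s'.
  by apply: inj; rewrite -tmap_exch s's sz.
by rewrite -zq zE; apply/(tmap_right_exactr ex pj); exists s'.
Qed.

Lemma pure_sub_acyclic C : tacyclic C F -> tacyclic C (ccsub sF).
Proof.
move=> Fa n m z; split=> [z0|[x <-]]; last exact: tmap_ccdiffK.
have /Fa[w wz] : tm (cmor_id C) (ccdiff F (n - 1)) m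
    (tm idc (cincl (sF (n - 1))) m z) = 0.
  transitivity (tm (cmor_id C) (cincl (sF (n - 1 - 1))) m
    (tm idc (ccdiff (ccsub sF) (n - 1)) m z)); last by rewrite z0 raddf0.
  rewrite -!(tmap_comp (f'' := idc)
    (g'' := cmor_comp (ccdiff F (n - 1)) (cincl (sF (n - 1))))) //.
exact: (pure_tensor_solve (esym wz)).
Qed.

(** Lift [q] to [z] over F. The boundary of [z] comes from C (x) S and is a boundary there by
    [pure_tensor_solve]; subtracting the corresponding [s'] makes the lift a cycle of C (x) F. *)
Lemma pure_quo_acyclic C : tacyclic C F -> tacyclic C (ccquo sF).
Proof.
move=> Fa n m q; split=> [|[x <-]]; last exact: tmap_ccdiffK.
have isurj : csurj (cmor_id C) by move=> k y; exists y.
have pi_diff k u : tm (cmor_id C) (ccdiff (ccquo sF) k) m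
    (tm idc (ccproj sF k) m u) =
    tm idc (ccproj sF (k - 1)) m (tm idc (ccdiff F k) m u).
  rewrite -!(tmap_comp (f'' := idc)
    (g'' := cmor_comp (ccproj sF (k - 1)) (ccdiff F k))) // => j y.
  exact: ccproj_diff.
have [z <-] := @tmap_surj _ T _ _ _ _ (cmor_id C) (ccproj sF (n - 1)) isurj
  (@cproj_surj _ _ _) m q.
have tex k := @tmap_right_exactr _ T C _ _ _ _ _
  (let: And3 _ e _ := csub_short_exact (sF k) in e) (@cproj_surj _ _ _).
rewrite pi_diff => /tex[s sz].
have s_cyc : tm (cmor_id C) (ccdiff (ccsub sF) (n - 1 - 1)) m s = 0.
  apply: (pure_tensor_inj (pS := pS)); rewrite raddf0.
  rewrite -[RHS](tmap_ccdiffK z) -sz.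
  by rewrite -!(tmap_comp (f'' := idc)
    (g'' := cmor_comp (ccdiff F (n - 1 - 1)) (cincl (sF (n - 1 - 1))))).
have [s' s's] := pure_tensor_solve sz.
have /Fa[w wE] : tm (cmor_id C) (ccdiff F (n - 1)) m
    (z - tm idc (cincl (sF (n - 1))) m s') = 0.
  rewrite linearB -sz -s's; apply/eqP; rewrite subr_eq0; apply/eqP.
  by rewrite -!(tmap_comp (f'' := idc)
    (g'' := cmor_comp (ccdiff F (n - 1)) (cincl (sF (n - 1))))).
exists (tm idc (ccproj sF n) m w); rewrite pi_diff wE linearB.
have -> : tm (cmor_id C) (ccproj sF (n - 1)) m
    (tm idc (cincl (sF (n - 1))) m s') = 0 by apply/tex; exists s'.
by rewrite subr0.
Qed.

End Pure.
End GoodCComplex.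

Lemma dep_choice (I : Type) (V : I -> Type) (P : forall k, V k -> Prop) :
  (forall k, exists x, P k x) -> exists f : forall k, V k, forall k, P k (f k).
Proof.
by move=> H; exists (fun k => projT1 (cid (H k))) => k; case: cid.
Qed.

(** * Direct sums of good complexes *)

Section DirectSumTensor.
Variables (R : pzRingType) (T : tensor_theory R) (I : choiceType).
Local Notation tg := (@tgen _ T _ _ _ _).
Local Notation tm := (@tmap _ T _ _ _ _).
Local Notation idc := (cmor_id _).

(** A tensor is a finite combination of generators, each of finite support. This reduces flatness
    and acyclicity of a direct sum to its summands without identifying its tensor product with a
    direct sum. *)
Lemma tensor_csum (C : complex R^c) (Y : I -> complex R) m
    (z : T C (csum Y) m) : exists s : seq I, forall r, uniq r ->
  {subset s <= r} ->
  z = \sum_(k <- r) tm idc (csum_in Y k) m (tm idc (csum_pr Y k) m z).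
Proof.
pose K : set (T C (csum Y) m) := [set z | exists s : seq I, forall r, uniq r ->
  {subset s <= r} ->
  z = \sum_(k <- r) tm idc (csum_in Y k) m (tm idc (csum_pr Y k) m z)].
suff : K z by [].
have K0 : K 0 by exists [::] => r _ _; rewrite big1 // => k _; rewrite !raddf0.
have KB u v : K u -> K v -> K (u - v).
  move=> [s su] [s' sv]; exists (s ++ s') => r ur sr.
  have Eu : u = _ := su r ur _; have Ev : v = _ := sv r ur _.
  rewrite [LHS](congr2 (fun a b => a - b) (Eu _) (Ev _)).
  - by rewrite -sumrB; apply: eq_bigr => k _; rewrite !raddfB.
  - by move=> k ks; apply: sr; rewrite mem_cat ks.
  - by move=> k ks; apply: sr; rewrite mem_cat ks orbT.
apply/(zquo0P K0 KB); move: z.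
apply: (@tgen_ext _ T _ _ _ _ (zpi K) (fun=> 0)) => [u v|u v|k x y].
- exact: raddfB.
- by rewrite subrr.
apply/(zquo0P K0 KB); have [s sy] := lsum_fin y.
exists s => r ur sr; rewrite {1}(sy r ur sr).
have tgB : zmod_morphism (fun y : csum Y (m - k) => tg x y).
  by move=> u v; rewrite tgenBr.
rewrite [LHS](raddf_sum (mkadd tgB)); apply: eq_bigr => j _ /=.
by rewrite !tmap_mk.
Qed.

Lemma csum_flat (Y : I -> complex R) :
  (forall k, tflat T (Y k)) -> tflat T (csum Y).
Proof.
move=> Yf; apply: tflatP => X' X X'' i p ip m z z0.
have [s ss] := tensor_csum z.
rewrite (ss _ (undup_uniq s) (fun k ks => etrans (mem_undup s k) ks)).
rewrite big1 // => k _; rewrite [X in tm _ _ m X](_ : _ = 0) ?raddf0 //.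
have [inj _ _] := Yf k _ _ _ _ _ ip.
by apply: inj; rewrite raddf0 -tmap_exch z0 raddf0.
Qed.

Variable F : I -> ccomplex R.

Lemma ccsum_acyclic C : (forall k, tacyclic T C (F k)) ->
  tacyclic T C (ccsum F).
Proof.
move=> Fa n m z; split=> [z0|[x <-]]; last exact: tmap_ccdiffK.
have [s ss] := tensor_csum z.
have /dep_choice[w wz] : forall k, exists w,
    tm (cmor_id C) (ccdiff (F k) n) m w =
    tm idc (csum_pr (fun k => F k (n - 1)) k) m z.
  move=> k.
  apply/Fa; transitivity (tm (cmor_id C)
    (csum_pr (fun k => F k (n - 1 - 1)) k) m
    (tm idc (ccdiff (ccsum F) (n - 1)) m z)); last by rewrite z0 raddf0.
  by rewrite -!(tmap_comp (f'' := idc) (g'' := cmor_comp (ccdiff (F k) (n - 1))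
    (csum_pr (fun k => F k (n - 1)) k))).
exists (\sum_(k <- undup s) tm idc (csum_in (fun k => F k n) k) m (w k)).
rewrite raddf_sum.
rewrite [RHS](ss _ (undup_uniq s) (fun k ks => etrans (mem_undup s k) ks)).
apply: eq_bigr => k _; rewrite -wz.
set G := cmor_comp (ccdiff (ccsum F) n) (csum_in (fun k => F k n) k).
rewrite -[LHS](tmap_comp (f'' := idc) (g'' := G)) //.
rewrite -[RHS](tmap_comp (f'' := idc) (g'' := G)) //.
by move=> j y; rewrite /= lsum_map_in.
Qed.

Lemma ccsum_exact : (forall k, ccexact (F k)) -> ccexact (ccsum F).
Proof.
move=> Fex n m z; split=> [z0|[x <-]]; last exact: ccdiffK.
have [s ss] := lsum_fin z.
have /dep_choice[w wz] : forall k, exists w, ccdiff (F k) n m w = lcoord k z.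
  move=> k.
  by apply/Fex; rewrite -[RHS](congr1 (lcoord k) z0).
exists (\sum_(k <- undup s) csum_in (fun k => F k n) k m (w k)).
rewrite raddf_sum.
rewrite [RHS](ss _ (undup_uniq s) (fun k ks => etrans (mem_undup s k) ks)).
by apply: eq_bigr => k _; rewrite -wz /= lsum_map_in.
Qed.

Lemma ccsum_Z0 (X : I -> complex R) :
  (forall k, is_Z0 (F k) (X k)) -> is_Z0 (ccsum F) (csum X).
Proof.
move=> /dep_choice[i iP].
exists (csum_map i); split=> [m x y xy|m z].
  by apply: lsum_eq => k; apply: (iP k).1; exact: (congr1 (lcoord k) xy).
split=> [z0|[x <-]]; last first.
  apply: lsum_eq => k; rewrite [RHS]linear0; apply/(iP k).2.
  by exists (lcoord k x).
have [s ss] := lsum_fin z.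
have /dep_choice[w wz] : forall k, exists w, i k m w = lcoord k z.
  move=> k.
  by apply/(iP k).2; rewrite -[RHS](congr1 (lcoord k) z0).
exists (\sum_(k <- undup s) csum_in X k m (w k)).
rewrite raddf_sum.
rewrite [RHS](ss _ (undup_uniq s) (fun k ks => etrans (mem_undup s k) ks)).
by apply: eq_bigr => k _; rewrite -wz /= lsum_map_in.
Qed.

End DirectSumTensor.

Section GF.
Variables (R : pzRingType) (T : tensor_theory R) (B : complex R^c -> Prop).

Definition tgood (F : ccomplex R) : Prop :=
  [/\ ccexact F, forall C, B C -> tacyclic T C F & forall n, tflat T (F n)].

Definition tgf (X : complex R) : Prop :=
  exists F, tgood F /\ is_Z0 F X.

Lemma pure_sub_good F (S : ccmem F) (pS : pure S) :
  tgood F -> tgood (ccsub (pure_subccx pS)).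
Proof.
case=> Fe Fa Ff; split; first exact: pure_sub_exact.
- by move=> C /Fa; exact: pure_sub_acyclic.
- by move=> n; exact: pure_sub_flat.
Qed.

Lemma pure_quo_good F (S : ccmem F) (pS : pure S) :
  tgood F -> tgood (ccquo (pure_subccx pS)).
Proof.
case=> Fe Fa Ff; split; first exact: pure_quo_exact.
- by move=> C /Fa; exact: pure_quo_acyclic.
- by move=> n; exact: pure_quo_flat.
Qed.

Lemma tgf_csum (I : choiceType) (X : I -> complex R) :
  (forall k, tgf (X k)) -> tgf (csum X).
Proof.
move=> /dep_choice[F FP].
exists (ccsum F); split; last by apply: ccsum_Z0 => k; exact: (FP k).2.
split.
- by apply: ccsum_exact => k; have [[]] := FP k.
- move=> C BC; apply: ccsum_acyclic => k; have [[_ + _] _] := FP k.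
  by move/(_ C BC).
- by move=> n; apply: csum_flat => k; have [[_ _ +] _] := FP k.
Qed.

End GF.

(** * Closures under solving diagrams *)

Section Atoms.
Variables (R : pzRingType) (Lam Lb X0 : int -> int -> Type).

Inductive atom : Type :=
| Aadd n m (a b c : Lam n m)
| Ascale n m (r : R) (a b : Lam n m)
| Adiff n m (a : Lam n m) (b : Lam n (m - 1))
| Accdiff n m (a : Lam n m) (b : Lam (n - 1) m)
| Alab n m (a : Lam n m) (l : Lb n m).

(* [Tnode a D K t] stands for the value at a of a chosen realization of the
   diagram D in which each variable b in K has the value of [t b]. *)
Inductive term : int -> int -> Type :=
| Tzero n m : term n m
| Tbase n m (x : X0 n m) : term n m
| Tnode n m (a : Lam n m) (D : set atom) (K : forall i j, set (Lam i j))
    (t : forall i j, Lam i j -> term i j) : term n m.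

Section Holds.
Variables (F : ccomplex R) (lab : forall n m, F n m -> Lb n m -> Prop).
Variable (e : forall n m, Lam n m -> F n m).

Definition holds (q : atom) : Prop :=
  match q with
  | Aadd n m a b c => e a + e b = e c
  | Ascale n m r a b => r *: e a = e b
  | Adiff n m a b => cdiff (F n) m (e a) = e b
  | Accdiff n m a b => ccdiff F n m (e a) = e b
  | Alab n m a l => lab (e a) l
  end.
End Holds.

Section MatchFun.
Variables (F F' : ccomplex R).
Variables (lab : forall n m, F n m -> Lb n m -> Prop).
Variables (lab' : forall n m, F' n m -> Lb n m -> Prop).
Variables (e : forall n m, Lam n m -> F n m).
Variables (e' : forall n m, Lam n m -> F' n m).
Hypothesis ee' : forall q, holds lab e q -> holds lab' e' q.

Definition covered n m (f : F n m) : Prop := exists i, e i = f.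

Definition match_fun n m (f : F n m) : F' n m :=
  if pselect (covered f) is left h then e' (projT1 (cid h)) else 0.

(** Atoms do not include equality, but [Ascale 1 i j] expresses it; this makes [match_fun]
    independent of the chosen index. *)
Lemma match_eq n m (i j : Lam n m) : e i = e j -> e' i = e' j.
Proof.
move=> eij; have := ee' (q := Ascale 1 i j); rewrite /= !scale1r; exact.
Qed.

Lemma match_funE n m (i : Lam n m) : match_fun (e i) = e' i.
Proof.
rewrite /match_fun; case: pselect => [h|[]]; last by exists i.
by apply: match_eq; case: (cid h).
Qed.

Lemma match_funD n m (a b : F n m) : covered a -> covered b ->
  covered (a + b) -> match_fun (a + b) = match_fun a + match_fun b.
Proof.
move=> [i <-] [j <-] [k kE]; rewrite -kE !match_funE.
by have /= := ee' (q := Aadd i j k) (esym kE).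
Qed.

Lemma match_funZ n m r (a : F n m) : covered a ->
  covered (r *: a) -> match_fun (r *: a) = r *: match_fun a.
Proof.
move=> [i <-] [k kE]; rewrite -kE !match_funE.
by have /= := ee' (q := Ascale r i k) (esym kE).
Qed.

Lemma match_fun_diff n m (a : F n m) : covered a ->
  covered (cdiff (F n) m a) ->
  match_fun (cdiff (F n) m a) = cdiff (F' n) m (match_fun a).
Proof.
move=> [i <-] [k kE]; rewrite -kE !match_funE.
by have /= := ee' (q := Adiff i k) (esym kE).
Qed.

Lemma match_fun_ccdiff n m (a : F n m) : covered a ->
  covered (ccdiff F n m a) ->
  match_fun (ccdiff F n m a) = ccdiff F' n m (match_fun a).
Proof.
move=> [i <-] [k kE]; rewrite -kE !match_funE.
by have /= := ee' (q := Accdiff i k) (esym kE).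
Qed.

Lemma match_fun_lab n m (a : F n m) l : covered a -> lab a l ->
  lab' (match_fun a) l.
Proof.
move=> [i <-] ai; rewrite match_funE.
exact: (ee' (q := Alab i l)).
Qed.

End MatchFun.

Section Closure.
Variables (F : ccomplex R) (lab : forall n m, F n m -> Lb n m -> Prop).
Variable (x0 : forall n m, X0 n m -> F n m).

Definition realize (P : (forall n m, Lam n m -> F n m) -> Prop) :
    forall n m, Lam n m -> F n m :=
  if pselect (exists e, P e) is left h then projT1 (cid h)
  else fun _ _ _ => 0.

Lemma realizeP P : (exists e, P e) -> P (realize P).
Proof. by rewrite /realize => h; case: pselect => // h'; case: (cid h'). Qed.

Fixpoint interp n m (t : term n m) : F n m :=
  match t with
  | Tzero n m => 0
  | Tbase n m x => x0 x
  | Tnode n m a D K t => realize (fun e =>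
      (forall q, D q -> holds lab e q) /\
      (forall i j (b : Lam i j), K i j b -> e i j b = interp (t i j b))) a
  end.

Definition closure n m (f : F n m) : Prop :=
  exists t, interp (t : term n m) = f.

Lemma closure_base n m (x : X0 n m) : closure (x0 x).
Proof. by exists (Tbase x). Qed.

Lemma closure0 n m : closure (0 : F n m).
Proof. by exists (Tzero n m). Qed.

(** Take the node whose diagram consists of all atoms true of [e], with those variables as constants
    whose values already lie in the closure. The family [e] itself shows that a realization exists,
    and the values of the node are again values of terms. *)
Lemma closure_sat (e : forall n m, Lam n m -> F n m) :
  exists e' : forall n m, Lam n m -> F n m,
  [/\ forall n m (i : Lam n m), closure (e' n m i),
      forall q, holds lab e q -> holds lab e' q &
      forall n m (i : Lam n m), closure (e n m i) -> e' n m i = e n m i].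
Proof.
pose D := [set q | holds lab e q].
pose K i j := [set b : Lam i j | closure (e i j b)].
have /dep_choice[t tP] i : exists t : forall j, Lam i j -> term i j,
    forall j (b : Lam i j), K i j b -> interp (t j b) = e i j b.
  suff /dep_choice[t tP] j : exists t : Lam i j -> term i j,
    forall b, K i j b -> interp (t b) = e i j b by exists t.
  suff /dep_choice[t tP] (b : Lam i j) : exists t : term i j,
    K i j b -> interp t = e i j b by exists t.
  have [[t tE]|nK] := pselect (K i j b); first by exists t.
  by exists (Tzero i j).
exists (fun n m a => interp (Tnode a D K t)).
pose Q (e : forall n m, Lam n m -> F n m) :=
  (forall q, D q -> holds lab e q) /\
  (forall i j (b : Lam i j), K i j b -> e i j b = interp (t i j b)).
have [h1 h2] : Q (realize Q).
  by apply: realizeP; exists e; split=> // i j b Kb; rewrite tP.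
split=> [n m i|//|n m i ci]; first by exists (Tnode i D K t).
by rewrite [LHS]h2 // tP.
Qed.

End Closure.
End Atoms.

(** * Finite systems as countable diagrams *)

Section Covering.
Variables (R : pzRingType) (F : ccomplex R).
Local Notation Nat := (fun _ _ : int => nat).
Implicit Types e : forall n m : int, nat -> F n m.

Definition covers e (q : req F) : Prop :=
  match q with
  | Radd n m a b => [/\ covered e a, covered e b & covered e (a + b)]
  | Rscale n m r a => covered e a /\ covered e (r *: a)
  | Rdiff n m a => covered e a /\ covered e (cdiff (F n) m a)
  | Rccdiff n m a => covered e a /\ covered e (ccdiff F n m a)
  | Rfix n m a => covered e a
  end.

Fixpoint covers_all e (l : seq (req F)) : Prop :=
  if l is q :: l' then covers e q /\ covers_all e l' else True.

Definition extends e e' := forall n m (f : F n m), covered e f -> covered e' f.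

Lemma covers_ext e e' q : extends e e' -> covers e q -> covers e' q.
Proof.
by move=> h; case: q => [n m a b|n m r a|n m a|n m a|n m a] /=;
  [case=> ? ? ?; split; apply: h|case=> ? ?; split; apply: h
  |case=> ? ?; split; apply: h|case=> ? ?; split; apply: h|apply: h].
Qed.

Lemma extends_trans e e' e'' : extends e e' -> extends e' e'' -> extends e e''.
Proof. by move=> h h' n m f /h/h'. Qed.

Lemma cover_elt e n m (f : F n m) : exists2 e', extends e e' & covered e' f.
Proof.
(* The old family is shifted by one. Index 0 receives [f] in its own degree and 0 in all others,
   [din_coord] supplying the cast. *)
exists (fun i j k => if k is k'.+1 then e i j k' else
  din_coord (T := fun s : int * int => F s.1 s.2) (k := (n, m)) f (i, j)).
  by move=> i j g [k <-]; exists k.+1.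
by exists 0%N; exact: (din_coord_id (T := fun s : int * int => F s.1 s.2)
  (k := (n, m)) f).
Qed.

Lemma cover_req e q : exists2 e', extends e e' & covers e' q.
Proof.
case: q => [n m a b|n m r a|n m a|n m a|n m a] /=.
- have [e1 h1 c1] := cover_elt e a; have [e2 h2 c2] := cover_elt e1 b.
  have [e3 h3 c3] := cover_elt e2 (a + b).
  exists e3; first exact: extends_trans (extends_trans h1 h2) h3.
  by split=> //; [apply: h3; apply: h2 | apply: h3].
- have [e1 h1 c1] := cover_elt e a; have [e2 h2 c2] := cover_elt e1 (r *: a).
  by exists e2; [exact: extends_trans h1 h2 | split=> //; apply: h2].
- have [e1 h1 c1] := cover_elt e a.
  have [e2 h2 c2] := cover_elt e1 (cdiff (F n) m a).
  by exists e2; [exact: extends_trans h1 h2 | split=> //; apply: h2].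
- have [e1 h1 c1] := cover_elt e a.
  have [e2 h2 c2] := cover_elt e1 (ccdiff F n m a).
  by exists e2; [exact: extends_trans h1 h2 | split=> //; apply: h2].
- exact: cover_elt.
Qed.

Lemma cover_reqs e l : exists2 e', extends e e' & covers_all e' l.
Proof.
elim: l => [|q l [e1 h1 c1]] /=; first by exists e => // n m f.
have [e2 h2 c2] := cover_req e1 q; exists e2; first exact: extends_trans h1 h2.
split=> //; elim: l c1 => //= q' l IH [c3 /IH c4]; split=> //.
exact: covers_ext c3.
Qed.

Lemma meets_match (Lb : int -> int -> Type)
    (lab : forall n m, F n m -> Lb n m -> Prop) (S : ccmem F)
    e (e' : forall n m : int, nat -> F n m) l :
  (forall q, holds lab e q -> holds lab e' q) ->
  (forall n m i, S n m (e n m i) -> e' n m i = e n m i) ->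
  covers_all e l -> meets_all S (match_fun e e') l.
Proof.
move=> ee' eS; elim: l => //= q l IH [cq /IH cl]; split=> //; clear IH cl.
case: q cq => [n m a b|n m r a|n m a|n m a|n m a] /=.
- by case; exact: (match_funD ee').
- by case; exact: (match_funZ ee').
- by case; exact: (match_fun_diff ee').
- by case; exact: (match_fun_ccdiff ee').
- by case=> i <- /eS Si; rewrite (match_funE ee').
Qed.

Lemma match_mem (e e' : forall n m : int, nat -> F n m) (S : ccmem F) :
  (forall n m, S n m 0) -> (forall n m i, S n m (e' n m i)) ->
  forall n m f, S n m (match_fun e e' f).
Proof. by move=> S0 Se' n m f; rewrite /match_fun; case: pselect. Qed.

Variables (Lb X0 : int -> int -> Type).
Variables (lab : forall n m, F n m -> Lb n m -> Prop).
Variable (x0 : forall n m, X0 n m -> F n m).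

(** A finite list of requirements names finitely many elements, so a diagram with countably many
    variables covers it; the whole diagram is then moved into the closure. *)
Lemma closure_pure : pure (@closure R Nat Lb X0 F lab x0).
Proof.
move=> l; have [e _ el] := cover_reqs (fun _ _ _ => 0) l.
have [e' [e'c ee' eS]] := closure_sat lab x0 (e : forall n m, Nat n m -> F n m).
exists (match_fun e e'); last first.
  exact: (meets_match ee' (S := closure Nat lab x0) eS el).
by apply: match_mem => // n m; exact: closure0.
Qed.

End Covering.

(** * Saturation *)

Definition natS (_ _ : int) : Type := nat.
Definition unitS (_ _ : int) : Type := unit.
Definition voidS (_ _ : int) : Type := void.
Definition small_term (R : pzRingType) := @term R natS unitS unitS.

Section Saturation.
Variables (R : pzRingType) (F : ccomplex R) (Lb : int -> int -> Type).
Variable lab : forall n m, F n m -> Lb n m -> Prop.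

(** The variables are [small_term R] because an entire small part P, enumerated by small terms, is
    copied as a single diagram. With no base elements, the number of terms is governed by R and the
    labels. *)
Definition saturated : ccmem F :=
  @closure R (small_term R) Lb voidS F lab (fun _ _ x => of_void _ x).

Local Notation P0 := saturated.

(** Meant for F/S with the values of psi as labels: the last clause then presents every cycle of [L]
    as a difference of two elements with the same value under psi. *)
Lemma saturated_pure_diff n0 m0 (x : F n0 m0) : ~ P0 x ->
  exists L : ccmem F, [/\ pure L, exists n m (f : F n m), L n m f /\ f <> 0 &
    forall n m f, L n m f -> ccdiff F n m f = 0 -> exists q q',
      [/\ f = q - q', ccdiff F n m q = 0 & forall l, lab q l -> lab q' l]].
Proof.
move=> nx.
(* Membership in [P0] serves as the only label, so that solutions moved into [P] keep those of their
   entries that lie in [P0] inside [P0]. *)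
pose lab1 n m (f : F n m) (_ : unitS n m) : Prop := P0 f.
pose x0 n m (_ : unitS n m) : F n m :=
  din_coord (T := fun s : int * int => F s.1 s.2) (k := (n0, m0)) x (n, m).
pose P : ccmem F := @closure R natS unitS unitS F lab1 x0.
have pP : pure P by exact: closure_pure.
have Px : P n0 m0 x.
  have := closure_base natS lab1 x0 (tt : unitS n0 m0).
  rewrite /x0 (din_coord_id (T := fun s : int * int => F s.1 s.2)
    (k := (n0, m0)) x).
  exact.
(* All of [P] as one diagram; its copy [e2] inside [P0] defines the map [g]. *)
pose e1 : forall n m, small_term R n m -> F n m :=
  fun n m t => interp lab1 x0 t.
have [e2 [e2P0 e12 e2fix]] :=
  closure_sat (Lam := small_term R) lab (fun _ _ x => of_void _ x) e1.
pose g := match_fun e1 e2.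
have cov n m (f : F n m) : P n m f <-> covered e1 f by [].
have gP0 n m (f : F n m) : P n m f -> P0 (g n m f).
  by case=> t <-; rewrite /g [match_fun _ _ _](match_funE e12); exact: e2P0.
have gfix n m (f : F n m) : P n m f -> P0 f -> g n m f = f.
  by case=> t <- h; rewrite /g [LHS](match_funE e12); exact: e2fix.
have gD n m (a b : F n m) : P n m a -> P n m b ->
    g n m (a + b) = g n m a + g n m b.
  by move=> Pa Pb; apply: (match_funD e12) => //; exact: (pure_add pP).
have gZ n m r (a : F n m) : P n m a -> g n m (r *: a) = r *: g n m a.
  by move=> Pa; apply: (match_funZ e12) => //; exact: (pure_scale pP).
have gd n m (a : F n m) : P n m a ->
    g n (m - 1) (cdiff (F n) m a) = cdiff (F n) m (g n m a).
  by move=> Pa; apply: (match_fun_diff e12) => //; exact: (pure_diff pP).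
have gcd n m (a : F n m) : P n m a ->
    g (n - 1) m (ccdiff F n m a) = ccdiff F n m (g n m a).
  by move=> Pa; apply: (match_fun_ccdiff e12) => //; exact: (pure_ccdiff pP).
have gB n m (a b : F n m) : P n m a -> P n m b ->
    g n m (a - b) = g n m a - g n m b.
  move=> Pa Pb; rewrite -scaleN1r gD ?gZ ?scaleN1r //.
  by rewrite -scaleN1r; exact: (pure_scale pP).
have PB n m (a b : F n m) : P n m a -> P n m b -> P n m (a - b).
  move=> Pa Pb; rewrite -scaleN1r; apply: (pure_add pP) => //.
  exact: (pure_scale pP).
pose dg n m (f : F n m) := f - g n m f.
(* A solution in F involving p - g p, with p in P, yields by elementarity a
   solution in P in which g p is replaced by an element of P inside P0; this
   element is fixed by g, so it disappears after applying id - g. *)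
have refl (e : forall n m, natS n m -> F n m) :
    exists e', [/\ forall n m (i : natS n m), P n m (e' n m i),
      forall q, holds lab1 e q -> holds lab1 e' q &
      forall n m (i : natS n m), P n m (e n m i) -> e' n m i = e n m i].
  exact: closure_sat.
have P00 n m : P0 (0 : F n m) by exact: closure0.
have mP0 (e e' : forall n m, natS n m -> F n m) :
    (forall q, holds lab1 e q -> holds lab1 e' q) ->
    forall n m (f : F n m), P0 f -> P0 (match_fun e e' f).
  move=> ee' n m f f0; have [cf|ncf] := pselect (covered e f).
    exact: (match_fun_lab ee' (l := tt)).
  by rewrite /match_fun; case: pselect.
have dg_sub n m (p c : F n m) : P n m p -> P n m c -> P0 c ->
    dg n m (p - c) = dg n m p.
  move=> Pp Pc P0c; by rewrite /dg gB // (gfix _ _ c) // opprB addrA subrK.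
pose L : ccmem F := fun n m f => exists2 p, P n m p & f = dg n m p.
exists L; split.
- move=> l.
  pose wit n m (f : F n m) : F n m :=
    if pselect (L n m f) is left h then s2val (cid2 h) else 0.
  have witP n m f : L n m f -> P n m (wit n m f) /\ f = dg n m (wit n m f).
    by rewrite /wit; case: pselect => // h _; split;
      [exact: (s2valP (cid2 h)) | exact: (s2valP' (cid2 h))].
  (* A constant of [L] is f = w - g w. Adding the equation f + g w = w with [w] as a constant of [P]
     ensures that the solution found in [P] yields f again after applying [dg]. *)
  pose ext_req (q : req F) : seq (req F) :=
    if q is Rfix n m f then
      [:: q; Radd f (g n m (wit n m f)); Rfix (wit n m f)] else [:: q].
  have [e _ el] := cover_reqs (fun _ _ _ => 0) (flatten (map ext_req l)).
  have [e' [e'P ee' eS]] := refl e.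
  pose rho n m (f : F n m) := dg n m (match_fun e e' f).
  have mP n m (f : F n m) : P n m (match_fun e e' f).
    by apply: match_mem => // i j; exact: (pure0 pP).
  exists rho; first by move=> n m f; exists (match_fun e e' f).
  have := meets_match (S := P) ee' eS el.
  elim: l {el} => //= q l IH /meets_all_cat[mq /IH ml]; split=> // {IH ml}.
  case: q mq => [n m a b|n m r a|n m a|n m a|n m a] /=.
  + by case=> E _; rewrite /rho /dg E gD // addrACA opprD.
  + by case=> E _; rewrite /rho /dg E gZ // scalerBr.
  + by case=> E _; rewrite /rho /dg E gd // linearB.
  + by case=> E _; rewrite /rho /dg E gcd // linearB.
  case=> _ [E [Ew _]] La; have [Pw aE] := witP _ _ _ La.
  have aw : a + g n m (wit n m a) = wit n m a.
    by rewrite {1}aE /dg subrK.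
  move: E; rewrite aw (Ew Pw) => /esym/eqP; rewrite eq_sym -subr_eq => /eqP Ea.
  rewrite /rho -Ea dg_sub -?aE //; apply: mP0 => //; exact: gP0.
- exists n0, m0, (dg _ _ x); split; first by exists x.
  move=> /eqP; rewrite subr_eq0 => /eqP xg; apply: nx; rewrite xg; exact: gP0.
move=> n m f [p Pp ->] dz.
(* The element [p] need not be a cycle. The required cycle is the image in [P] of [dg n m p]; fixing
   0 makes the boundary of this image vanish. *)
have [e _ el] := cover_reqs (fun _ _ _ => 0)
  [:: Radd (dg n m p) (g n m p); Rfix p; Rccdiff (dg n m p);
      Rfix (0 : F (n - 1) m)].
have [e' [e'P ee' eS]] := refl e.
have mP i j (z : F i j) : P i j (match_fun e e' z).
  by apply: match_mem => // *; exact: (pure0 pP).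
have /= [E [Ep [Ed [E0 _]]]] := meets_match (S := P) ee' eS el.
have pE : dg n m p + g n m p = p by rewrite /dg subrK.
move: E; rewrite pE (Ep Pp) => /eqP; rewrite -subr_eq => /eqP Ea.
have Pq := mP n m (dg n m p).
exists (match_fun e e' (dg n m p)), (g n m (match_fun e e' (dg n m p))).
split.
- rewrite -[RHS]/(dg n m (match_fun e e' (dg n m p))) -Ea.
  by rewrite [RHS]dg_sub //; apply: mP0 => //; exact: gP0.
- by rewrite -Ed dz E0 //; exact: (pure0 pP).
- by move=> l; exact: (match_fun_lab e12).
Qed.

End Saturation.

(** * Maximal pure subobjects *)

Lemma subr_trans (V : zmodType) (p s q : V) : (p - s) + (s - q) = p - q.
Proof. by rewrite addrA subrK. Qed.

Lemma addrBK (V : zmodType) (s q p : V) : s + p = q + (p + (s - q)).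
Proof. by rewrite (addrCA q) subrKC addrC. Qed.

(** * Purity is transitive along quotients *)

Section Transitivity.
Variables (R : pzRingType) (F : ccomplex R) (S : ccmem F) (pS : pure S).
Local Notation Q := (ccquo (pure_subccx pS)).
Local Notation pi := (ccproj (pure_subccx pS)).
Variables (L : ccmem Q) (pL : pure L).
Arguments S : clear implicits.
Arguments L : clear implicits.

Definition pure_preim : ccmem F := fun n m f => L n m (pi n m f).
Arguments pure_preim : clear implicits.

Let qreq (q : req F) : req Q :=
  match q with
  | Radd n m a b => Radd (pi n m a) (pi n m b)
  | Rscale n m r a => Rscale r (pi n m a)
  | Rdiff n m a => Rdiff (pi n m a)
  | Rccdiff n m a => Rccdiff (pi n m a)
  | Rfix n m a => Rfix (pi n m a)
  end.

Lemma pure_preim_sub n m f : S n m f -> pure_preim n m f.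
Proof.
move=> Sf; rewrite /pure_preim (proj2 (ccproj0P pS f) Sf); exact: (pure0 pL).
Qed.

(** Lifting a solution from F/S to F by [sg] leaves errors in S. The defect [tau] satisfies the same
    equations with these errors as constants, so a retraction onto S applied to [tau] supplies
    exactly the correction of [sg]. *)
Lemma pure_preim_pure : pure pure_preim.
Proof.
move=> l; have [rb rbL rbl] := pL (map qreq l).
pose sg n m (f : F n m) : F n m :=
  projT1 (cid (@cproj_surj _ _ (pure_subccx pS n) m (rb n m (pi n m f)))).
have sgE n m (f : F n m) : pi n m (sg n m f) = rb n m (pi n m f).
  exact: projT2 (cid (@cproj_surj _ _ _ _ _)).
pose tau n m (f : F n m) := f - sg n m f.
have SP n m (f : F n m) : pi n m f = 0 -> S n m f by move/ccproj0P.
suff [l' l'P] : exists l', forall rho, meets_all S rho l' ->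
    meets_all pure_preim (fun n m f => sg n m f + rho n m (tau n m f)) l.
  have [rho rS /l'P rl] := pS l'.
  exists (fun n m f => sg n m f + rho n m (tau n m f)) => // n m f.
  rewrite /pure_preim linearD sgE (proj2 (ccproj0P pS _) (rS _ _ _)) addr0.
  exact: rbL.
elim: l rbl => [|q l IH] /=; first by exists [::].
case=> mq /IH[l' l'P]; clear IH.
suff [l'' l''P] : exists l'', forall rho, meets_all S rho l'' ->
    meets pure_preim (fun n m f => sg n m f + rho n m (tau n m f)) q.
  exists (l'' ++ l') => rho /meets_all_cat[h h'].
  by split; [exact: l''P | exact: l'P].
clear l' l'P; case: q mq => [n m a b E|n m r a E|n m a E|n m a E|n m a E].
- have {}E : rb n m (pi n m a + pi n m b) =
      rb n m (pi n m a) + rb n m (pi n m b) := E.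
  pose ep := sg n m (a + b) - (sg n m a + sg n m b).
  have Sep : S n m ep.
    by apply: SP; rewrite linearB linearD !sgE linearD E subrr.
  exists [:: Radd (tau n m (a + b)) ep; Radd (tau n m a) (tau n m b); Rfix ep].
  move=> rho /= [E1 [E2 [/(_ Sep) E3 _]]].
  have tE : tau n m (a + b) + ep = tau n m a + tau n m b.
    by rewrite [LHS]subr_trans opprD addrACA.
  move: E1; rewrite tE E2 E3 => E1.
  by rewrite [RHS]addrACA E1; exact: addrBK.
- have {}E : rb n m (r *: pi n m a) = r *: rb n m (pi n m a) := E.
  pose ep := sg n m (r *: a) - r *: sg n m a.
  have Sep : S n m ep.
    apply: SP; rewrite linearB sgE !(linearZ_LR (pi n m)) sgE.
    by rewrite [X in X - _]E subrr.
  exists [:: Radd (tau n m (r *: a)) ep; Rscale r (tau n m a); Rfix ep].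
  move=> rho /= [E1 [E2 [/(_ Sep) E3 _]]].
  have tE : tau n m (r *: a) + ep = r *: tau n m a.
    by rewrite [LHS]subr_trans -scalerBr.
  move: E1; rewrite tE E2 E3 => E1.
  by rewrite scalerDr E1; exact: addrBK.
- have {}E : rb n (m - 1) (cdiff (Q n) m (pi n m a)) =
      cdiff (Q n) m (rb n m (pi n m a)) := E.
  pose ep := sg n (m - 1) (cdiff (F n) m a) - cdiff (F n) m (sg n m a).
  have Sep : S n (m - 1) ep.
    by apply: SP; rewrite linearB sgE !cmap_diff sgE -E subrr.
  exists [:: Radd (tau n (m - 1) (cdiff (F n) m a)) ep;
            Rdiff (tau n m a); Rfix ep].
  move=> rho /= [E1 [E2 [/(_ Sep) E3 _]]].
  have tE : tau n (m - 1) (cdiff (F n) m a) + ep = cdiff (F n) m (tau n m a).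
    by rewrite [LHS]subr_trans -linearB.
  move: E1; rewrite tE E2 E3 => E1.
  by rewrite linearD E1; exact: addrBK.
- have {}E : rb (n - 1) m (ccdiff Q n m (pi n m a)) =
      ccdiff Q n m (rb n m (pi n m a)) := E.
  pose ep := sg (n - 1) m (ccdiff F n m a) - ccdiff F n m (sg n m a).
  have Sep : S (n - 1) m ep.
    by apply: SP; rewrite linearB sgE !ccproj_diff sgE -E subrr.
  exists [:: Radd (tau (n - 1) m (ccdiff F n m a)) ep;
            Rccdiff (tau n m a); Rfix ep].
  move=> rho /= [E1 [E2 [/(_ Sep) E3 _]]].
  have tE : tau (n - 1) m (ccdiff F n m a) + ep = ccdiff F n m (tau n m a).
    by rewrite [LHS]subr_trans -linearB.
  move: E1; rewrite tE E2 E3 => E1.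
  by rewrite linearD E1; exact: addrBK.
have {}E : L n m (pi n m a) -> rb n m (pi n m a) = pi n m a := E.
exists [:: Rfix (tau n m a)] => rho /= [Et _] La.
rewrite Et; first by rewrite /tau addrC subrK.
by apply: SP; rewrite linearB sgE E ?subrr.
Qed.

End Transitivity.

Section MaximalPure.
Variables (R : pzRingType) (F : ccomplex R) (X M : complex R).
Variables (i : cmor X (F 0)) (psi : cmor X M).

Definition pure_killed (S : ccmem F) : Prop :=
  pure S /\ forall m x, S 0 m (i m x) -> psi m x = 0.

(** A finite list involves finitely many constants of the union. One member of the chain contains
    them all, and its own solution serves. *)
Lemma chain_pure (A : set (ccmem F)) (s0 : ccmem F) : A s0 ->
  (forall s, A s -> pure s) ->
  (forall s t, A s -> A t -> (forall n m f, s n m f -> t n m f) \/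
                             (forall n m f, t n m f -> s n m f)) ->
  pure (fun n m f => exists2 s, A s & s n m f).
Proof.
move=> As0 Ap tot l; pose U : ccmem F := fun n m f => exists2 s, A s & s n m f.
have [s As [rho rs rU]] : exists2 s, A s & exists2 rho : ccfun F,
    (forall n m f, s n m (rho n m f)) & meets_all U rho l.
  suff [s As sl] : exists2 s, A s & forall rho, meets_all s rho l ->
      meets_all U rho l.
    by exists s => //; have [rho rs /sl] := Ap s As l; exists rho.
  (* Strengthened to all larger [t], so that the induction survives passing to the larger of two
     members of the chain. *)
  suff [s As sl] : exists2 s, A s &
      forall t : ccmem F, (forall n m f, s n m f -> t n m f) ->
      forall rho, meets_all t rho l -> meets_all U rho l.
    by exists s => //; exact: sl.
  elim: l => [|q l [s As sl]] /=; first by exists s0.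
  have [t At tq] : exists2 t, A t &
      forall u : ccmem F, (forall n m f, t n m f -> u n m f) ->
      forall rho, meets u rho q -> meets U rho q.
    case: q => [n m a b|n m r a|n m a|n m a|n m a] /=; try by exists s0.
    have [[t At ta]|nU] := pselect (U n m a).
      by exists t => // u tu rho h _; apply/h/tu.
    by exists s0.
  have [st|ts] := tot s t As At; [exists t => // | exists s => //].
    move=> u tu rho [hq hl]; split; [exact: tq hq |].
    by apply: sl hl => n m f /st/tu.
  move=> u su rho [hq hl]; split; [|exact: sl hl].
  by apply: tq hq => n m f /ts/su.
by exists rho => // n m f; exists s.
Qed.

Lemma zero_pure : pure (fun n m (f : F n m) => f = 0).
Proof.
move=> l; exists (fun _ _ _ => 0) => //; elim: l => //= q l IH; split=> //.
case: q => [n m a b|n m r a|n m a|n m a|n m a] //=.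
- by rewrite addr0.
- by rewrite scaler0.
- by rewrite linear0.
- by rewrite linear0.
Qed.

Lemma max_pure_killed : cinj i -> exists S : ccmem F, pure_killed S /\
  forall S', pure_killed S' -> (forall n m f, S n m f -> S' n m f) ->
  forall n m f, S' n m f -> S n m f.
Proof.
move=> i_inj; pose T := {S : ccmem F | pure_killed S}.
pose rel_T (s t : T) := `[< forall n m f, sval s n m f -> sval t n m f >].
have [||s t st ts|A totA|s sP] := @Zorn T rel_T.
- by move=> s; apply/asboolP.
- by move=> s t u /asboolP st /asboolP tu; apply/asboolP => n m f /st/tu.
- case: s t st ts => s sP [t tP] /asboolP /= st /asboolP /= ts.
  have {}st : s = t.
    apply: functional_extensionality_dep => n.
    apply: functional_extensionality_dep => m.
    by apply/funext => f; apply/propext; split; [exact: st | exact: ts].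
  by case: t / st tP ts => tP _; congr exist; exact: Prop_irrelevance.
- have [[s0 As0]|nA] := pselect (exists s, A s); last first.
    (* The bound for the empty chain. *)
    have z0 : pure_killed (fun n m (f : F n m) => f = 0).
      split; first exact: zero_pure.
      move=> m x ix0; have -> : x = 0 by apply: i_inj; rewrite ix0 raddf0.
      by rewrite raddf0.
    by exists (exist _ _ z0) => s As; case: nA; exists s.
  pose A' : set (ccmem F) := [set S | exists2 s, A s & sval s = S].
  have UP : pure_killed (fun n m f => exists2 s, A' s & s n m f).
    split; last first.
      by move=> m x [_ [[s [sp sk]] As <-]] /sk.
    apply: (@chain_pure A' (sval s0)); first by exists s0.
      by move=> _ [[s [sp sk]] As <-].
    move=> _ _ [s As <-] [t At <-].
    by have [/asboolP|/asboolP] := totA s t As At; [left|right].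
  exists (exist _ _ UP) => s As; apply/asboolP => n m f sf /=.
  by exists (sval s) => //; exists s.
case: s sP => S SP Smax; exists S; split=> // S' S'P SS' n m f S'f.
have /Smax : rel_T (exist _ S SP) (exist _ S' S'P) by apply/asboolP.
by move=> -[E]; rewrite -E.
Qed.

End MaximalPure.

(** * Precovers *)

Section PureCycles.
Variables (R : pzRingType) (F : ccomplex R) (X : complex R).
Variables (i : cmor X (F 0)) (S : ccmem F) (pS : pure S).
Hypothesis i_ker : exact_at i (ccdiff F 0).
Local Notation sF := (pure_subccx pS).

Lemma pure_quo_Z0 :
  exact_at (cquo_preim i (sF 0)) (ccdiff (ccquo sF) 0).
Proof.
move=> m y; split=> [|[u <-]].
  have [f <-] := @cproj_surj _ _ (sF 0) m y.
  rewrite -[cproj _ _ _]/(ccproj sF 0 m f) -ccproj_diff.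
  move=> /(ccproj0P pS)/(pure_solve pS)[s Ss /esym/eqP].
  rewrite -subr_eq0 -linearB => /eqP/i_ker[x xE].
  exists (cproj _ m x); rewrite cquo_preimE xE.
  rewrite -[cproj _ _ _]/(ccproj sF 0 m (f - s)) linearB.
  by rewrite (proj2 (ccproj0P pS s) Ss) subr0.
have [x <-] := cproj_surj u; rewrite cquo_preimE.
rewrite -[cproj _ _ _]/(ccproj sF 0 m (i m x)) -ccproj_diff.
by rewrite (proj2 (i_ker _)) ?linear0 //; exists x.
Qed.

Lemma pure_sub_Z0 :
  exact_at (csub_preim i (sF 0)) (ccdiff (ccsub sF) 0).
Proof.
move=> m y; split=> [y0|[u <-]]; last first.
  by apply: lval_inj; apply/i_ker; exists (lval u).
have /i_ker[x xE] : ccdiff F 0 m (lval y) = 0.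
  exact: (congr1 (@lval _ _ _) y0).
have Kx : preim_subcx i (sF 0) m x by move: (lvalP y); rewrite -xE.
by exists (LSub Kx); apply: lval_inj.
Qed.

End PureCycles.

Section Precover.
Variables (R : pzRingType) (T : tensor_theory R) (B : complex R^c -> Prop).
Variable M : complex R.

Definition labM (_ m : int) : Type := M m.

(** A relation rather than a function: only elements of term 0 in the image of [i], that is cycles,
    carry a label, namely a value of [psi]. *)
Definition cycle_label (F : ccomplex R) (X : complex R) (i : cmor X (F 0))
    (psi : cmor X M) (n m : int) : F n m -> labM n m -> Prop :=
  match n return F n m -> labM n m -> Prop with
  | Posz 0 => fun f y => exists2 x, f = i m x & psi m x = y
  | _ => fun _ _ => False
  end.

Definition big_term := @term R (small_term R) labM voidS.

Record realization := Realization {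
  robj : complex R;
  rcc : ccomplex R;
  rinc : cmor robj (rcc 0);
  rmor : cmor robj M;
  renum : forall n m, big_term n m -> rcc n m;
  rgood : tgood T B rcc;
  rinc_inj : cinj rinc;
  rinc_ker : exact_at rinc (ccdiff rcc 0);
  renum_surj : forall n m f, exists t, @renum n m t = f }.

Definition rcode (r : realization) : set (atom R big_term labM) :=
  [set q | holds (@cycle_label (rcc r) (robj r) (rinc r) (rmor r))
             (@renum r) q].

(** Atoms true of one enumeration are true of the other, so matching equal terms is linear and
    commutes with both differentials. Labels are preserved, hence cycles in term 0 go to cycles with
    the same value in [M]. *)
Lemma rcode_mor (r s : realization) : rcode r = rcode s ->
  exists h : cmor (robj r) (robj s), cmor_comp (rmor s) h =c rmor r.
Proof.
move=> rs; pose lr := @cycle_label (rcc r) _ (rinc r) (rmor r).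
pose ls := @cycle_label (rcc s) _ (rinc s) (rmor s).
have ee q : holds lr (@renum r) q -> holds ls (@renum s) q.
  by move=> h; have : rcode r q by []; rewrite rs.
pose g := @match_fun R big_term (rcc r) (rcc s) (@renum r) (@renum s).
have cov n m (f : rcc r n m) : covered (@renum r) f by exact: renum_surj.
have hP m (x : robj r m) : exists y : robj s m,
    g 0 m (rinc r m x) = rinc s m y /\ rmor s m y = rmor r m x.
  have : ls 0 m (g 0 m (rinc r m x)) (rmor r m x).
    by apply: (match_fun_lab ee); [exact: cov | exists x].
  by case=> y gy yr; exists y.
have [h hE] : exists h : forall m, robj r m -> robj s m,
    forall m x, g 0 m (rinc r m x) = rinc s m (h m x) /\
                rmor s m (h m x) = rmor r m x.
  exists (fun m x => projT1 (cid (hP m x))) => m x.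
  exact: projT2 (cid (hP m x)).
have hlin m : linear (h m).
  move=> a x y; apply: rinc_inj; rewrite -(hE _ _).1 !linearP -!(hE _ _).1.
  rewrite /g (match_funD ee) //; congr (_ + _); exact: (match_funZ ee).
have hd m x : h (m - 1) (cdiff _ m x) = cdiff _ m (h m x).
  apply: rinc_inj; rewrite -(hE _ _).1 !cmap_diff -(hE _ _).1.
  exact: (match_fun_diff ee).
by exists (mkcmor hlin hd) => m x; exact: (hE m x).2.
Qed.

Lemma tgf_realization (X : complex R) (psi : cmor X M) : tgf T B X ->
  exists (r : realization) (h : cmor X (robj r)), cmor_comp (rmor r) h =c psi.
Proof.
case=> F [Fg [i [i_inj i_ker]]].
have [S [[pS Sk] Smax]] := max_pure_killed psi i_inj.
pose sF := pure_subccx pS; pose Q := ccquo sF.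
pose K := preim_subcx i (sF 0).
have KM m x : K m x -> psi m x = 0 by exact: Sk.
pose psi' := cquo_lift KM.
pose i' : cmor (cquo K) (Q 0) := cquo_preim i (sF 0).
have i'E m x : i' m (cproj K m x) = ccproj sF 0 m (i m x).
  exact: cquo_preimE.
have i'_inj : cinj i' by exact: cquo_preim_inj.
have i'_ker : exact_at i' (ccdiff Q 0) by exact: pure_quo_Z0.
have surj n m (f : Q n m) : @saturated R Q labM (cycle_label i' psi') n m f.
  apply: contrapT => nf.
  have [L [pL [n0 [m0 [f0 [Lf0 f0n]]]] Ldiff]] := saturated_pure_diff nf.
  apply: f0n; have [g gE] := @cproj_surj _ _ (sF n0) m0 f0.
  rewrite -gE; apply/(ccproj0P pS); apply: (Smax (pure_preim L)).
  - split; first exact: pure_preim_pure.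
    move=> m1 x Lx.
    have [|q [q' [qq' dq lq]]] := Ldiff _ _ _ Lx.
      by rewrite -ccproj_diff (proj2 (i_ker _ _)) ?linear0 //; exists x.
    (* The cycle of [L] given by x is q - q', where q and q' come from u and v with equal value
       under [psi']; so x is u - v modulo [K]. *)
    have [u uq] := (i'_ker _ _).1 dq.
    have [v vq' uv] : cycle_label i' psi' q' (psi' m1 u).
      by apply: lq; exists u.
    have xuv : cproj K m1 x = u - v.
      by apply: i'_inj; rewrite i'E linearB uq -vq' -qq'.
    by rewrite -(cquo_liftE KM) xuv linearB uv subrr.
  - by move=> n1 m1 f1 Sf1; exact: pure_preim_sub.
  by rewrite /pure_preim -gE in Lf0 *.
pose e : forall n m, big_term n m -> Q n m :=
  fun n m t => interp (cycle_label i' psi') (fun _ _ x => of_void _ x) t.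
exists (@Realization _ Q i' psi' e (pure_quo_good pS Fg) i'_inj i'_ker surj).
by exists (cproj K) => m x; exact: cquo_liftE.
Qed.

(** Indexing by codes rather than by realizations keeps the index type small: a code is a subset of
    a type that depends on R and M only, so the direct sum over all codes is again a complex in the
    given universe. *)
Record code_index := CodeIndex {
  ci_code : set (atom R big_term labM);
  ci_real : exists r, rcode r = ci_code }.
HB.instance Definition _ := gen_eqMixin code_index.
HB.instance Definition _ := gen_choiceMixin code_index.

Lemma tgf_precover : exists (A : complex R) (phi : cmor A M),
  tgf T B A /\ forall (X : complex R) (psi : cmor X M), tgf T B X ->
    exists f : cmor X A, cmor_comp phi f =c psi.
Proof.
pose r (c : code_index) := projT1 (cid (ci_real c)).
have rE c : rcode (r c) = ci_code c by exact: projT2 (cid (ci_real c)).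
exists (csum (fun c => robj (r c))), (csum_lift (fun c => rmor (r c))).
split.
  apply: tgf_csum => c; exists (rcc (r c)); split; first exact: rgood.
  by exists (rinc (r c)); split; [exact: rinc_inj | exact: rinc_ker].
move=> X psi /(tgf_realization psi)[s [h hE]].
pose c := CodeIndex (ex_intro _ s erefl).
have [g gE] := rcode_mor (esym (rE c) : rcode s = rcode (r c)).
exists (cmor_comp (csum_in (fun c => robj (r c)) c) (cmor_comp g h)) => m x.
rewrite -hE /= -gE; exact: (@csum_lift_in _ _ (fun c => robj (r c)) M
  (fun c => rmor (r c)) c m (g m (h m x))).
Qed.

End Precover.

(** * Cardinals *)

Lemma card_le_inj T U (A : set T) (B : set U) (f : T -> U) :
  set_fun A B f -> set_inj A f -> A #<= B.
Proof.
move=> fAB finj; have [g] : $|{injfun A >-> B}| by apply/injfunPex; exists f.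
exact: inj_card_le.
Qed.

(* A maximal set G of choice functions that are pairwise distinct in every
   coordinate must exhaust some coordinate, which is then of least
   cardinality. *)
Lemma card_min T (P : set (set T)) : (exists A, P A) ->
  exists A, P A /\ forall B, P B -> A #<= B.
Proof.
case=> A0 PA0; pose J := {A : set T | P A}.
pose ok (G : set (J -> T)) := (forall g j, G g -> sval j (g j)) /\
  (forall g h j, G g -> G h -> g j = h j -> g = h).
have [|G [[Gv Gi] Gmax]] := @Zorn_bigcup (J -> T) ok.
  move=> C Cok Ctot; split=> [g j [X CX Xg]|g h j [X CX Xg] [Y CY Yh]].
    by have [+ _] := Cok X CX; apply.
  have [XY|YX] := Ctot X Y CX CY.
    by have [_] := Cok Y CY; apply => //; exact: XY.
  by have [_] := Cok X CX; apply => //; exact: YX.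
have [j jP] : exists j, forall x, sval j x -> exists2 g, G g & g j = x.
  apply: contrapT => nj.
  have /dep_choice[g0 g0P] (j : J) : exists x, sval j x /\
      forall g, G g -> g j <> x.
    apply: contrapT => nx; apply: nj; exists j => x jx.
    apply: contrapT => ng; apply: nx; exists x; split=> // g Gg gx.
    by apply: ng; exists g.
  have lt : G `<` G `|` [set g0].
    split; first by move=> g; left.
    move=> /(_ g0 (or_intror erefl)) Gg0.
    by have [_ /(_ _ Gg0)] := g0P (exist _ A0 PA0).
  apply: (Gmax _ lt); split; first by move=> g j [/Gv //|->]; have [] := g0P j.
  move=> g h j [Gg|->] [Gh|->] //; first exact: Gi.
    by have [_ /(_ _ Gg)] := g0P j.
  by move/esym; have [_ /(_ _ Gh)] := g0P j.
exists (sval j); split=> [|B PB]; first exact: (svalP j).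
pose jB : J := exist _ B PB.
have /dep_choice[f fP] (x : T) : exists y, sval j x ->
    exists2 g, G g & g j = x /\ g jB = y.
  have [/jP[g Gg gx]|nx] := pselect (sval j x); last by exists x.
  by exists (g jB) => _; exists g.
apply: (@card_le_inj _ _ _ _ f) => [x /fP[g Gg [_ <-]]|x y].
  exact: (Gv g jB Gg).
rewrite !inE => /fP[g Gg [gx gf]] /fP[h Gh [hy hf]] fxy.
by rewrite -gx -hy (Gi g h jB Gg Gh) // gf hf.
Qed.

Lemma no_inj_powerset T (f : set T -> T) : ~ injective f.
Proof.
move=> finj; pose A : set T := [set x | exists2 S, f S = x & ~ S x].
have nA : ~ A (f A) by move=> h; case: (h) => S /finj ->; apply.
exact: (nA (ex_intro2 _ _ A erefl nA)).
Qed.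

(** * Small sets and their successor cardinal *)

Section Small.
Variable R : pzRingType.

(* What matters is that lam is infinite, at least as large as R, and that
   countable sequences in lam can be coded in lam. *)
Definition lam : Type := set (R * nat).

Definition small T (A : set T) : Prop := A #<= [set: lam].

Lemma small_injP T (A : set T) (f : T -> lam) : set_inj A f -> small A.
Proof. exact: card_le_inj. Qed.

Lemma small_exinj T (A : set T) : small A -> exists f : T -> lam, set_inj A f.
Proof.
by move=> /(@pcard_injP _ (set (R * nat)) A).
Qed.

Lemma small0 T : small (set0 : set T).
Proof. exact: card_ge0. Qed.

Lemma small_subset T (A B : set T) : A `<=` B -> small B -> small A.
Proof. by move=> AB; apply: card_le_trans; exact: subset_card_le. Qed.

Lemma small_image T U (f : T -> U) (A : set T) : small A -> small (f @` A).
Proof. by apply: card_le_trans; exact: card_image_le. Qed.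

Definition lam_seq (u : nat -> lam) : lam :=
  [set p : R * nat | exists k j : nat,
    p.2 = choice.pickle (k, j) /\ u k (p.1, j)].

Lemma lam_seqE u k r j : lam_seq u (r, choice.pickle (k, j)) <-> u k (r, j).
Proof.
split=> [[k' [j' /= [/(pcan_inj choice.pickleK) [-> ->] //]]]|h].
by exists k, j.
Qed.

Lemma lam_seq_inj : injective lam_seq.
Proof.
move=> u v uv; apply/funext => k; apply/seteqP.
by split=> -[r j] h; apply/lam_seqE; [rewrite -uv|rewrite uv]; apply/lam_seqE.
Qed.

Definition lam_pair (x y : lam) : lam :=
  lam_seq (fun k => if k is 0%N then x else y).

Lemma lam_pair_inj x y x' y' :
  lam_pair x y = lam_pair x' y' -> x = x' /\ y = y'.
Proof.
move/lam_seq_inj => h.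
by split; [exact: (congr1 (@^~ 0%N) h) | exact: (congr1 (@^~ 1%N) h)].
Qed.

(** An element is coded by the code of one index whose set contains it, paired with its code inside
    that set. *)
Lemma small_bigcup I T (D : set I) (F : I -> set T) :
  small D -> (forall i, D i -> small (F i)) -> small (\bigcup_(i in D) F i).
Proof.
move=> /small_exinj[fD fDi] Fs.
have /dep_choice[f fi] (i : I) : exists f : T -> lam, D i -> set_inj (F i) f.
  have [/Fs/small_exinj[f fi]|nD] := pselect (D i); first by exists f.
  by exists (fun=> set0).
pose U := \bigcup_(i in D) F i.
have [[i0 Di0]|D0] := pselect (exists i, D i); last first.
  apply: (small_injP (f := fun=> set0)) => x y; rewrite inE => -[i Di].
  by case: D0; exists i.
have /dep_choice[ix ixP] (x : T) : exists i : option I, U x ->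
    exists2 j, i = Some j & D j /\ F j x.
  have [[i Di Fix]|nU] := pselect (U x); last by exists None.
  by exists (Some i) => _; exists i.
pose ix' x := odflt i0 (ix x).
have ixP' x : U x -> D (ix' x) /\ F (ix' x) x.
  by rewrite /ix' => /ixP[j -> []].
apply: (small_injP (f := fun x => lam_pair (fD (ix' x)) (f (ix' x) x))).
move=> x y; rewrite !inE => /ixP'[Dx Fx] /ixP'[Dy Fy] /lam_pair_inj[].
move/fDi; rewrite !inE => /(_ Dx Dy) ixy.
rewrite -ixy in Fy * => fxy.
by apply: (fi _ Dx) => //; rewrite inE.
Qed.

Definition lam_tag (c : nat) : lam := [set p : R * nat | p.2 = c].

Lemma lam_tag_inj : injective lam_tag.
Proof.
move=> a b ab; have : lam_tag a ((0 : R), a) by [].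
by rewrite ab.
Qed.

Lemma small_nat : small [set: nat].
Proof.
by apply: (small_injP (f := lam_tag)) => x y _ _; exact: lam_tag_inj.
Qed.

Lemma small_countable (T : countType) (A : set T) : small A.
Proof.
apply: (small_injP (f := fun x => lam_tag (choice.pickle x))) => x y _ _.
by move=> /lam_tag_inj/(pcan_inj choice.pickleK).
Qed.

Lemma small_inj_into (U V : Type) (f : U -> V) (A : set V) :
  injective f -> (forall u, A (f u)) -> small A -> small [set: U].
Proof.
move=> fi fA; apply: card_le_trans.
by apply: (card_le_inj (f := f)) => [u _ //|u v _ _ /fi].
Qed.

Lemma smallU (U : Type) (A A' : set U) :
  small A -> small A' -> small (A `|` A').
Proof.
move=> sA sA'.
apply: (@small_subset _ _ (\bigcup_(b in [set: bool]) if b then A else A')).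
  by move=> x [Ax|Ax]; [exists true | exists false].
by apply: small_bigcup => [|[] _] //; exact: small_countable.
Qed.

Lemma smallX T U (A : set T) (B : set U) :
  small A -> small B -> small (A `*` B).
Proof.
move=> /small_exinj[f fi] /small_exinj[g gi].
apply: (small_injP (f := fun x => lam_pair (f x.1) (g x.2))).
move=> [x y] [x' y']; rewrite !inE /= => -[Ax By] [Ax' By'] /lam_pair_inj[].
by move=> /fi ->; rewrite ?inE // => /gi ->; rewrite ?inE.
Qed.

Lemma small_ring : small [set: R].
Proof.
apply: (small_injP (f := fun r => [set p | p.1 = r])) => x y _ _ xy.
have : [set p : R * nat | p.1 = x] (x, 0%N) by [].
by rewrite xy.
Qed.

Lemma small_lam : small [set: lam].
Proof. exact: card_lexx. Qed.

(** The successor cardinal of [lam], taken as a least non-small subset of [set lam]; such subsets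
    exist by Cantor. Cardinality below it means being small, and regularity is [small_bigcup]. *)
Lemma regular_cardinal_exists : exists kappa : Type,
  regular_cardinal kappa /\
  forall T (A : set T), card_lt A [set: kappa] <-> small A.
Proof.
have [|K [nK Kmin]] := @card_min (set lam) [set A | ~ small A].
  exists setT => /small_exinj[f fi].
  apply: (@no_inj_powerset lam f) => x y; apply: fi; exact: in_setT.
have /card_eqPle[kK Kk] : [set: K] #= K by exact: card_setT.
have nk : ~ small [set: K].
  by move=> h; apply: nK; apply: card_le_trans h; exact: Kk.
have leK : [set: lam] #<= [set: K].
  pose S : set (set lam) := range set1.
  have lS : [set: lam] #<= S.
    apply: (@card_le_inj _ _ _ _ set1) => [x _|x y _ _ xy]; first by exists x.
    by have : [set x] x by []; rewrite xy.
  have Sl : small S by apply: small_image; exact: small_lam.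
  (* A least element of the two-element family of S and K gives their comparability. *)
  have [|A [[->|->] Amin]] := @card_min (set lam) [set A | A = S \/ A = K].
  - by exists S; left.
  - apply: card_le_trans lS _.
    apply: card_le_trans (Amin K (or_intror erefl)) _.
    exact: Kk.
  by case: nK; exact: card_le_trans (Amin S (or_introl erefl)) Sl.
have ltP T (A : set T) : card_lt A [set: K] <-> small A.
  split=> [[AK nKA]|sA]; last first.
    split; first exact: card_le_trans sA leK.
    by move=> KA; apply: nk; exact: card_le_trans KA sA.
  apply: contrapT => nA; apply: nKA.
  (* Minimality of [K] concerns subsets of [set lam], so [A] is first embedded there. *)
  have /(@pcard_injP _ (set lam) A)[f fi] : A #<= [set: set lam].
    by apply: card_le_trans AK (card_le_trans kK _); exact: card_leT.
  have Af : A #<= f @` A.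
    by apply: (card_le_inj (f := f)) => // x Ax; exists x.
  apply: card_le_trans kK (card_le_trans (Kmin (f @` A) _) (card_image_le _ _)).
  by move=> h; apply: nA; exact: card_le_trans Af h.
exists K; split=> //; split.
  by apply/infiniteP; exact: card_le_trans small_nat leK.
move=> I F /ltP sI sF UT; apply: nk; rewrite -UT.
by apply: small_bigcup => // i /sF/ltP.
Qed.

End Small.

(** * Small terms form a small set *)

Section TermCardinality.
Variable R : pzRingType.

Definition lamS (_ _ : int) : Type := lam R.

Definition sort_code (k : nat) (n m : int) (a b c : nat) : nat :=
  choice.pickle (k, (n, m), (a, b, c)).

Definition atom_code (q : atom R natS unitS) : R * nat :=
  match q with
  | Aadd n m a b c => (0, sort_code 0 n m a b c)
  | Ascale n m r a b => (r, sort_code 1 n m a b 0)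
  | Adiff n m a b => (0, sort_code 2 n m a b 0)
  | Accdiff n m a b => (0, sort_code 3 n m a b 0)
  | Alab n m a _ => (0, sort_code 4 n m a 0 0)
  end.

Lemma pickle_pair_inj (T : countType) (r r' : R) (x y : T) :
  (r, choice.pickle x) = (r', choice.pickle y) -> r = r' /\ x = y.
Proof. by case=> -> /(pcan_inj choice.pickleK). Qed.

Lemma atom_code_inj : injective atom_code.
Proof.
move=> [n m a b c|n m r a b|n m a b|n m a b|n m a []]
  [n' m' a' b' c'|n' m' r' a' b'|n' m' a' b'|n' m' a' b'|n' m' a' []];
  move=> /pickle_pair_inj[E] //.
- by case=> ? ? ? ? ?; subst.
- by case=> ? ? ? ?; subst.
- by case=> ? ? ? ?; subst.
- by case=> ? ? ? ?; subst.
- by case=> ? ? ?; subst.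
Qed.

Definition step : Type := (int * int * nat)%type.

(** Branching is over the countable type [step], so a term is a labelling of countably many paths.
    At the end of a path, the index in nat selects the constructor (0), its argument (1), the
    diagram (2) or the set of constants (from 3 on). *)
Fixpoint term_code n m (t : term R natS unitS lamS n m) (p : seq step) :
    nat -> lam R :=
  match t with
  | Tzero n m => fun k =>
      if p is [::] then if k is 0%N then @lam_tag R 0 else set0 else set0
  | Tbase n m x => fun k =>
      if p is [::] then if k is 0%N then @lam_tag R 1 else x else set0
  | Tnode n m a D K t =>
      match p with
      | [::] => fun k => match k with
        | 0%N => @lam_tag R 2
        | 1%N => @lam_tag R a
        | 2%N => atom_code @` D
        | _ => [set q | exists i j b, K i j b /\
                          q = (0, choice.pickle (i, j, (b : nat)))]
        end
      | s :: p' => term_code (t s.1.1 s.1.2 s.2) p'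
      end
  end.

(** Inversion with the degrees kept fixed, for use inside the induction on another term of the same
    degrees. *)
Lemma term_cases n m (u : term R natS unitS lamS n m) :
  [\/ u = Tzero R natS unitS lamS n m, exists x, u = Tbase R natS unitS x |
      exists a D K t, u = Tnode a D K t].
Proof.
case: u => [{}n {}m|{}n {}m x|{}n {}m a D K t].
- by apply: Or31.
- by apply: Or32; exists x.
- by apply: Or33; exists a, D, K, t.
Qed.

Lemma term_code_inj n m : injective (@term_code n m).
Proof.
(* Terms with different constructors already differ at the root. *)
have tag (A B : seq step -> nat -> lam R) (a b : nat) :
    A = B -> A [::] 0%N = lam_tag a -> B [::] 0%N = lam_tag b -> a = b.
  by move=> -> -> /lam_tag_inj.
move=> t; elim: t => [{}n {}m|{}n {}m x|{}n {}m a D K t IH] u E;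
  have [Eu|[x' Eu]|[a' [D' [K' [t' Eu]]]]] := term_cases u;
  move: E; rewrite Eu => E; clear u Eu => //;
  try by have := tag _ _ _ _ E erefl erefl.
- by have /= -> := congr1 (fun f => f [::] 1%N) E.
have at1 k : term_code (Tnode a D K t) [::] k =
  term_code (Tnode a' D' K' t') [::] k by rewrite E.
have /lam_tag_inj ea : lam_tag a = lam_tag a' := at1 1%N.
have eD : D = D'.
  have h : atom_code @` D = atom_code @` D' := at1 2%N.
  apply/seteqP; split=> q Dq.
    have : (atom_code @` D') (atom_code q) by rewrite -h; exists q.
    by case=> q' D'q' /atom_code_inj <-.
  have : (atom_code @` D) (atom_code q) by rewrite h; exists q.
  by case=> q' D'q' /atom_code_inj <-.
have eK : K = K'.
  have h := at1 3%N.
  have KK (K1 K2 : forall i j, set (natS i j)) :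
    [set q : R * nat | exists i j b, K1 i j b /\
       q = (0, choice.pickle (i, j, (b : nat)))] =
    [set q | exists i j b, K2 i j b /\
       q = (0, choice.pickle (i, j, (b : nat)))] ->
    forall i j b, K1 i j b -> K2 i j b.
    move=> e i j b Kb.
    have : [set q : R * nat | exists i j b, K1 i j b /\
       q = (0, choice.pickle (i, j, (b : nat)))]
       (0, choice.pickle (i, j, (b : nat))) by exists i, j, b.
    rewrite e => -[i' [j' [b' [Kb' /pickle_pair_inj[_ [ei ej eb]]]]]].
    by subst.
  apply: functional_extensionality_dep => i.
  apply: functional_extensionality_dep => j.
  by apply/seteqP; split=> b; apply: KK.
have et : t = t'.
  apply: functional_extensionality_dep => i.
  apply: functional_extensionality_dep => j.
  apply: functional_extensionality_dep => b; apply: IH.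
  by apply/funext => p; have := congr1 (fun f => f ((i, j, b) :: p)) E.
by rewrite -ea -eD -eK -et.
Qed.

Lemma small_lam_term n m : small R [set: term R natS unitS lamS n m].
Proof.
pose f (t : term R natS unitS lamS n m) : lam R := lam_seq (fun k =>
  if @choice.unpickle (seq step * nat)%type k is Some (p, j)
  then term_code t p j else set0).
apply: (small_injP (f := f)) => t u _ _ /lam_seq_inj tu.
apply: term_code_inj; apply/funext => p; apply/funext => j.
have := congr1 (fun g => g (choice.pickle (p, j))) tu.
by rewrite /= choice.pickleK.
Qed.

End TermCardinality.

(** * Presentable and generated complexes *)

Section Product.
Variables (R : pzRingType) (I : Type) (V : I -> lmodType R).

Definition dprod : Type := forall i, V i.
HB.instance Definition _ := gen_eqMixin dprod.
HB.instance Definition _ := gen_choiceMixin dprod.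

Lemma dprod_eq (x y : dprod) : (forall i, x i = y i) -> x = y.
Proof. exact: functional_extensionality_dep. Qed.

Let p0 : dprod := fun i => 0.
Let pN (x : dprod) : dprod := fun i => - x i.
Let pD (x y : dprod) : dprod := fun i => x i + y i.
Let pZ (r : R) (x : dprod) : dprod := fun i => r *: x i.

Fact dprod_addA : associative pD.
Proof. by move=> x y z; apply: dprod_eq => i; exact: addrA. Qed.
Fact dprod_addC : commutative pD.
Proof. by move=> x y; apply: dprod_eq => i; exact: addrC. Qed.
Fact dprod_add0 : left_id p0 pD.
Proof. by move=> x; apply: dprod_eq => i; exact: add0r. Qed.
Fact dprod_addN : left_inverse p0 pN pD.
Proof. by move=> x; apply: dprod_eq => i; exact: addNr. Qed.
HB.instance Definition _ :=
  GRing.isZmodule.Build dprod dprod_addA dprod_addC dprod_add0 dprod_addN.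

Fact dprod_scaleA a b x : pZ a (pZ b x) = pZ (a * b) x.
Proof. by apply: dprod_eq => i; exact: scalerA. Qed.
Fact dprod_scale1 : left_id 1 pZ.
Proof. by move=> x; apply: dprod_eq => i; exact: scale1r. Qed.
Fact dprod_scaleDr : right_distributive pZ +%R.
Proof. by move=> a x y; apply: dprod_eq => i; exact: scalerDr. Qed.
Fact dprod_scaleDl (x : dprod) : {morph pZ^~ x : a b / a + b}.
Proof. by move=> a b; apply: dprod_eq => i; exact: scalerDl. Qed.
HB.instance Definition _ := GRing.Zmodule_isLmodule.Build R dprod
  dprod_scaleA dprod_scale1 dprod_scaleDr dprod_scaleDl.

End Product.

Section ProductComplex.
Variables (R : pzRingType) (I : Type) (X : I -> complex R).

Definition cprod_diff m (x : dprod (fun i => X i m)) :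
    dprod (fun i => X i (m - 1)) :=
  fun i => cdiff (X i) m (x i).

Fact cprod_diff_linear m : linear (@cprod_diff m).
Proof. by move=> a x y; apply: dprod_eq => i; exact: linearP. Qed.

Fact cprod_diffK m x :
  mklin (@cprod_diff_linear (m - 1)) (mklin (@cprod_diff_linear m) x) = 0.
Proof. by apply: dprod_eq => i; exact: cdiffK. Qed.

Definition cprod : complex R := @Complex R (fun m => dprod (fun i => X i m))
  (fun m => mklin (@cprod_diff_linear m)) cprod_diffK.

Lemma cprod_diffE m (x : cprod m) i : cdiff cprod m x i = cdiff (X i) m (x i).
Proof. by []. Qed.

Section Pair.
Variables (Y : complex R) (f : forall i, cmor Y (X i)).
Fact cprod_pair_linear m : linear (fun y => (fun i => f i m y) : cprod m).
Proof. by move=> a x y; apply: dprod_eq => i; exact: linearP. Qed.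
Fact cprod_pair_diff m y :
  (fun i => f i (m - 1) (cdiff Y m y)) = cdiff cprod m (fun i => f i m y).
Proof. by apply: dprod_eq => i; exact: cmap_diff. Qed.
Definition cprod_pair : cmor Y cprod :=
  mkcmor cprod_pair_linear cprod_pair_diff.
End Pair.

End ProductComplex.

Definition cmor0 (R : pzRingType) (X Y : complex R) : cmor X Y :=
  @CMor R X Y (fun m => \0%R) (fun m x => esym (linear0 (cdiff Y m))).

(** * Directed colimits and complexes with small terms *)

Section Directed.
Variables (R : pzRingType) (kappa : Type).
Hypothesis kappaP : forall T (A : set T),
  card_lt A [set: kappa] <-> small R A.
Variables (d : Order.disp_t) (I : porderType d) (D : dsystem R I).
Hypothesis Idir : directed kappa I.

Lemma directed_ub (A : set I) :
  small R A -> exists j, forall i, A i -> (i <= j)%O.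
Proof. by move=> /kappaP; exact: Idir. Qed.

Lemma directed_ub2 (i j : I) : exists k, (i <= k)%O /\ (j <= k)%O.
Proof.
have [|k kP] := @directed_ub ((fun b : bool => if b then i else j) @` setT).
  by apply: small_image; exact: small_countable.
by exists k; split; apply: kP; [exists true | exists false].
Qed.

Lemma dmap_irr i j (h h' : (i <= j)%O) : dmap D h =c dmap D h'.
Proof. by rewrite (bool_irrelevance h h'). Qed.

Variables (C : complex R) (c : forall i, cmor (D i) C).
Hypothesis cC : is_colimit c.

(** The images of the stages form a subcomplex of [C]. The projection modulo it and the zero map
    agree on the cocone, so they are equal by uniqueness. *)
Lemma colimit_surj m (x : C m) : exists i y, c i m y = x.
Proof.
have [cc cu] := cC.
have ccE i j (h : (i <= j)%O) n y : c j n (dmap D h n y) = c i n y by exact: cc.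
pose U n : set (C n) := [set x | exists i y, c i n y = x].
have U0 n : U n 0.
  by have [i _] := directed_ub (small0 R I); exists i, 0; rewrite linear0.
have UD n u v : U n u -> U n v -> U n (u + v).
  move=> [i [y <-]] [j [z <-]]; have [k [ik jk]] := directed_ub2 i j.
  by exists k, (dmap D ik n y + dmap D jk n z); rewrite linearD !ccE.
have UZ n r u : U n u -> U n (r *: u).
  by move=> [i [y <-]]; exists i, (r *: y); rewrite linearZ_LR.
have Ud n u : U n u -> U (n - 1) (cdiff C n u).
  by move=> [i [y <-]]; exists i, (cdiff _ n y); rewrite cmap_diff.
pose sU := SubCx (scmem := fun n => SubMod (@U0 n) (@UD n) (@UZ n)) Ud.
have [|u _ uP] := cu (cquo sU) (fun i => cmor0 _ _); first by [].
suff : cproj sU m x = 0 by move/cproj0P.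
rewrite (uP (cproj sU)); last by move=> i n y; apply/cproj0P; exists i, y.
by rewrite -(uP (cmor0 _ _)).
Qed.

(** The maps to all later stages form a cocone into the product of the stages modulo families that
    vanish from some index on. An element that dies in [C] dies in this quotient, hence at some
    stage. *)
Lemma colimit_kill i m (y : D i m) : c i m y = 0 ->
  exists k (h : (i <= k)%O), dmap D h m y = 0.
Proof.
have [cc cu] := cC => cy0.
pose P := cprod D.
pose E n : set (P n) := [set f | exists j0, forall j, (j0 <= j)%O -> f j = 0].
have E0 n : E n 0 by exists i.
have ED n u v : E n u -> E n v -> E n (u + v).
  move=> [j uj] [k vk]; have [l [jl kl]] := directed_ub2 j k.
  exists l => p lp; rewrite -[LHS]/(u p + v p) uj ?vk ?addr0 //.
    exact: le_trans kl lp.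
  exact: le_trans jl lp.
have EZ n r u : E n u -> E n (r *: u).
  by move=> [j uj]; exists j => p /uj up; rewrite -[LHS]/(r *: u p) up scaler0.
have Ed n u : E n u -> E (n - 1) (cdiff P n u).
  by move=> [j uj]; exists j => p /uj up; rewrite cprod_diffE up linear0.
pose sE := SubCx (scmem := fun n => SubMod (@E0 n) (@ED n) (@EZ n)) Ed.
(* Stages that are not above [a] receive 0; modulo [sE] only a tail of indices matters. *)
pose to a b : cmor (D a) (D b) :=
  if boolP (a <= b)%O is AltTrue h then dmap D h else cmor0 _ _.
have toE a b (h : (a <= b)%O) : to a b =c dmap D h.
  rewrite /to; case: {-}_ / boolP => [h'|]; first exact: dmap_irr.
  by rewrite h.
pose c' a : cmor (D a) (cquo sE) :=
  cmor_comp (cproj sE) (cprod_pair (fun b => to a b)).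
have c'P : is_cocone c'.
  move=> a b h n z.
  pose pr a := cprod_pair (fun b => to a b).
  suff /cproj0P : sE n (pr b n (dmap D h n z) - pr a n z).
    by rewrite linearB => /eqP; rewrite subr_eq0 => /eqP.
  exists b => k bk.
  rewrite -[LHS]/(to b k n (dmap D h n z) - to a k n z).
  rewrite (toE _ _ bk) (toE _ _ (le_trans h bk)).
  by rewrite (dmap_comp h bk) subrr.
have [u uc _] := cu _ _ c'P.
have /cproj0P [j0 jP] : c' i m y = 0 by rewrite -uc /= cy0 linear0.
have [k [ik jk]] := directed_ub2 i j0.
by exists k, ik; rewrite -(toE _ _ ik); exact: jP.
Qed.

Lemma small_indices (X : int -> Type) (P : forall m, X m -> I -> Prop) :
  (forall m, small R [set: X m]) ->
  (forall m s, exists k, P m s k) -> exists idx : forall m, X m -> I,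
    (forall m s, P m s (idx m s)) /\ exists k, forall m s, (idx m s <= k)%O.
Proof.
move=> Xs H; exists (fun m s => projT1 (cid (H m s))).
split=> [m s|]; first exact: projT2 (cid (H m s)).
pose A : set I := \bigcup_(m in [set: int])
  ((fun s => projT1 (cid (H m s))) @` [set: X m]).
have [|k kA] := @directed_ub A.
  apply: small_bigcup => [|m _]; first exact: small_countable.
  exact: small_image.
by exists k => m s; apply: kA; exists m => //; exists s.
Qed.

Variable S : complex R.
Hypothesis Ssmall : forall m, small R [set: S m].

(** Lift [f] elementwise to one stage. Linearity and compatibility with the differentials may fail
    there at a small set of instances only; each failure dies at some later stage, and small sets of
    indices are bounded. *)
Lemma small_hom_preserves : hom_preserves S c.
Proof.
have [cc _] := cC.
have ccE i j (h : (i <= j)%O) n y : c j n (dmap D h n y) = c i n y by exact: cc.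
have dcE i j k (hij : (i <= j)%O) (hjk : (j <= k)%O) (hik : (i <= k)%O) n y :
  dmap D hjk n (dmap D hij n y) = dmap D hik n y.
  by rewrite (dmap_comp hij hjk hik).
split=> [f|i g j h gh].
  have [i0 i0P] : exists i0, forall m s, exists y, c i0 m y = f m s.
    have [idx [iP [i0 i0P]]] := small_indices Ssmall
      (fun m s => colimit_surj (f m s)).
    exists i0 => m s; have [y yE] := iP m s.
    by exists (dmap D (i0P m s) m y); rewrite ccE.
  have /dep_choice[y yP] m : exists y : S m -> D i0 m,
      forall s, c i0 m (y s) = f m s.
    exists (fun s => projT1 (cid (i0P m s))) => s.
    exact: projT2 (cid (i0P m s)).
  have [k1 [k1i k1P]] : exists k (ik : (i0 <= k)%O), forall m r s t,
      dmap D ik m (y m (r *: s + t) - (r *: y m s + y m t)) = 0.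
    have H1 m (x : R * (S m * S m)) : exists k, exists ik : (i0 <= k)%O,
        dmap D ik m (y m (x.1 *: x.2.1 + x.2.2) -
                     (x.1 *: y m x.2.1 + y m x.2.2)) = 0.
      apply: colimit_kill; rewrite linearB yP linearP.
      by rewrite (linearP (c i0 m)) !yP subrr.
    have Xs m : small R [set: (R * (S m * S m))%type].
      rewrite -setXTT; apply: smallX; first exact: small_ring.
      by rewrite -setXTT; exact: smallX.
    have [idx [iP [k kP]]] := small_indices Xs H1.
    have [l [kl il]] := directed_ub2 k i0.
    exists l, il => m r s t; have [h hE] := iP m (r, (s, t)).
    by rewrite -(dcE _ _ _ h (le_trans (kP m _) kl)) hE linear0.
  have [k2 [k2i k2P]] : exists k (ik : (k1 <= k)%O), forall m s,
      dmap D ik (m - 1) (dmap D k1i (m - 1)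
        (y (m - 1) (cdiff S m s) - cdiff (D i0) m (y m s))) = 0.
    have H2 m s : exists k, exists ik : (k1 <= k)%O,
        dmap D ik (m - 1) (dmap D k1i (m - 1)
          (y (m - 1) (cdiff S m s) - cdiff (D i0) m (y m s))) = 0.
      by apply: colimit_kill; rewrite ccE linearB yP !cmap_diff yP subrr.
    have [idx [iP [k kP]]] := small_indices Ssmall H2.
    have [l [kl il]] := directed_ub2 k k1.
    exists l, il => m s; have [h hE] := iP m s.
    by rewrite -(dcE _ _ _ h (le_trans (kP m _) kl)) hE linear0.
  pose g m s := dmap D k2i m (dmap D k1i m (y m s)).
  have glin m : linear (g m).
    move=> a s t; apply/eqP; rewrite /g -!linearP -subr_eq0 -!linearB.
    by rewrite k1P linear0.
  have gd m s : g (m - 1) (cdiff S m s) = cdiff (D k2) m (g m s).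
    by apply/eqP; rewrite /g -!cmap_diff -subr_eq0 -!linearB k2P.
  by exists k2, (mkcmor glin gd) => m s; rewrite /= /g !ccE yP.
have [k0 [ik jk]] := directed_ub2 i j.
have H m s : exists k, exists kk : (k0 <= k)%O,
    dmap D kk m (dmap D ik m (g m s) - dmap D jk m (h m s)) = 0.
  apply: colimit_kill; rewrite linearB !ccE.
  by rewrite (gh m s : c i m (g m s) = c j m (h m s)) subrr.
have [idx [iP [k kP]]] := small_indices Ssmall H.
have [l [kl k0l]] := directed_ub2 k k0.
exists l, (le_trans ik k0l), (le_trans jk k0l) => m s.
have [hh hE] := iP m s.
rewrite /= -(dcE _ _ _ ik k0l (le_trans ik k0l)).
rewrite -(dcE _ _ _ jk k0l (le_trans jk k0l)).
apply/eqP; rewrite -subr_eq0 -linearB.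
by rewrite -(dcE _ _ _ hh (le_trans (kP m s) kl) k0l) hE linear0.
Qed.

End Directed.

(** * Small pure subobjects *)

Section LowenheimSkolem.
Variables (R : pzRingType) (F : ccomplex R).

(** The closure of A under countable diagrams, with base elements coded by [lam]; it is the image of
    a small set of terms. *)
Lemma pure_small_cover (A : ccmem F) : (forall n m, small R (A n m)) ->
  exists S : ccmem F, [/\ pure S, forall n m f, A n m f -> S n m f &
    forall n m, small R (S n m)].
Proof.
move=> As.
have /dep_choice[x0 x0P] n : exists x0 : forall m, lamS R n m -> F n m,
    forall m f, A n m f -> exists x, x0 m x = f.
  suff /dep_choice[x0 x0P] m : exists x0 : lamS R n m -> F n m,
    forall f, A n m f -> exists x, x0 x = f by exists x0.
  have [g gi] := small_exinj (As n m).
  (* Decodes an embedding of [A n m] into [lam]; elements of [lam] that code nothing are sent to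
     0. *)
  exists (fun x => if pselect (exists2 f, A n m f & g f = x) is left h
                   then s2val (cid2 h) else 0) => f Af.
  exists (g f); case: pselect => [h|[]]; last by exists f.
  by apply: gi; rewrite ?inE //; [exact: (s2valP (cid2 h)) |
    exact: (s2valP' (cid2 h))].
pose lab n m (_ : F n m) (_ : unitS n m) := True.
exists (@closure R natS unitS (lamS R) F lab x0); split.
- exact: closure_pure.
- by move=> n m f /x0P[x <-]; exact: closure_base.
move=> n m; apply: (@small_subset _ _ _
  (@interp R natS unitS (lamS R) F lab x0 n m @` setT)).
  by move=> f [t <-]; exists t.
apply: small_image; exact: small_lam_term.
Qed.

End LowenheimSkolem.

(** * Generated complexes have small terms *)

Section SmallSubcomplex.
Variables (R : pzRingType) (M : complex R).

Definition ss_ok (A : forall m, set (M m)) : Prop :=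
  [/\ forall m, A m 0, forall m x y, A m x -> A m y -> A m (x + y),
      forall m r x, A m x -> A m (r *: x),
      forall m x, A m x -> A (m - 1) (cdiff M m x) &
      forall m, small R (A m)].

Record ssub := SSub { ssm :> forall m, set (M m); ssP : ss_ok ssm }.
HB.instance Definition _ := gen_eqMixin ssub.
HB.instance Definition _ := gen_choiceMixin ssub.

Definition ss_le (a b : ssub) : bool := `[< forall m x, a m x -> b m x >].

Fact ss_le_refl : reflexive ss_le.
Proof. by move=> a; apply/asboolP. Qed.
Fact ss_le_anti : antisymmetric ss_le.
Proof.
move=> [a ha] [b hb] /andP[/asboolP ab /asboolP ba].
have eab : a = b.
  apply: functional_extensionality_dep => m.
  by apply/seteqP; split=> x; [exact: ab | exact: ba].
by case: b / eab hb {ab ba} => hb; congr SSub; exact: Prop_irrelevance.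
Qed.
Fact ss_le_trans : transitive ss_le.
Proof.
move=> b a c /asboolP ab /asboolP bc; apply/asboolP => m x /ab; exact: bc.
Qed.
Fact ss_display : Order.disp_t. Proof. exact: (Order.Disp tt tt). Qed.
HB.instance Definition _ := Order.Le_isPOrder.Build ss_display ssub
  ss_le_refl ss_le_anti ss_le_trans.

Lemma ss_leP (a b : ssub) : (a <= b)%O -> forall m x, a m x -> b m x.
Proof. by move/asboolP. Qed.

Definition ss_subcx (a : ssub) : subcx M :=
  let: And5 A0 AD AZ Ad _ := ssP a in
  SubCx (scmem := fun m => SubMod (A0 m) (@AD m) (@AZ m)) Ad.

Lemma ss_subcxE (a : ssub) m x : ss_subcx a m x <-> a m x.
Proof. by rewrite /ss_subcx; case: (ssP a). Qed.

Lemma ss_cover (A : forall m, set (M m)) : (forall m, small R (A m)) ->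
  exists a : ssub, forall m x, A m x -> a m x.
Proof.
(* With [M] as every term and zero differentials between the copies, the term of index 0 of a small
   pure subobject is a small subcomplex of [M]. *)
move=> As; pose Mc : ccomplex R :=
  @CComplex R (fun=> M) (fun=> cmor0 M M) (fun _ _ _ => erefl).
have [S [pS AS Ss]] := @pure_small_cover R Mc (fun=> A) (fun=> As).
have ok : ss_ok (S 0).
  split=> [m|m x y|m r x|m x|m]; last exact: Ss.
  - exact: (pure0 pS 0 m).
  - exact: (@pure_add _ _ _ pS 0 m).
  - exact: (@pure_scale _ _ _ pS 0 m).
  - exact: (@pure_diff _ _ _ pS 0 m).
by exists (SSub ok) => m x /(AS 0).
Qed.

Definition ss_map (a b : ssub) (h : (a <= b)%O) :
    cmor (csub (ss_subcx a)) (csub (ss_subcx b)) :=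
  @csub_map R M M (ss_subcx a) (ss_subcx b) (cmor_id M)
    (fun m x ax => (ss_subcxE b x).2 (ss_leP h ((ss_subcxE a x).1 ax))).

Fact ss_map_id a (h : (a <= a)%O) : ss_map h =c cmor_id _.
Proof. by move=> m x; exact: lval_inj. Qed.
Fact ss_map_comp a b c (hab : (a <= b)%O) (hbc : (b <= c)%O)
    (hac : (a <= c)%O) :
  ss_map hac =c cmor_comp (ss_map hbc) (ss_map hab).
Proof. by move=> m x; exact: lval_inj. Qed.

Definition ss_system : dsystem R ssub := DSystem ss_map_id ss_map_comp.

Variable kappa : Type.
Hypothesis kappaP : forall T (A : set T),
  card_lt A [set: kappa] <-> small R A.

Lemma ss_directed : directed kappa ssub.
Proof.
move=> A /kappaP sA.
have [|a aP] := @ss_cover (fun m => \bigcup_(i in A) (i m)).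
  by move=> m; apply: small_bigcup => // i _; case: (ssP i).
by exists a => i Ai; apply/asboolP => m x ix; apply: aP; exists i.
Qed.

(** Each element lies in a small subcomplex and any two of these lie in a third, so the maps of a
    cocone glue independently of the chosen stage. *)
Lemma ss_colimit : is_colimit (D := ss_system) (fun a => cincl (ss_subcx a)).
Proof.
split=> [a b h m x //|C c' cc].
have inS (a : ssub) m (x : M m) :
    a m x -> exists y : csub (ss_subcx a) m, lval y = x.
  by move=> /(ss_subcxE a) ax; exists (LSub ax).
have wd a b m (y : csub (ss_subcx a) m) (z : csub (ss_subcx b) m) :
    lval y = lval z -> c' a m y = c' b m z.
  move=> yz; have [k [ak bk]] := directed_ub2 kappaP ss_directed a b.
  rewrite -(cc _ _ ak m y) -(cc _ _ bk m z) /=; congr (c' k m _).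
  exact: lval_inj.
have ex m (x : M m) : exists a, exists y : csub (ss_subcx a) m, lval y = x.
  have [|a aP] := @ss_cover (fun k => [set din_coord (T := fun j => M j) x k]).
    move=> k; apply: (@small_subset _ _ _
      ((fun=> din_coord (T := fun j => M j) x k) @` [set: unit])).
      by move=> _ ->; exists tt.
    by apply: small_image; exact: small_countable.
  exists a; apply: inS; apply: aP.
  by rewrite /= (din_coord_id (T := fun j => M j) x).
have [u uP] : exists u : forall m, M m -> C m,
    forall m a (y : csub (ss_subcx a) m), u m (lval y) = c' a m y.
  exists (fun m x => let a := projT1 (cid (ex m x)) in
    c' a m (projT1 (cid (projT2 (cid (ex m x)))))) => m a y /=.
  apply: wd; exact: projT2 (cid (projT2 (cid (ex m (lval y))))).
have common m (x y : M m) : exists a (x' y' : csub (ss_subcx a) m),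
    lval x' = x /\ lval y' = y.
  have [a [x' x'E]] := ex m x; have [b [y' y'E]] := ex m y.
  have [k [ak bk]] := directed_ub2 kappaP ss_directed a b.
  by exists k, (ss_map ak m x'), (ss_map bk m y').
have ulin m : linear (u m).
  move=> r x y; have [a [x' [y' [<- <-]]]] := common m x y.
  by rewrite -[r *: _ + _]/(lval (r *: x' + y')) !uP linearP.
have ud m x : u (m - 1) (cdiff M m x) = cdiff C m (u m x).
  by have [a [y <-]] := ex m x; rewrite uP -cmap_diff -(uP _ a).
exists (mkcmor ulin ud) => [a m y|v vP m x]; first exact: uP.
by have [a [y <-]] := ex m x; rewrite [RHS]uP -vP.
Qed.

(** The identity of [M] factors through a stage of the directed union of small subcomplexes, so that
    stage is all of [M]. *)
Lemma generated_small : generated kappa M -> forall m, small R [set: M m].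
Proof.
move=> gM m; have [] := gM _ _ ss_system M (fun a => cincl (ss_subcx a)).
- exact: ss_directed.
- by move=> a b h k x y xy; apply: lval_inj; exact: (congr1 (@lval _ _ _) xy).
- exact: ss_colimit.
move=> /(_ (cmor_id M))[a [g gE]] _.
have [_ _ _ _ /(_ m)] := ssP a; apply: small_subset => x _.
by rewrite -[x](gE m x); apply/ss_subcxE; exact: lvalP.
Qed.

End SmallSubcomplex.

(** * The Kaplansky property *)

Section Kaplansky.
Variables (R : pzRingType) (T : tensor_theory R) (B : complex R^c -> Prop).

Lemma tgf_kaplansky : kaplansky (tgf T B).
Proof.
have [kappa [kreg kP]] := regular_cardinal_exists R.
exists kappa => // M A i [F [Fg [io [io_inj io_ker]]]] [m0 [a0 a0n]] i_inj gM.
have Ms := generated_small kP gM.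
(* The nonzero element [a0] is added since [M] may be zero, while the subobject must not be. *)
pose N m : set (A m) :=
  (i m @` setT) `|` [set din_coord (T := fun j => A j) a0 m].
have Ns m : small R (N m).
  apply: smallU; first exact: (small_image _ (Ms m)).
  apply: (@small_subset R _ _
    ((fun=> din_coord (T := fun j => A j) a0 m) @` [set: unit])).
    by move=> _ ->; exists tt.
  by apply: small_image; exact: small_countable.
pose Y : ccmem F := fun n => match n return forall m, F n m -> Prop with
  | Posz 0 => fun m f => exists2 x, N m x & io m x = f
  | _ => fun _ _ => False end.
have Ys n m : small R (Y n m).
  by case: n => [[|n]|n]; [exact: (small_image (io m) (Ns m)) |
    exact: small0 | exact: small0].
have [S [pS YS Ss]] := pure_small_cover Ys.
pose K := preim_subcx io (pure_subccx pS 0).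
have NK m x : N m x -> K m x by move=> Nx; apply: YS; exists x.
have [h hE] : exists h : cmor M (csub K), cmor_comp (cincl K) h =c i.
  by apply: csub_lift => m y; apply: NK; left; exists y.
exists (csub K), (cquo K), h, (cincl K), (cproj K); split=> //.
- move=> d I D C c Idir cC; apply: (small_hom_preserves kP Idir cC) => m.
  apply: (@small_inj_into R _ _ (fun x : csub K m => io m (lval x)) (S 0 m)).
  + by move=> x y /io_inj/lval_inj.
  + by move=> x; exact: (lvalP x).
  + exact: Ss.
- have Ka0 : K m0 a0.
    apply: NK; right.
    by rewrite /= (din_coord_id (T := fun j => A j) a0).
  exists m0, (LSub Ka0 : csub K m0) => E; apply: a0n.
  exact: (congr1 (@lval _ _ _) E).
- exact: csub_short_exact.
split.
  exists (ccsub (pure_subccx pS)); split; first exact: pure_sub_good.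
  exists (csub_preim io (pure_subccx pS 0)); split; last exact: pure_sub_Z0.
  move=> m x y xy; apply/lval_inj/io_inj.
  exact: (congr1 (@lval _ _ _) xy).
exists (ccquo (pure_subccx pS)); split; first exact: pure_quo_good.
exists (cquo_preim io (pure_subccx pS 0)); split; last exact: pure_quo_Z0.
exact: cquo_preim_inj.
Qed.

Lemma tgf_precovering : precovering (tgf T B).
Proof. by move=> M; exact: tgf_precover. Qed.

End Kaplansky.

(** * The two tensor products *)

Section DotTheory.
Variable R : pzRingType.
Implicit Types (X : complex R^c) (Y : complex R).

Lemma dot_mk_balanced X Y m k :
  balanced_biadditive (@dot_mk R X Y m k).
Proof.
split=> [x x' y|x y y'|x r y]; rewrite /dot_mk.
- by rewrite Defs.tmkDl raddfD.
- by rewrite tmkDr raddfD.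
- by rewrite tmk_balanced.
Qed.

Lemma dot_lift X Y m (C : zmodType) (f : forall k, X k -> Y (m - k) -> C) :
  (forall k, balanced_biadditive (f k)) ->
  exists2 g : {additive dot_obj X Y m -> C}, True &
    forall k x y, g (@dot_mk R X Y m k x y) = f k x y.
Proof.
move=> fb; exists (dlift (fun k => tensor_lift (fb k))) => // k x y.
by rewrite [LHS]dlift_din [LHS]tensor_lift_tmk.
Qed.

Lemma dot_tensor_ext X Y m (C : zmodType) (f g : dot_tensor X Y m -> C) :
  zmod_morphism f -> zmod_morphism g ->
  (forall k x y, f (@dot_mk R X Y m k x y) = g (@dot_mk R X Y m k x y)) ->
  f =1 g.
Proof.
move=> fB gB fg.
exact: (@dot_ext R X Y m C (@mkadd (dot_obj X Y m) C f fB)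
  (@mkadd (dot_obj X Y m) C g gB) fg).
Qed.

(** Transparent, like [bar_theory], so that flatness and acyclicity over the interface are
    convertible to the notions of the statement. *)
Definition dot_theory : tensor_theory R.
Proof.
refine (@TensorTheory R False (@dot_tensor R) (@dot_mk R) _ _ dot_tensor_ext
  (@dot_map R) _).
- by move=> X Y m; split=> // k; exact: dot_mk_balanced.
- move=> X Y m C f [fb _]; have [g _ gE] := dot_lift fb.
  by exists g => //; exact: (raddfB g).
- by move=> X X' Y Y' f g m k x y; exact: dot_map_mk.
Defined.

Definition bar_mk X Y m k (x : X k) (y : Y (m - k)) : bar_tensor X Y m :=
  bar_pi (dot_mk x y).

Lemma bar_mk_ok X Y m : tensor_like True (@bar_mk X Y m).
Proof.
split=> [k|_ n k e1 e2 x y].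
  have [D1 D2 Z] := @dot_mk_balanced X Y m k.
  split=> [x x' y|x y y'|x r y]; rewrite /bar_mk.
  - by rewrite D1; exact: raddfD.
  - by rewrite D2; exact: raddfD.
  - by rewrite Z.
(* The index equations force n = m + 1. After substitution their proofs are unique, so the casts
   become those in [dot_diff_mk]. *)
have e : n - 1 = m.
  by apply: (addIr (- (k - 1))); rewrite -e1 opprB addrA subrK.
case: m / e e1 e2 => e1 e2.
have -> : e1 = dot_index_l n k by exact: eq_irrelevance.
have -> : e2 = dot_index_r n k by exact: eq_irrelevance.
rewrite /bar_mk.
have <- : bar_pi (dot_diff (dot_mk x y)) = 0 :> bar_obj X Y (n - 1).
  apply: (@zpi_rel _ (boundary (dot_tensor X Y) (n - 1))).
  by exists n, erefl, (dot_mk x y); rewrite ccast_id.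
by rewrite dot_diff_mk [RHS]raddfD; congr (_ + _); rewrite [RHS]raddfMz.
Qed.

(** The extra condition in [tensor_like] says that the lift to the total tensor product kills the
    boundaries of generators, hence all boundaries. *)
Lemma bar_lift X Y m (C : zmodType) (f : forall k, X k -> Y (m - k) -> C) :
  tensor_like True f ->
  exists2 g : bar_tensor X Y m -> C, zmod_morphism g &
    forall k x y, g (@bar_mk X Y m k x y) = f k x y.
Proof.
move=> [fb /(_ I) fbd]; have [g _ gE] := dot_lift fb.
have g0 z : boundary (dot_tensor X Y) m z -> g z = 0.
  move=> -[n [e [w ->]]]; case: m / e f fb fbd g gE z => f fb fbd g gE _.
  rewrite ccast_id.
  apply: (@dot_ext R X Y n C (g \o @dot_diff R X Y n) \0) => k x y.
  rewrite -[LHS]/(g (dot_diff (dot_mk x y))) -[RHS]/0.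
  by rewrite dot_diff_mk raddfD raddfMz !gE fbd.
exists (zquo_lift g0); first exact: (raddfB (zquo_lift g0)).
by move=> k x y; rewrite -gE; exact: (zquo_liftE g0).
Qed.

Lemma bar_tensor_ext X Y m (C : zmodType) (f g : bar_tensor X Y m -> C) :
  zmod_morphism f -> zmod_morphism g ->
  (forall k x y, f (@bar_mk X Y m k x y) = g (@bar_mk X Y m k x y)) ->
  f =1 g.
Proof.
move=> fB gB fg z; have [w <-] := bar_pi_surj z.
have piB : zmod_morphism (@bar_pi R X Y m) by exact: raddfB.
apply: (@dot_tensor_ext X Y m C (f \o @bar_pi R X Y m) (g \o @bar_pi R X Y m))
  => // u v.
- by rewrite /= -fB; congr f; exact: piB.
- by rewrite /= -gB; congr g; exact: piB.
Qed.

Definition bar_theory : tensor_theory R.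
Proof.
refine (@TensorTheory R True (@bar_tensor R) bar_mk bar_mk_ok bar_lift
  bar_tensor_ext (@bar_map R) _).
move=> X X' Y Y' f g m k x y; apply: etrans (bar_map_pi _ _ _) _.
by rewrite dot_map_mk.
Defined.

End DotTheory.

Theorem proposition2p18 (R : pzRingType) (B : complex R^c -> Prop) :
  (precovering (gorenstein_flat B) /\ kaplansky (gorenstein_flat B)) /\
  (precovering (dot_gorenstein_flat B) /\ kaplansky (dot_gorenstein_flat B)).
Proof.
(* The two classes differ in the grouping of their conditions only; the conditions themselves agree
   by conversion. *)
have <- : tgf (bar_theory R) B = gorenstein_flat B.
  apply/funext => X; apply/propext; split.
    by case=> F [[Fe Fa Ff] FX]; exists F.
  by case=> F [Fe Fa Ff FX]; exists F.
have <- : tgf (dot_theory R) B = dot_gorenstein_flat B.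
  apply/funext => X; apply/propext; split.
    by case=> F [[Fe Fa Ff] FX]; exists F.
  by case=> F [Fe Fa Ff FX]; exists F.
by split; split; (exact: tgf_precovering || exact: tgf_kaplansky).
Qed.
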